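(* Let $(\mathcal{S}_\alpha)_{\alpha<\omega_1}$ be a transfinite Schreier sequence, let $1\leqslant\alpha<\omega_1$ and $p\in[1,\infty)$, and assume that $(\mathcal{S}_\alpha)_{\alpha<\omega_1}$ is good if $p\in(1,\infty)\setminus\{2\}$. Let $\mathbb{S}$ be the unit sphere of $X_{\mathcal{S}_\alpha,p}$ and let $T:\mathbb{S}\to\mathbb{S}$ be a surjective isometry. Then there exists a sequence of signs $(\theta_i)_{i\in\mathbb{N}}$ (i.e. $\theta_i\in\{-1,1\}$) such that $T(e_i)=\theta_i e_i$ for any $i\in\mathbb{N}$.
   Context: All vector spaces are real; $\mathbb{N}$ starts at $1$; $\omega_1$ is the first uncountable ordinal; an isometry is a distance-preserving map. For finite sets $E,E'\subset\mathbb{N}$ and $n\in\mathbb{N}$, $n\leqslant E$ means $n\leqslant\min E$ and $E<E'$ means $\max E<\min E'$; these are considered true whenever one of the sets involved is empty. A transfinite Schreier sequence is a sequence $(\mathcal{S}_\alpha)_{0\leqslant\alpha<\omega_1}$ of families of finite subsets of $\mathbb{N}$ such that: $\mathcal{S}_0=\{F\subset\mathbb{N}: |F|\leqslant1\}$; $\mathcal{S}_{\beta+1}=\{\bigcup_{i=1}^nE_i:\ n\in\mathbb{N},\ n\leqslant E_1<E_2<\dots<E_n,\ E_i\in\mathcal{S}_\beta\}$ for every $\beta<\omega_1$; and for limit $\alpha$, $\mathcal{S}_\alpha=\{F\subset\mathbb{N}: F\in\mathcal{S}_{\alpha_n}\text{ for some }n\leqslant F\}$, where $(\alpha_n)_{n\in\mathbb{N}}$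 is a preassigned strictly increasing sequence of non-zero ordinals with $\sup_n\alpha_n=\alpha$ (the approximating sequence of $\alpha$). The sequence $(\mathcal{S}_\alpha)_{\alpha<\omega_1}$ is good if for every limit ordinal $\alpha<\omega_1$ the approximating sequence consists of successor ordinals $\alpha_n=\beta_n+1$ and $(\mathcal{S}_{\beta_n})_{n\in\mathbb{N}}$ is increasing for inclusion. Let $c_{00}$ be the space of finitely supported real sequences, with canonical basis $(e_i)_{i\in\mathbb{N}}$. For $p\in[1,\infty)$, $X_{\mathcal{S}_\alpha,p}$ is the completion of $c_{00}$ for the norm $\|x\|=\sup\{(\sum_{i\in F}|x(i)|^p)^{1/p}: F\in\mathcal{S}_\alpha\}$. *)

(* Defs.v *)
From HB Require Import structures.
From mathcomp Require Import all_boot all_order all_algebra finmap.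
From mathcomp Require Import all_classical all_reals all_analysis.
Import Order.TTheory GRing.Theory Num.Theory.
Import numFieldNormedType.Exports.

Set Implicit Arguments.
Unset Strict Implicit.
Unset Printing Implicit Defensive.

Local Open Scope classical_set_scope.
Local Open Scope ring_scope.

Notation posn := {n : nat | (0 < n)%N}.

(* The order type of [W] is the first uncountable ordinal: an uncountable
   well-order all of whose proper initial segments are countable.  The elements
   of [W] play the role of the ordinals below omega_1. *)
Definition is_omega1 (d : Order.disp_t) (W : orderType d) : Prop :=
  [/\ wochoice.well_order (<=%O : rel W),
      (forall a : W, countable [set b | (b < a)%O])
    & ~ countable [set: W]].

Section Ordinals.
Context {d : Order.disp_t} {W : orderType d}.

Definition ord_zero (a : W) : Prop := forall b, (a <= b)%O.

Definition ord_succ (b a : W) : Prop :=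
  (b < a)%O /\ forall c, (b < c)%O -> (a <= c)%O.

Definition ord_limit (a : W) : Prop :=
  ~ ord_zero a /\ ~ exists b, ord_succ b a.

End Ordinals.

(* [nle_fset n E] is "n <= E" and [fset_lt E E'] is "E < E'"; with these
   universally quantified forms both hold whenever a set involved is empty. *)
Definition nle_fset (n : posn) (E : {fset posn}) : Prop :=
  forall k, k \in E -> (val n <= val k)%N.

Definition fset_lt (E E' : {fset posn}) : Prop :=
  forall k l, k \in E -> l \in E' -> (val k < val l)%N.

(* "n <= E_1 < ... < E_n" is required for all pairs, not just consecutive ones:
   otherwise an empty E_i would disconnect the chain. *)
Definition schreier_succ (A : set {fset posn}) : set {fset posn} :=
  [set F | exists (n : posn) (E : 'I_(val n) -> {fset posn}),
    [/\ (forall i, A (E i)),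
        (forall i, nle_fset n (E i)),
        (forall i j : 'I_(val n), (i < j)%N -> fset_lt (E i) (E j))
      & F = \big[fsetU/fset0]_(i < val n) E i]].

Section Schreier.
Context {d : Order.disp_t} {W : orderType d}.

(* [appr a] is the approximating sequence of [a]; its values matter only when
   [a] is a limit ordinal. *)
Definition approximating (appr : W -> posn -> W) : Prop :=
  forall a, ord_limit a ->
    [/\ (forall m n : posn, (val m < val n)%N -> (appr a m < appr a n)%O),
        (forall n, ~ ord_zero (appr a n))
      & supremums (range (appr a)) a].

Definition transfinite_schreier (appr : W -> posn -> W)
    (S : W -> set {fset posn}) : Prop :=
  [/\ approximating appr,
      (forall a, ord_zero a -> S a = [set F : {fset posn} | (#|` F| <= 1)%N]),
      (forall b a, ord_succ b a -> S a = schreier_succ (S b))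
    & (forall a, ord_limit a ->
         S a = [set F | exists n : posn, nle_fset n F /\ S (appr a n) F])].

Definition good_schreier (appr : W -> posn -> W)
    (S : W -> set {fset posn}) : Prop :=
  forall a, ord_limit a -> exists b : posn -> W,
    (forall n, ord_succ (b n) (appr a n)) /\
    (forall m n : posn, (val m <= val n)%N -> S (b m) `<=` S (b n)).

End Schreier.

Section C00.
Variable R : realType.

Definition finsupp_pred : {pred posn -> R} :=
  fun x => `[< finite_set [set i | x i != 0] >].

Fact finsupp_submod_closed : submod_closed finsupp_pred.
Proof.
split=> [|a x y /asboolP fx /asboolP fy]; apply/asboolP.
  rewrite (_ : [set _ | _] = set0) //; apply/seteqP; split=> // i /=.
  by rewrite eqxx.
apply: (@sub_finite_set _ _ ([set i | x i != 0] `|` [set i | y i != 0])).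
  move=> i /= xyi; have [xi|] := eqVneq (x i) 0; [right | by left].
  apply: contra_neq xyi => yi.
  by rewrite -[LHS]/(a * x i + y i) xi yi mulr0 addr0.
by rewrite finite_setU.
Qed.

HB.instance Definition _ :=
  GRing.isSubmodClosed.Build R (posn -> R) finsupp_pred finsupp_submod_closed.

Record c00 := C00 {
  c00_fun :> posn -> R;
  c00_finsupp : c00_fun \in finsupp_pred }.

HB.instance Definition _ := [isSub for c00_fun].
HB.instance Definition _ := [Choice of c00 by <:].
HB.instance Definition _ := [SubChoice_isSubLmodule of c00 by <:].

Fact basis_finsupp (i : posn) :
  (fun j : posn => (j == i)%:R : R) \in finsupp_pred.
Proof.
apply/asboolP; apply: (@sub_finite_set _ _ [set i]); last exact: finite_set1.
by move=> j /=; have [//|_] := eqVneq j i; rewrite mulr0n eqxx.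
Qed.

Definition c00_basis (i : posn) : c00 := C00 (basis_finsupp i).

Definition schreier_norm (p : R) (A : set {fset posn}) (x : c00) : R :=
  sup [set (\sum_(i <- F) `|x i| `^ p) `^ p^-1 | F in A].

End C00.

(* [X] together with [iota] is the completion of c00 for the norm [N]. *)
Definition is_completion (R : realType) (N : c00 R -> R)
    (X : completeNormedModType R) (iota : {linear c00 R -> X}) : Prop :=
  (forall x, `|iota x| = N x) /\ dense (range iota).

Definition unit_sphere (R : realType) (X : normedModType R) : set X :=
  [set x | `|x| = 1].

Arguments unit_sphere {R} X _.

(* Main.v *)
Require Import Defs.
From HB Require Import structures.
From mathcomp Require Import all_boot all_order all_algebra finmap.
From mathcomp Require Import all_classical all_reals all_analysis.
From mathcomp Require Import zify ring lra.
Import Order.TTheory GRing.Theory Num.Theory.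
Import numFieldNormedType.Exports.

Set Implicit Arguments.
Unset Strict Implicit.
Unset Printing Implicit Defensive.

Local Open Scope classical_set_scope.
Local Open Scope ring_scope.

(* Every set of the family containing 1 is {1}, so e_1 spans an l^oo-summand;
   {e_1, -e_1} is the only pair at distance 2 whose unit balls cover the sphere.
   Hence T fixes e_1 up to sign and preserves the sphere of the closed span of
   the other e_i, to which everything below refers.

   There the set of all e_i and -e_i is recognized metrically.  If p > 1, the
   points x having -x as their only point at distance 2 are the unit vectors
   whose support F stays in the family when any one point is added to it.  Among
   them v is one of the e_i, -e_i unless some other one y satisfies
   |v - y|^p < 2 and |v + y|^p < 2; if F has two elements, such a y is spread
   evenly over a set G disjoint from F with F u G outside the family.  If p = 1,
   call y maximal when it is determined by the points at distance 2 from it.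
   Then one of y - e_i, y + e_i has norm 2, while any pair (v, w) not of the
   form (e_j, -e_j) or (-e_j, e_j) admits a maximal y at distance less than 2
   from both.  This y has modulus 1/r on an interval [3, K] and 1 - q/r at 2, and
   0 elsewhere.

   So T e_i = +-e_pi(i).  As x_i = 0 if and only if |x - e_i| = |x + e_i|, the
   bijection pi transports supports, and comparing the values of |x + e_a| for x
   flat on a set H shows that pi and its inverse preserve the family.  Finally,
   if i < j and {i} u G is in the family, j < G, then {j, m} u G is in the family
   for all m between j and G; by compactness {j} u G may therefore be in the
   family without {i} u G, while the converse is impossible.  So pi is
   increasing, hence the identity. *)
(** * Families of finite sets *)

(** Nothing is known of [T] off the sphere, neither linearity nor oddness, so every object must be
    recognised by distances alone, and [T] is always treated together with its inverse. The code
    numbers the basis from 0: index [k] stands for the integer [k.+1], so the isolated vector is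
    [e 0] and the interval [3, K] starts at index 2. The integer 2 (index 1) is delicate. A set
    containing it has at most two blocks at every successor step, so replacing a point by two later
    ones, elsewhere paid for by a larger minimum, needs its own argument. Blockers and windows
    therefore distinguish sets with and without index 1. The norm is a supremum that may not be
    attained, so a strict inequality on each set of the family is not enough. Comparisons are made
    with a margin uniform over the family, taken for instance from the least nonzero modulus of a
    finitely supported vector or from a bound on tails. For p = 1 strict convexity is lost: a point
    may have many points at distance 2, and the set of all of them takes over the part of the
    antipode. *)

Section Families.
Local Open Scope fset_scope.
Local Open Scope nat_scope.
Implicit Types (A : set {fset nat}) (F G H E L : {fset nat}).

Definition hereditary A := forall F G, A F -> G `<=` F -> A G.

Definition shiftable A :=
  forall F i, A F -> i \in F -> i.+1 \notin F -> A (i.+1 |` (F `\ i)).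

Definition prefix_fset (m : nat -> nat) k := [fset x in map m (iota 0 k)].

Definition compact_family A :=
  forall m, {homo m : i j / i < j} -> exists k, ~ A (prefix_fset m k).

Definition before E G := forall k l, k \in E -> l \in G -> k < l.

(** If [i.+1] already lies in [G], the point [i] is blocked. Then the blocking point travels to [j]
    first and [i] steps into the vacated place, which results in the same set as a direct move. *)
Lemma exchange A (i j : nat) G : hereditary A -> shiftable A ->
  i \notin G -> i <= j -> A (i |` G) -> A (j |` G).
Proof.
move=> hA sA; move: {2}(j - i) (erefl (j - i)) => d.
elim: d i G => [|d IH] i G dE iG ij AG.
  by rewrite (_ : j = i) //; lia.
have [jG|jG] := boolP (j \in G).
  apply: hA AG _; apply/fsubsetP=> x; rewrite !inE => /orP[/eqP->|->].
    by rewrite jG orbT.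
  by rewrite orbT.
have jNi : j != i by lia.
have [i1G|i1G] := boolP (i.+1 \in G); last first.
  apply: (IH i.+1) => //; try lia.
  have -> : i.+1 |` G = i.+1 |` ((i |` G) `\ i).
    by apply/fsetP=> x; rewrite !inE; case: (eqVneq x i) => [->|]; rewrite ?(negPf iG).
  apply: sA => //; rewrite !inE ?eqxx // negb_or i1G andbT; lia.
have jNi1 : j != i.+1 by apply: contraNneq jG => ->.
set G' := G `\ i.+1.
have GE : G = i.+1 |` G' by rewrite fsetD1K.
have iG' : i \notin G' by rewrite !inE (negPf iG) andbF.
have i1G'' : i.+1 \notin i |` G' by rewrite !inE eqxx /= orbF; lia.
have Ai1 : A (i.+1 |` (i |` G')) by rewrite fsetUCA -GE.
have /sA : A (j |` (i |` G')) by apply: (IH i.+1) => //; lia.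
move=> /(_ i); rewrite !inE eqxx orbT => /(_ isT).
have -> : [|| i.+1 == j, i.+1 == i | (i.+1 != i.+1) && (i.+1 \in G)] = false.
  by rewrite eqxx /= orbF; lia.
move=> /(_ isT); congr A; apply/fsetP=> x; rewrite GE !inE.
case: (eqVneq x i) => [->|]; first by rewrite /= (negPf iG) andbF !orbF; lia.
by case: (eqVneq x i.+1); case: (eqVneq x j); rewrite //= ?orbT.
Qed.

(* Elements of [H `\` H'] are exchanged one by one for elements of [H' `\` H],
   so only these have to be compared. *)
Lemma exchange_fset A L H H' : hereditary A -> shiftable A ->
  [disjoint L & H] -> [disjoint L & H'] -> #|` H'| <= #|` H| ->
  (forall h h', h \in H -> h' \in H' -> h \notin H' -> h' \notin H -> h <= h') ->
  A (L `|` H) -> A (L `|` H').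
Proof.
move=> hA sA LH LH' cH; move: {2}#|` H' `\` H| (erefl #|` H' `\` H|) => n.
elim: n H LH cH => [|n IH] H LH cH nE hh' AH.
  apply: hA AH _; apply: fsetUS; rewrite -fsetD_eq0.
  by rewrite -cardfs_eq0 nE.
have [h'] : exists h', h' \in H' `\` H.
  by apply/fset0Pn; rewrite -cardfs_eq0 nE.
rewrite inE => /andP[h'H h'H'].
have [h] : exists h, h \in H `\` H'.
  apply/fset0Pn; rewrite -cardfs_eq0.
  have := cardfsID H' H; have := cardfsID H H'; rewrite fsetIC; lia.
rewrite inE => /andP[hH' hH].
have LhH x : x \in L -> (x \in H = false) * (x \in H' = false).
  move=> xL; split; apply/negP => xH.
    by move/fdisjointP/(_ _ xL): LH; rewrite xH.
  by move/fdisjointP/(_ _ xL): LH'; rewrite xH.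
have hL : h \notin L by apply/negP => /LhH[]; rewrite hH.
have h'L : h' \notin L by apply/negP => /LhH[_]; rewrite h'H'.
have hNh' : h != h' by apply: contraNneq hH' => ->.
apply: (IH (h' |` (H `\ h))).
- apply/fdisjointP => x xL; rewrite !inE (LhH _ xL) andbF orbF.
  by apply: contraNneq h'L => <-.
- by rewrite cardfsU1 !inE (negPf h'H) andbF /=; move: cH; rewrite (cardfsD1 h H) hH.
- apply/eqP; rewrite -eqSS -nE (cardfsD1 h' (H' `\` H)) !inE h'H h'H' /= add1n eqSS.
  apply/eqP; congr #|` _|; apply/fsetP=> x; rewrite !inE negb_or negb_and negbK.
  case: (eqVneq x h') => //= _; case: (eqVneq x h) => [->|] //=.
  by rewrite (negPf hH') andbF.
- move=> x x'; rewrite !inE => /orP[/eqP->|/andP[xh xH]] x'H' xH'.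
    by rewrite h'H' in xH'.
  rewrite negb_or negb_and negbK => /andP[_ /orP[/eqP x'E|x'H]].
    by move: hH'; rewrite -x'E x'H'.
  exact: hh'.
have -> : L `|` (h' |` (H `\ h)) = h' |` (L `|` (H `\ h)) by rewrite fsetUCA.
apply: (@exchange _ h) => //.
- by rewrite !inE eqxx /= orbF.
- exact: hh'.
- by rewrite fsetUCA fsetD1K.
Qed.

(** Each block is compared with the whole remainder, which keeps the order correct across empty
    blocks. *)
Fixpoint blocks n A F : Prop :=
  if n is n'.+1 then
    exists E G, [/\ A E, blocks n' A G, before E G & F = E `|` G]
  else F = fset0.

Definition schreier_zero : set {fset nat} := fun F => #|` F| <= 1.

(* The element [k] of an index set stands for the positive integer [k.+1], so
   that "n <= F" becomes a comparison of [n.-1] with the elements of [F]. *)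
Definition schreier_next A : set {fset nat} :=
  fun F => exists n, (forall k, k \in F -> n <= k) /\ blocks n.+1 A F.

Definition schreier_limit (A : nat -> set {fset nat}) : set {fset nat} :=
  fun F => exists n, (forall k, k \in F -> n <= k) /\ A n F.

(** Ordinals are forgotten; only the way the families are generated is kept. The generation starts
    at the family of index 1, because the family of index 0 has no two-point sets and
    [schreier_family_pair] would fail for it. *)
Inductive schreier_family : set {fset nat} -> Prop :=
| schreier_family_one : schreier_family (schreier_next schreier_zero)
| schreier_family_next A : schreier_family A -> schreier_family (schreier_next A)
| schreier_family_limit (A : nat -> set {fset nat}) :
    (forall n, schreier_family (A n)) ->
    schreier_family (schreier_limit A).

Lemma blocks_hereditary n A F G : hereditary A ->
  blocks n A F -> G `<=` F -> blocks n A G.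
Proof.
move=> hA; elim: n F G => [|n IH] F G /=; first by move=> -> /[!fsubset0]/eqP.
move=> [E [E' [AE bE' EE' ->]]] GF.
exists (G `&` E), (G `&` E'); split.
- by apply: hA AE _; rewrite fsubsetIr.
- by apply: IH bE' _; rewrite fsubsetIr.
- by move=> k l; rewrite !inE => /andP[_ ?] /andP[_ ?]; exact: EE'.
- by rewrite -fsetIUr; apply/esym/fsetIidPl.
Qed.

Lemma blocksS n A F : A fset0 -> blocks n A F -> blocks n.+1 A F.
Proof. by move=> A0 bF; exists fset0, F; split => //; rewrite fset0U. Qed.

Lemma blocks0 n A : A fset0 -> blocks n A fset0.
Proof. by move=> A0; elim: n => [//|n IH]; exact: blocksS. Qed.

Lemma blocks1 n A F : A fset0 -> A F -> blocks n.+1 A F.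
Proof.
move=> A0 AF; exists F, fset0; split; rewrite ?fsetU0 //; exact: blocks0.
Qed.

(** A point moves within its own block. It cannot run into a later block, whose points exceed [i]
    and differ from [i.+1]. *)
Lemma blocks_shiftable n A : hereditary A -> shiftable A -> shiftable (blocks n A).
Proof.
move=> hA sA; elim: n => [|n IH] F i /=; first by move=> ->; rewrite in_fset0.
move=> [E [G [AE bG EG ->]]]; rewrite !inE negb_or => iEG /andP[i1E i1G].
have [iE|iE] := boolP (i \in E).
  have iG : i \notin G by apply/negP => /(EG _ _ iE); rewrite ltnn.
  exists (i.+1 |` (E `\ i)), G; split => //.
  - exact: sA.
  - move=> k l; rewrite !inE => /orP[/eqP->|/andP[_ kE]] lG; last exact: EG.
    have := EG _ _ iE lG.
    by rewrite leq_eqVlt => /predU1P[lE|//]; rewrite lE lG in i1G.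
  - apply/fsetP=> x; rewrite !inE.
    by case: (eqVneq x i) => [->|] /=; rewrite ?(negPf iG) ?orbF ?orbA.
have iG : i \in G by move: iEG; rewrite (negPf iE).
exists E, (i.+1 |` (G `\ i)); split => //.
- exact: IH.
- move=> k l kE; rewrite !inE => /orP[/eqP->|/andP[_ lG]]; last exact: EG.
  exact: ltnW (EG _ _ kE iG).
- apply/fsetP=> x; rewrite !inE.
  case: (eqVneq x i) => [->|] /=; first by rewrite (negPf iE) !orbF.
  by rewrite orbCA.
Qed.

(* The smallest element pays for a block of its own, which makes room for [m]. *)
Lemma blocks_split n A i j m G : hereditary A -> shiftable A -> A fset0 ->
  (forall k, A [fset k]) -> i < j -> j < m -> (forall k, k \in G -> m < k) ->
  blocks n A (i |` G) -> blocks n.+1 A (j |` (m |` G)).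
Proof.
move=> hA sA A0 A1 ij jm mG.
elim: n => [|n IH]; first by move/fsetP/(_ i); rewrite !inE eqxx.
move=> [E [G' [AE bG' EG' iGE]]].
have GiG k : k \in E `|` G' -> k = i \/ m < k.
  by rewrite -iGE !inE => /orP[/eqP|/mG]; [left|right].
have [iE|iE] := boolP (i \in E).
  have iG' : i \notin G' by apply/negP => /(EG' _ _ iE); rewrite ltnn.
  exists [fset j], ((m |` (E `\ i)) `|` G'); split => //.
  - exists (m |` (E `\ i)), G'; split => //.
      apply: (@exchange _ i) => //; rewrite ?inE ?eqxx //; first lia.
      by rewrite fsetD1K.
    move=> k l; rewrite !inE => /orP[/eqP->|/andP[_ kE]] lG'; last exact: EG'.
    have [|lE|//] := GiG l; first by rewrite inE lG' orbT.
    by move: iG'; rewrite -lE lG'.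
  - move=> k l; rewrite !inE => /eqP-> /orP[/orP[/eqP->//|/andP[li lE]]|lG'].
      by have [|lE'|] := GiG l; [rewrite inE lE|rewrite lE' eqxx in li|lia].
    have [|lE'|] := GiG l; first by rewrite inE lG' orbT.
      by move: iG'; rewrite -lE' lG'.
    lia.
  - have iG : i \notin G by apply/negP => /mG; lia.
    have GE : G = (E `\ i) `|` G'.
      apply/fsetP=> x; have /fsetP/(_ x) := iGE; rewrite !inE.
      by case: (eqVneq x i) => //= ->; rewrite (negPf iG) (negPf iG').
    by rewrite GE -!fsetUA.
(* All points other than [i] exceed [m], so a nonempty first block would have to contain [i]. *)
have E0 : E = fset0.
  apply/eqP; apply: contraT => /fset0Pn[k kE].
  have iG' : i \in G'.
    by have /fsetP/(_ i) := iGE; rewrite !inE eqxx (negPf iE) /= => <-.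
  have := EG' _ _ kE iG'; have [|kE'|] := GiG k; first by rewrite inE kE.
    by rewrite -kE' kE in iE.
  lia.
by move: iGE; rewrite E0 fset0U => iGE; apply: blocksS => //; apply: IH; rewrite iGE.
Qed.

Lemma prefix_fsetE (m : nat -> nat) k x :
  (x \in prefix_fset m k) = [exists t : 'I_k, x == m t].
Proof.
rewrite !inE; apply/mapP/existsP => [[t]|[t /eqP->]].
  by rewrite mem_iota /= add0n => tk ->; exists (Ordinal tk).
by exists (t : nat) => //; rewrite mem_iota /= add0n.
Qed.

Lemma prefix_fsetP (m : nat -> nat) k x :
  reflect (exists2 t, t < k & x = m t) (x \in prefix_fset m k).
Proof.
rewrite prefix_fsetE; apply: (iffP existsP) => [[t /eqP->]|[t tk ->]].
  by exists t.
by exists (Ordinal tk).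
Qed.

Lemma prefix_fset_le m k l : k <= l -> prefix_fset m k `<=` prefix_fset m l.
Proof.
move=> kl; apply/fsubsetP => x /prefix_fsetP[t tk ->].
by apply/prefix_fsetP; exists t => //; exact: leq_trans kl.
Qed.

(** The minimum of a set limits the number of its blocks, or the index in an approximating sequence,
    so only finitely many families compete for a given sequence [m]. *)
Lemma compact_bound (A : nat -> set {fset nat}) m n :
  (forall t, hereditary (A t)) -> (forall t, compact_family (A t)) ->
  {homo m : i j / i < j} ->
  exists k, forall t, t <= n -> ~ A t (prefix_fset m k).
Proof.
move=> hA cA mm; elim: n => [|n [k IH]].
  by have [k kA] := cA 0 m mm; exists k => t /[!leqn0]/eqP->.
have [l lA] := cA n.+1 m mm; exists (maxn k l) => t.
rewrite leq_eqVlt => /predU1P[->|/IH kA].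
  by move=> /hA/(_ (prefix_fset_le m (leq_maxr k l))).
by move=> /hA/(_ (prefix_fset_le m (leq_maxl k l))).
Qed.

(** A prefix outside [A] does not fit into the first block, so some [m t] with [t < l] lies in the
    remainder, and so does everything after it. Induction applies to the sequence shifted by [l]. *)
Lemma blocks_compact n A : hereditary A -> compact_family A ->
  compact_family (blocks n A).
Proof.
move=> hA cA; elim: n => [|n IH] m mm.
  have : m 0 \in prefix_fset m 1 by apply/prefix_fsetP; exists 0.
  by move=> m0; exists 1 => /= mE; rewrite mE in_fset0 in m0.
have [l lA] := cA m mm.
have [|k kA] := IH (fun t => m (l + t)).
  by move=> i j ij; apply: mm; rewrite ltn_add2l.
exists (l + k) => -[E [G [AE bG EG mE]]].
have miE i : i < l + k -> m i \in E `|` G.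
  by move=> ilk; rewrite -mE; apply/prefix_fsetP; exists i.
have [t tl mtE] : exists2 t, t < l & m t \notin E.
  apply: contrapT => noex; apply: lA; apply: hA AE _.
  apply/fsubsetP => x /prefix_fsetP[t tl ->]; apply: contrapT => /negP mtE.
  by apply: noex; exists t.
apply: kA; apply: blocks_hereditary bG _ => //.
apply/fsubsetP => x /prefix_fsetP[u uk ->].
have mtG : m t \in G by have := miE t ltac:(lia); rewrite inE (negPf mtE).
have := miE (l + u) ltac:(lia); rewrite inE => /orP[mE'|//].
by have := EG _ _ mE' mtG; have := mm t (l + u) ltac:(lia); lia.
Qed.

Lemma schreier_zero_props :
  [/\ hereditary schreier_zero, shiftable schreier_zero,
      compact_family schreier_zero & forall k, schreier_zero [fset k]].
Proof.
rewrite /schreier_zero; split.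
- by move=> F G F1 GF; apply: leq_trans F1; exact: fsubset_leq_card.
- move=> F i F1 iF i1F; rewrite cardfsU1 !inE (negPf i1F) andbF /=.
  by move: F1; rewrite (cardfsD1 i F) iF.
- move=> m mm; exists 2 => F1.
  have m01 : m 0 != m 1 by have := mm 0 1 isT; lia.
  have : [fset m 0; m 1] `<=` prefix_fset m 2.
    apply/fsubsetP => x; rewrite in_fset2.
    by move=> /orP[]/eqP->; apply/prefix_fsetP; [exists 0|exists 1].
  by move/fsubset_leq_card; rewrite cardfs2 m01 => /leq_trans/(_ F1).
- by move=> k; rewrite cardfs1.
Qed.

Lemma schreier_next_props A :
  [/\ hereditary A, shiftable A, compact_family A & forall k, A [fset k]] ->
  [/\ hereditary (schreier_next A), shiftable (schreier_next A),
      compact_family (schreier_next A) & forall k, schreier_next A [fset k]].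
Proof.
move=> [hA sA cA A1]; split.
- move=> F G [n [nF bF]] GF; exists n; split; last exact: blocks_hereditary bF _.
  by move=> k kG; apply: nF; exact: (fsubsetP GF).
- move=> F i [n [nF bF]] iF i1F; exists n; split; last exact: blocks_shiftable.
  by move=> k; rewrite !inE => /orP[/eqP->|/andP[_ /nF//]]; exact: leqW (nF _ iF).
- move=> m mm.
  (* A nonempty prefix contains [m 0], which bounds the admissible [n]; taking [k.+1] points
     guarantees nonemptiness. *)
  have [k kA] := @compact_bound (fun t => blocks t.+1 A) m (m 0)
    (fun t F G bF GF => blocks_hereditary hA bF GF)
    (fun t => @blocks_compact _ _ hA cA) mm.
  exists k.+1 => -[n [nm bn]]; apply: (kA n).
    by apply: nm; apply/prefix_fsetP; exists 0.
  by apply: blocks_hereditary bn _ => //; exact: prefix_fset_le.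
- move=> k; exists 0; split => //; apply: blocks1 => //.
  by apply: hA (A1 0) _; exact: fsub0set.
Qed.

Lemma schreier_family_props A : schreier_family A ->
  [/\ hereditary A, shiftable A, compact_family A & forall k, A [fset k]].
Proof.
elim=> {A} [|A _|A _ IH].
- exact: schreier_next_props schreier_zero_props.
- exact: schreier_next_props.
split.
- move=> F G [n [nF AF]] GF; exists n; split.
    by move=> k kG; apply: nF; exact: (fsubsetP GF).
  by have [hA _ _ _] := IH n; exact: hA AF GF.
- move=> F i [n [nF AF]] iF i1F; exists n; split.
    by move=> k; rewrite !inE => /orP[/eqP->|/andP[_ /nF//]]; exact: leqW (nF _ iF).
  by have [_ sA _ _] := IH n; exact: sA.
- move=> m mm.
  have [k kA] := @compact_bound A m (m 0)
    (fun t => let: And4 h _ _ _ := IH t in h)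
    (fun t => let: And4 _ _ h _ := IH t in h) mm.
  exists k.+1 => -[n [nm An]]; apply: (kA n).
    by apply: nm; apply/prefix_fsetP; exists 0.
  by have [hA _ _ _] := IH n; apply: hA An _; exact: prefix_fset_le.
- by move=> k; exists 0; split => //; have [_ _ _] := IH 0.
Qed.

(** A set containing 0 admits only [n = 0], that is, a single block. *)
Lemma schreier_next_zero A F :
  (forall F, A F -> 0 \in F -> F = [fset 0]) ->
  schreier_next A F -> 0 \in F -> F = [fset 0].
Proof.
move=> zA [n [nF bF]] F0; move: bF (nF _ F0); rewrite leqn0 => + /eqP n0.
rewrite {}n0 => -[E [G [AE /= -> _ FE]]].
by move: F0; rewrite FE fsetU0; exact: zA.
Qed.

Lemma schreier_family_zero A F : schreier_family A ->
  A F -> 0 \in F -> F = [fset 0].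
Proof.
move=> sA; elim: sA F => {A} [|A _ IH|A _ IH] F.
- apply: schreier_next_zero => {}F; rewrite /schreier_zero => F1 F0.
  by apply/eqP; rewrite eq_sym eqEfcard fsub1set F0 cardfs1.
- exact: schreier_next_zero.
- by move=> [n [_ AF]]; exact: IH AF.
Qed.

Lemma schreier_next_pair A i j : A fset0 -> (forall k, A [fset k]) ->
  0 < i -> 0 < j -> schreier_next A [fset i; j].
Proof.
move=> A0 A1 i0 j0.
wlog ij : i j i0 j0 / i <= j.
  move=> H; have [/H|/ltnW/H] := leqP i j; [exact|rewrite fsetUC; exact].
exists 1; split; first by move=> k; rewrite !inE => /orP[]/eqP->.
have [->|ijN] := eqVneq i j; first by rewrite fsetUid; exact: blocks1.
exists [fset i], [fset j]; split => //; first exact: blocks1.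
by move=> k l; rewrite !inE => /eqP-> /eqP->; lia.
Qed.

Lemma schreier_family_pair A i j : schreier_family A ->
  0 < i -> 0 < j -> A [fset i; j].
Proof.
move=> sA; elim: sA => {A} [|A sA _|A _ IH] i0 j0.
- apply: schreier_next_pair => //.
  by have [_ _ _] := schreier_zero_props.
- have [hA _ _ A1] := schreier_family_props sA.
  by apply: schreier_next_pair => //; exact: hA (A1 0) (fsub0set _).
- by exists 0; split => //; exact: IH.
Qed.

(** The minimum rises above [i], so one more block is allowed than before; [blocks_split] spends
    it. *)
Lemma schreier_next_split A i j m G : hereditary A -> shiftable A ->
  (forall k, A [fset k]) -> i < j -> j < m -> (forall k, k \in G -> m < k) ->
  schreier_next A (i |` G) -> schreier_next A (j |` (m |` G)).
Proof.
move=> hA sA A1 ij jm mG [n [nG bG]].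
have ni : n <= i by apply: nG; rewrite !inE eqxx.
exists n.+1; split.
  by move=> k; rewrite !inE => /or3P[/eqP->|/eqP->|/mG]; lia.
apply: (@blocks_split _ _ i) => //.
exact: hA (A1 0) (fsub0set _).
Qed.

(** At successors the gained block suffices; induction is used only at limits, where the index [n]
    is kept. *)
Lemma schreier_family_split A i j m G : schreier_family A ->
  i < j -> j < m -> (forall k, k \in G -> m < k) ->
  A (i |` G) -> A (j |` (m |` G)).
Proof.
move=> sA ij jm mG; elim: sA => {A} [|A sA _|A sA IH].
- have [hA ? _ A1] := schreier_zero_props.
  exact: (schreier_next_split hA _ A1 ij jm).
- have [hA ? _ A1] := schreier_family_props sA.
  exact: (schreier_next_split hA _ A1 ij jm).
- move=> [n [nG AG]]; exists n; split; last exact: IH.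
  have ni : n <= i by apply: nG; rewrite !inE eqxx.
  by move=> k; rewrite !inE => /or3P[/eqP->|/eqP->|/mG]; lia.
Qed.

(** Containing 1 forces [n <= 1]; a single block is completed by an empty one. *)
Lemma schreier_next2 A F : A fset0 -> 1 \in F -> schreier_next A F ->
  exists E G, [/\ A E, A G, before E G & F = E `|` G].
Proof.
move=> A0 F1 [n [nF]]; have := nF _ F1; case: n {nF} => [_|[_|//]].
  move=> [E [G [AE /= -> EG ->]]]; exists E, fset0; split => //.
move=> [E [_ [AE [G [_ [AG /= -> _ ->]]] EG ->]]].
by exists E, G; split => //; move: EG; rewrite fsetU0.
Qed.

Lemma schreier_next2I A E G : A E -> A G -> before E G -> 0 \notin E `|` G ->
  schreier_next A (E `|` G).
Proof.
move=> AE AG EG EG0; exists 1; split.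
  by move=> [|//]; rewrite (negPf EG0).
exists E, G; split => //; exists G, fset0; split => //; last by rewrite fsetU0.
Qed.

Lemma schreier_next_sub A F : A fset0 -> A F -> schreier_next A F.
Proof. by move=> A0 AF; exists 0; split => //; exact: blocks1. Qed.

Lemma before_no0 E G : 1 \in G -> 0 \notin E `|` G -> before E G -> E = fset0.
Proof.
move=> G1 EG0 EG; apply/eqP; apply: contraT => /fset0Pn[k kE].
have := EG _ _ kE G1; rewrite ltnS leqn0 => /eqP k0.
by move: EG0; rewrite inE -k0 kE.
Qed.

Lemma schreier_next_zero_card F : 1 \in F ->
  schreier_next schreier_zero F -> #|` F| <= 2.
Proof.
have Z0 : schreier_zero fset0 by [].
move=> F1 /(schreier_next2 Z0 F1)[E [G [E1 G1 _ ->]]].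
by rewrite cardfsU; move: E1 G1; rewrite /schreier_zero; lia.
Qed.

(* The element 1 stands for the integer 2, so that each successor step yields at
   most two blocks; [m] lies in the first one until that block is [fset 1]. *)
Lemma schreier_family_thin A m H : schreier_family A ->
  1 < m -> (forall k, k \in H -> m < k) ->
  A (1 |` (m |` H)) -> A (1 |` (2 |` H)).
Proof.
move=> sA m1 mH.
have mNH : m \notin H by apply/negP => /mH; rewrite ltnn.
have H1 : 1 \notin H by apply/negP => /mH; lia.
have H0 : 0 \notin H by apply/negP => /mH; lia.
elim: sA H mH mNH H1 H0 => {A} [|A sA IH|A sA IH] H mH mNH H1 H0.
- move=> /(schreier_next_zero_card (fset1U1 _ _)).
  rewrite !cardfsU1 !inE mNH (negPf H1) orbF (_ : 1 != m) /=; last lia.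
  rewrite !add1n !ltnS leqn0 cardfs_eq0 => /eqP->.
  by rewrite fsetU0; exact: (schreier_family_pair schreier_family_one).
- have [hA shA _ A1] := schreier_family_props sA.
  have A0 : A fset0 by exact: hA (A1 0) (fsub0set _).
  have F0 : 0 \notin 1 |` (m |` H) by rewrite !inE (negPf H0) orbF /=; lia.
  have F0' : 0 \notin 1 |` (2 |` H) by rewrite !inE (negPf H0).
  move=> /(schreier_next2 A0 (fset1U1 _ _))[E [G [AE AG EG FE]]].
  have EGF k : k \in E `|` G -> [\/ k = 1, k = m | k \in H].
    rewrite -FE !inE => /or3P[/eqP|/eqP|]; by [constructor 1|constructor 2|constructor 3].
  (* If 1 lies in the second block, the first is empty and the set already belongs to [A]. *)
  have [E1|E1] := boolP (1 \in E); last first.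
    have G1 : 1 \in G by have /fsetP/(_ 1) := FE; rewrite !inE eqxx (negPf E1).
    have E0 : E = fset0 by apply: before_no0 G1 _ EG; rewrite -FE.
    apply: schreier_next_sub => //; apply: IH => //.
    by rewrite FE E0 fset0U.
  have [mE|mE] := boolP (m \in E).
    have mG : m \notin G by apply/negP => /(EG _ _ mE); rewrite ltnn.
    have G1 : 1 \notin G by apply/negP => /(EG _ _ E1); rewrite ltnn.
    pose H' := (E `\ 1) `\ m.
    have EE : E = 1 |` (m |` H').
      rewrite fsetD1K ?fsetD1K // !inE mE andbT; lia.
    have H'H k : k \in H' -> k \in H.
      rewrite !inE => /and3P[km k1 kE].
      by have [|||//] := EGF k; rewrite ?inE ?kE // => kE'; move: km k1; rewrite kE' eqxx.
    have HE : H = H' `|` G.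
      apply/fsetP => x; have /fsetP/(_ x) := FE; rewrite EE !inE.
      case: (eqVneq x 1) => [->|] /=; first by rewrite (negPf H1) (negPf G1) !andbF.
      case: (eqVneq x m) => [->|] //=; first by rewrite (negPf mNH) (negPf mG).
    rewrite HE (_ : 1 |` (2 |` (H' `|` G)) = (1 |` (2 |` H')) `|` G); last first.
      by rewrite -!fsetUA.
    apply: schreier_next2I => //.
    + apply: IH; rewrite -?EE //.
      * by move=> k /H'H/mH.
      * by apply: contra mNH => /H'H.
      * by apply: contra H1 => /H'H.
      * by apply: contra H0 => /H'H.
    + move=> k l; rewrite !inE => /or3P[/eqP->|/eqP->|/and3P[_ _ kE]] lG.
      * exact: EG.
      * exact: leq_ltn_trans m1 (EG _ _ mE lG).
      * exact: EG.
    + by rewrite -!fsetUA -HE.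
  (* Everything beyond [m] lies with it in the second block, so [[fset 1; 2]] may be taken as the
     first. *)
  have mG : m \in G by have /fsetP/(_ m) := FE; rewrite !inE eqxx (negPf mE) orbT.
  have -> : 1 |` (2 |` H) = [fset 1; 2] `|` H by rewrite fsetUA.
  apply: schreier_next2I.
  + exact: schreier_family_pair.
  + apply: hA AG _; apply/fsubsetP => x xH; have /fsetP/(_ x) := FE.
    rewrite !inE xH !orbT => /esym/orP[xE|//].
    by have := ltn_trans (EG _ _ xE mG) (mH _ xH); rewrite ltnn.
  + by move=> k l; rewrite !inE => /orP[]/eqP-> /mH; lia.
  + by rewrite !inE (negPf H0).
- move=> [n [nF AF]]; exists n; split; last exact: IH.
  have n1 : n <= 1 by apply: nF; rewrite !inE eqxx.
  by move=> k; rewrite !inE => /or3P[/eqP->|/eqP->|/mH]; lia.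
Qed.

(** With 1 in the set no block can be gained at this level. If [i] is in the first block, the claim
    passes to that block by induction; otherwise [[fset 1; 2]] becomes the first block and
    [schreier_family_split] applies to the second. *)
Lemma schreier_family_split12 A i j m G : schreier_family A ->
  2 < i -> i < j -> j < m -> (forall k, k \in G -> m < k) ->
  A (1 |` (2 |` (i |` G))) -> A (1 |` (2 |` (j |` (m |` G)))).
Proof.
move=> sA i2 ij jm.
elim: sA G => {A} [|A sA IH|A sA IH] G mG.
(* Vacuous: in the first family a set containing 1 has at most two points, and here there are
   three. *)
- move=> /(schreier_next_zero_card (fset1U1 _ _)).
  have GN k : k <= i -> k \notin G by move=> ki; apply/negP => /mG; lia.
  rewrite !cardfsU1 !inE !(negPf (GN _ _)) ?orbF //; try lia.
- have [hA shA _ A1] := schreier_family_props sA.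
  have A0 : A fset0 by exact: hA (A1 0) (fsub0set _).
  have G0 : 0 \notin G by apply/negP => /mG; lia.
  have F0 : 0 \notin 1 |` (2 |` (i |` G)) by rewrite !inE (negPf G0) orbF /=; lia.
  have F0' : 0 \notin 1 |` (2 |` (j |` (m |` G))).
    by rewrite !inE (negPf G0) orbF /=; lia.
  move=> /(schreier_next2 A0 (fset1U1 _ _))[E [G' [AE AG EG FE]]].
  have EGF k : k \in E `|` G' -> [\/ k = 1, k = 2, k = i | k \in G].
    rewrite -FE !inE => /or4P[/eqP|/eqP|/eqP|];
    by [constructor 1|constructor 2|constructor 3|constructor 4].
  have [E1|E1] := boolP (1 \in E); last first.
    have G1 : 1 \in G' by have /fsetP/(_ 1) := FE; rewrite !inE eqxx (negPf E1).
    have E0 : E = fset0 by apply: before_no0 G1 _ EG; rewrite -FE.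
    apply: schreier_next_sub => //; apply: IH => //.
    by rewrite FE E0 fset0U.
  have [iE|iE] := boolP (i \in E).
    have G'G k : k \in G' -> k \in G.
      move=> kG'; have := EG _ _ iE kG'.
      by have [||||//] := EGF k; rewrite ?inE ?kG' ?orbT // => ->; lia.
    have E2 : 2 \in E.
      have /fsetP/(_ 2) := FE; rewrite !inE eqxx orbT => /esym/orP[//|G'2].
      by have := EG _ _ iE G'2; lia.
    pose H := ((E `\ 1) `\ 2) `\ i.
    have EE : E = 1 |` (2 |` (i |` H)).
      rewrite fsetD1K ?fsetD1K ?fsetD1K // !inE ?E2 ?iE ?andbT //; lia.
    have HG k : k \in H -> k \in G.
      rewrite !inE => /and4P[ki k2 k1 kE].
      by have [||||//] := EGF k; rewrite ?inE ?kE // => kE';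
        move: ki k2 k1; rewrite kE' eqxx.
    have GE : G = H `|` G'.
      apply/fsetP => x; have /fsetP/(_ x) := FE; rewrite EE !inE.
      have GN k : k <= i -> (k \in G) = false by move=> ki; apply/negP => /mG; lia.
      have GN' k : k <= i -> (k \in G') = false by move=> /GN kG; apply/negP => /G'G; rewrite kG.
      case: (eqVneq x 1) => [->|] /=; first by rewrite !GN ?GN' ?andbF //; lia.
      case: (eqVneq x 2) => [->|] /=; first by rewrite !GN ?GN' ?andbF //; lia.
      by case: (eqVneq x i) => [->|] //=; first by rewrite !GN ?GN' ?andbF //; lia.
    have -> : 1 |` (2 |` (j |` (m |` G))) = (1 |` (2 |` (j |` (m |` H)))) `|` G'.
      by rewrite GE -!fsetUA.
    apply: schreier_next2I => //.
    + apply: IH; rewrite -?EE //.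
      by move=> k /HG/mG.
    + move=> k l; rewrite !inE.
      move=> /or4P[/eqP->|/eqP->|/eqP->|/orP[/eqP->|/and4P[_ _ _ kE]]] lG;
      by [exact: EG|have := mG _ (G'G _ lG); lia].
    + by rewrite -!fsetUA -GE.
  have iG' : i \in G' by have /fsetP/(_ i) := FE; rewrite !inE eqxx (negPf iE) !orbT.
  have -> : 1 |` (2 |` (j |` (m |` G))) = [fset 1; 2] `|` (j |` (m |` G)) by rewrite fsetUA.
  apply: schreier_next2I.
  + exact: schreier_family_pair.
  + apply: (@schreier_family_split _ i) => //.
    apply: hA AG _; apply/fsubsetP => x; rewrite !inE => /orP[/eqP->//|xG].
    have /fsetP/(_ x) := FE; rewrite !inE xG !orbT => /esym/orP[xE|//].
    have xm := ltn_trans (EG _ _ xE iG') (ltn_trans ij jm).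
    by have := ltn_trans (mG _ xG) xm; rewrite ltnn.
  + by move=> k l; rewrite !inE => /orP[]/eqP-> /or3P[/eqP->|/eqP->|/mG]; lia.
  + by move: F0'; rewrite !inE.
- move=> [n [nF AF]]; exists n; split; last exact: IH.
  have n1 : n <= 1 by apply: nF; rewrite !inE eqxx.
  by move=> k; rewrite !inE => /or4P[/eqP->|/eqP->|/eqP->|/orP[/eqP->|/mG]]; lia.
Qed.

End Families.

(** * Extremal sets in a fixed Schreier family *)

Section SchreierFamily.
Local Open Scope fset_scope.
Local Open Scope nat_scope.
Variables (A : set {fset nat}) (sA : schreier_family A).
Implicit Types (F G H E L : {fset nat}).

Let hA : hereditary A. Proof. by have [] := schreier_family_props sA. Qed.
Let shA : shiftable A. Proof. by have [] := schreier_family_props sA. Qed.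
Let cA : compact_family A. Proof. by have [] := schreier_family_props sA. Qed.
Let A1 k : A [fset k]. Proof. by have [] := schreier_family_props sA. Qed.

Definition seg a n : {fset nat} := [fset x in iota a n].

Lemma in_seg a n (x : nat) : (x \in seg a n) = (a <= x < a + n).
Proof. by rewrite inE mem_iota. Qed.

Lemma card_seg a n : #|` seg a n| = n.
Proof. by rewrite card_fseq undup_id ?iota_uniq // size_iota. Qed.

Lemma segS a n : seg a n.+1 = a |` seg a.+1 n.
Proof. by apply/fsetP => x; rewrite in_seg !inE mem_iota; lia. Qed.

Lemma segSr a n : seg a n.+1 = (a + n) |` seg a n.
Proof. by apply/fsetP => x; rewrite in_seg !inE mem_iota; lia. Qed.

Lemma seg_bound a : exists n, ~ A (seg a n).
Proof.
have [|n nA] := cA (m := fun t => a + t); first by move=> i j ij; lia.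
exists n; congr (~ A _): nA; apply/fsetP => x; rewrite in_seg.
apply/prefix_fsetP/idP => [[t tn ->]|xa]; first lia.
by exists (x - a); lia.
Qed.

Lemma seg_max L a : A L ->
  exists n, A (L `|` seg a n) /\ ~ A (L `|` seg a n.+1).
Proof.
move=> AL; have [n nA] := seg_bound a.
apply: contrapT => noex; apply: nA; apply: (hA (F := L `|` seg a n)); last first.
  exact: fsubsetUr.
elim: n => [|n IH].
  by rewrite (_ : seg a 0 = fset0) ?fsetU0 //; apply/fsetP => x; rewrite !inE.
by apply: contrapT => nA; apply: noex; exists n.
Qed.

(** Moving points to the right stays in the family, so the last [t] points below [K] are the easiest
    to accommodate. This turns bounds on cardinalities into statements about intervals. *)
Lemma push_right L H K t : H `<=` seg 0 K -> t <= #|` H| ->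
  [disjoint L & H] -> [disjoint L & seg (K - t) t] ->
  A (L `|` H) -> A (L `|` seg (K - t) t).
Proof.
move=> HK tH LH LS AH.
apply: (exchange_fset hA shA LH) => //; first by rewrite card_seg.
move=> h h' hH; rewrite !in_seg; have := fsubsetP HK _ hH; rewrite in_seg; lia.
Qed.

(** Suppose that replacing [j] by [i] never leaves the family. Splitting [i] into [j] and [a] and
    then putting [i] back for [j] gains the point [a]; iterating, [i] acquires a whole interval that
    is not in the family. *)
Lemma schreier_family_strict i j : i < j ->
  exists G, [/\ forall k, k \in G -> j < k, A (j |` G) & ~ A (i |` G)].
Proof.
move=> ij; apply: contrapT => noex.
have [n] := seg_bound j.+1; apply.
suff H d a : a + d = j.+1 + n -> j < a -> A (i |` seg a d).
  by apply: hA (H n j.+1 _ _) _ => //; exact: fsubsetU1.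
elim: d a => [|d IH] a ad ja.
  by rewrite (_ : seg a 0 = fset0) ?fsetU0 //; apply/fsetP => x; rewrite !inE.
apply: contrapT => nA; apply: noex; exists (seg a d.+1); split => //.
  by move=> k; rewrite in_seg; lia.
rewrite segS; apply: (schreier_family_split sA ij) => //.
  by move=> k; rewrite in_seg; lia.
by apply: IH; lia.
Qed.

Lemma schreier_family_pos F (k l : nat) : A F -> k \in F -> l \in F -> k != l -> 0 < k.
Proof.
case: k => // AF F0 lF; rewrite eq_sym => l0; move: lF.
by rewrite (schreier_family_zero sA AF F0) inE (negPf l0).
Qed.

(** This will characterise the supports of antipodal vectors. Index 0 is left out because it belongs
    to no set of the family except its singleton. *)
Definition extendable G := forall k, 0 < k -> A (k |` G).

(** [G] contains an interval far to the right, as long as possible beside 1 or, if 1 is not in [F],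
    beside 1 and 2. Two points of [F] refute its union with [G]: one is 1 or stands in for 2, the
    other moves to the end of the interval and lengthens it. *)
Lemma exists_blocker F (k l : nat) : A F -> k \in F -> l \in F -> k < l ->
  exists G, [/\ [disjoint F & G], extendable G, forall i, i \in G -> 0 < i
    & ~ A (F `|` G)].
Proof.
move=> AF kF lF kl.
have F0 i : i \in F -> 0 < i.
  have [->|il] := eqVneq i l; first by move=> _; lia.
  by move=> iF; exact: (schreier_family_pos AF iF lF il).
pose N := (\max_(i <- F) i).+1.
have FN i : i \in F -> i < N by move=> iF; rewrite ltnS; exact: leq_bigmax_seq.
have lN := FN _ lF; have k0 := F0 _ kF.
have exch (i j : nat) G : i \notin G -> i <= j -> A (i |` G) -> A (j |` G).
  exact: exchange.
have [F1|F1] := boolP (1 \in F).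
  have [t [At nAt]] := seg_max N (A1 1); exists (seg N t); split.
  - by apply/fdisjointP => x /FN; rewrite in_seg; lia.
  - by move=> i i0; apply: (exch 1) => //; rewrite in_seg; lia.
  - by move=> i; rewrite in_seg; lia.
  - move=> AFG; apply: nAt; rewrite segSr fsetUCA; apply: (exch l).
    + by rewrite !inE mem_iota; lia.
    + lia.
    + apply: hA AFG _; apply/fsubsetP => x; rewrite !inE.
      by move=> /or3P[/eqP->|/eqP->|->]; rewrite ?lF ?F1 ?orbT.
have k1 : 1 < k by rewrite ltn_neqAle k0 andbT; apply: contraNneq F1 => ->.
have [t [At nAt]] := seg_max N (schreier_family_pair sA (ltn0Sn 0) (ltn0Sn 1)).
exists (1 |` seg N t); split.
- apply/fdisjointP => x xF; rewrite !inE mem_iota; have := FN _ xF.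
  by have : x != 1 by [apply: contraNneq F1 => <-]; lia.
- move=> i i0; have [->|i1] := eqVneq i 1.
    by rewrite fsetUA fsetUid; apply: hA At _; rewrite -fsetUA fsetUS // fsubsetU1.
  rewrite fsetUCA; have [iS|iS] := boolP (i \in seg N t).
    rewrite (_ : i |` seg N t = seg N t); last first.
      by apply/fsetUidPr; rewrite fsub1set.
    by apply: hA At _; rewrite -fsetUA fsetUS // fsubsetU1.
  rewrite fsetUCA; apply: (exch 2); last by rewrite fsetUCA fsetUA.
    by rewrite !inE mem_iota; lia.
  lia.
- by move=> i; rewrite !inE mem_iota; lia.
- move=> AFG; apply: nAt; rewrite -fsetUA.
  (* This moves [k] to the left, down to 2, which [exchange] cannot do; the presence of 1 makes it
     possible. *)
  apply: (@schreier_family_thin _ k) => //.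
    by move=> i; rewrite in_seg; lia.
  rewrite segSr (_ : 1 |` _ = (N + t) |` (1 |` (k |` seg N t))); last first.
    by rewrite [k |` _]fsetUCA fsetUCA.
  apply: (exch l); first by rewrite !inE mem_iota; lia.
    lia.
  apply: hA AFG _; apply/fsubsetP => x; rewrite !inE.
  by move=> /or4P[/eqP->|/eqP->|/eqP->|->]; rewrite ?lF ?kF ?orbT.
Qed.

(* In the window [2, a + r] of this lemma, [r] is the largest size of a set of
   [A], and [q] the largest size of a set which [1] completes to a set of [A]. *)
Lemma exists_window N : exists a r q,
  let W := seg 2 (a + r).-1 in
  [/\ 2 <= a, N <= a, 0 < q & q < r] /\
  [/\ forall x, x \in seg a r.+1 -> A (seg a r.+1 `\ x),
      forall i, a + r < i -> A (i |` seg a.+1 r)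
    & forall i, 2 <= i -> i + q <= a + r.+1 ->
        A (1 |` (i |` seg (a + r.+1 - q).+1 q.-1))] /\
  forall F, A F ->
  [/\ #|` F `&` W| <= r, 1 \in F -> #|` F `&` W| <= q,
      forall b, #|` F `&` W| = r -> b \in F -> 2 <= b -> N <= b
    & forall b c, 1 \in F -> #|` F `&` W| = q -> b \in F -> c \in F ->
        2 <= b -> b < c -> N <= c].
Proof.
pose a := maxn N 2; have A0 : A fset0 by exact: hA (A1 0) (fsub0set _).
have aN : N <= a /\ 2 <= a by rewrite /a; lia.
have exch (i j : nat) G : i \notin G -> i <= j -> A (i |` G) -> A (j |` G).
  exact: exchange.
(* The window ends where [seg a r.+1] does: a set with more than [r] points in it would be pushed
   right onto that interval, which is not in the family. *)
have [r []] := seg_max a A0; rewrite !fset0U => Ar nAr.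
pose K := a + r.+1; pose W := seg 2 (a + r).-1.
have WE x : (x \in W) = (2 <= x < K) by rewrite in_seg /K; lia.
have WK F : F `&` W `<=` seg 0 K.
  by apply/fsubsetP => x; rewrite inE WE in_seg => /andP[_]; lia.
have cardW F : A F -> #|` F `&` W| <= r.
  move=> AF; rewrite leqNgt; apply/negP => rF; apply: nAr.
  have := @push_right fset0 (F `&` W) K r.+1 (WK _) rF.
  rewrite !fdisjoint0X !fset0U addnK; apply => //.
  by apply: hA AF _; exact: fsubsetIl.
have r0 : 0 < r.
  rewrite lt0n; apply/eqP => r0; apply: nAr; rewrite r0 segSr.
  by rewrite (_ : seg a 0 = fset0) ?fsetU0 //; apply/fsetP => x; rewrite !inE.
pose P t := `[< 0 < t /\ A (1 |` seg (K - t) t) >].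
have P1 : P 1.
  apply/asboolP; split => //; rewrite segS.
  rewrite (_ : seg _ 0 = fset0) ?fsetU0; last by apply/fsetP => x; rewrite !inE.
  by apply: schreier_family_pair => //; rewrite /K; lia.
(* Otherwise 1 could be exchanged for [a] beside the last [r] points of the window, and [seg a r.+1]
   would be in the family. *)
have Pr t : P t -> t <= r.-1.
  move=> /asboolP[t0 At]; rewrite leqNgt; apply/negP => rt.
  apply: nAr; rewrite segS; apply: (exch 1); first by rewrite in_seg; lia.
    lia.
  apply: hA At _; apply: fsetUS; apply/fsubsetP => x; rewrite !in_seg /K; lia.
have [q /asboolP[q0 Aq] qmax] := ex_maxnP (ex_intro P 1 P1) Pr.
have qr : q < r by have := Pr q ltac:(by apply/asboolP); lia.
have cardW1 F : A F -> 1 \in F -> #|` F `&` W| <= q.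
  move=> AF F1; rewrite leqNgt; apply/negP => qF.
  have : P q.+1; last by move=> /qmax; rewrite ltnn.
  apply/asboolP; split => //; apply: (@push_right _ (F `&` W)) => //.
  - by apply/fdisjointP => x; rewrite in_fset1 => /eqP->; rewrite in_fsetI WE andbF.
  - by apply/fdisjointP => x; rewrite !inE mem_iota /K => /eqP->; lia.
  - apply: hA AF _; apply/fsubsetP => x; rewrite !inE.
    by move=> /orP[/eqP->//|/andP[]].
exists a, r, q; split; first by split; lia.
split; first split.
- move=> x xS; rewrite -[_ `\ x]fset0U.
  apply: (@exchange_fset _ fset0 (seg a r)); rewrite ?fdisjoint0X ?fset0U //.
    by have := cardfsD1 x (seg a r.+1); rewrite xS !card_seg add1n => -[<-]; rewrite ?card_seg.
  move=> h h'; rewrite !inE !mem_iota; lia.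
(* One step further right the interval may be longer: push the rest of [seg a r] away and split [a]
   into [a.+1] and [a.+2]. *)
- move=> i ri; have Ai : A (seg a.+1 r.+1).
    rewrite (_ : r = r.-1.+1) ?segS; last lia.
    apply: (schreier_family_split sA (ltnSn a) (ltnSn _)).
      by move=> k; rewrite in_seg; lia.
    rewrite (_ : seg a.+3 _ = seg (a.+3 + r.-1 - r.-1) r.-1); last by rewrite addnK.
    apply: (@push_right _ (seg a.+1 r.-1)).
    + by apply/fsubsetP => x; rewrite !in_seg; lia.
    + by rewrite card_seg.
    + by apply/fdisjointP => x; rewrite in_fset1 in_seg => /eqP->; lia.
    + by apply/fdisjointP => x; rewrite in_fset1 in_seg => /eqP->; lia.
    + by rewrite -segS (_ : r.-1.+1 = r) //; lia.
  apply: (exch (a.+1 + r)); first by rewrite in_seg; lia.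
    lia.
  by rewrite -segSr.
- move=> i i2 iq; rewrite fsetUCA; apply: (exch 2) => //.
    by rewrite !inE mem_iota; lia.
  rewrite fsetUCA; apply: (@schreier_family_thin _ (K - q)) => //.
  + by rewrite /K; lia.
  + by move=> k; rewrite in_seg; lia.
  + by rewrite -segS prednK.
move=> F AF; split; [exact: cardW|exact: cardW1| |].
(* Were [b < N <= a], splitting [b] into [a] and [a.+1], with the other points pushed right, would
   yield [seg a r.+1]. *)
- move=> b Fr bF b2; rewrite leqNgt; apply/negP => bN; apply: nAr.
  have bW : b \in F `&` W by rewrite in_fsetI bF WE; lia.
  rewrite (_ : r = r.-1.+1) ?segS; last lia.
  apply: (@schreier_family_split _ b) => //; first lia.
    by move=> k; rewrite in_seg; lia.
  rewrite (_ : seg _ _ = seg (K - r.-1) r.-1); last by congr seg; rewrite /K; lia.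
  apply: (@push_right _ ((F `&` W) `\ b)).
  + by apply: fsubset_trans (fsubsetDl _ _) _; exact: WK.
  + by move: Fr; rewrite (cardfsD1 b) bW /W; lia.
  + by apply/fdisjointP => x; rewrite in_fset1 in_fsetD1 => /eqP->; rewrite eqxx.
  + by apply/fdisjointP => x; rewrite in_fset1 in_seg => /eqP->; rewrite /K; lia.
  + by rewrite fsetD1K //; apply: hA AF _; exact: fsubsetIl.
(* Were [c < N], thinning would replace [b] by 2 and splitting [c] would gain a point, so that
   [q.+1] points of the window would go with 1. *)
- move=> b c F1 Fq bF cF b2 bc; rewrite leqNgt; apply/negP => cN.
  have bW : b \in F `&` W by rewrite in_fsetI bF WE; lia.
  have cW : c \in (F `&` W) `\ b by rewrite in_fsetD1 in_fsetI cF WE; lia.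
  pose H := ((F `&` W) `\ b) `\ c.
  have Hq : q = #|` H|.+2 by rewrite -Fq (cardfsD1 b) bW (cardfsD1 c) cW.
  have : A (1 |` (2 |` seg (K - q) q)).
    rewrite (_ : seg _ q = (K - q) |` ((K - q).+1 |` seg (K - q.-2) q.-2)); last first.
      by apply/fsetP => x; rewrite !inE !mem_iota /K; lia.
    apply: (@schreier_family_split12 _ c) => //; try by rewrite /K; lia.
      by move=> k; rewrite in_seg /K; lia.
    apply: (@schreier_family_thin _ b) => //.
      by move=> k; rewrite !inE mem_iota /K; lia.
    rewrite !fsetUA; apply: (@push_right _ H).
    + apply: fsubset_trans (fsubsetDl _ _) _.
      by apply: fsubset_trans (fsubsetDl _ _) _; exact: WK.
    + by rewrite Hq.
    + apply/fdisjointP => x; rewrite !in_fsetU !in_fset1 !in_fsetD1 in_fsetI WE.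
      by move=> /orP[/orP[]|]/eqP->; rewrite ?eqxx ?andbF.
    + apply/fdisjointP => x; rewrite !in_fsetU !in_fset1 in_seg /K.
      by move=> /orP[/orP[]|]/eqP->; lia.
    + apply: hA AF _; apply/fsubsetP => x; rewrite !in_fsetU !in_fset1 !in_fsetD1 in_fsetI.
      by move=> /orP[/orP[/orP[]|]/eqP->|/and4P[]].
  move=> /cardW1 /(_ (fset1U1 _ _)); rewrite leqNgt => /negP; apply.
  apply: (@leq_trans #|` 2 |` seg (K - q) q|).
    by rewrite cardfsU1 card_seg in_seg /K; lia.
  apply: fsubset_leq_card; apply/fsubsetP => x.
  by rewrite !in_fsetI !in_fsetU !in_fset1 WE in_seg /K; lia.
Qed.

End SchreierFamily.

(** * The power function *)

Section AbsPower.
Local Open Scope ring_scope.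
Context {R : realType}.
Implicit Types p s t a b : R.

Definition absp p t : R := `|t| `^ p.

Lemma absp_ge0 p t : 0 <= absp p t.
Proof. exact: powR_ge0. Qed.

Lemma absp0 p : 1 <= p -> absp p 0 = 0.
Proof. by move=> p1; rewrite /absp normr0 powR0 // gt_eqF // (lt_le_trans ltr01). Qed.

Lemma absp1 p : absp p 1 = 1.
Proof. by rewrite /absp normr1 powR1. Qed.

Lemma abspN p t : absp p (- t) = absp p t.
Proof. by rewrite /absp normrN. Qed.

Lemma absp_norm p t : absp p `|t| = absp p t.
Proof. by rewrite /absp normr_id. Qed.

Lemma abspM p s t : absp p (s * t) = absp p s * absp p t.
Proof. by rewrite /absp normrM powRM. Qed.

Lemma abspC1 t : absp 1 t = `|t|.
Proof. by rewrite /absp powRr1. Qed.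

Lemma ltr_absp p s t : 1 <= p -> (absp p s < absp p t) = (`|s| < `|t|).
Proof.
move=> p1; have p0 : 0 < p by exact: lt_le_trans p1.
have mono x y : 0 <= x -> 0 <= y -> x < y -> x `^ p < y `^ p.
  by move=> x0 y0; apply: gt0_ltr_powR.
apply/idP/idP; last exact: mono.
apply: contraTT; rewrite -!leNgt le_eqVlt => /predU1P[ts|/mono ts].
  by rewrite /absp ts.
by rewrite ltW // ts.
Qed.

Lemma ler_absp p s t : 1 <= p -> (absp p s <= absp p t) = (`|s| <= `|t|).
Proof. by move=> p1; rewrite leNgt ltr_absp // -leNgt. Qed.

Lemma absp_inj p s t : 1 <= p -> absp p s = absp p t -> `|s| = `|t|.
Proof. by move=> p1 st; apply: le_anti; rewrite -!(ler_absp _ _ p1) st lexx. Qed.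

Lemma absp_eq0 p t : 1 <= p -> (absp p t == 0) = (t == 0).
Proof.
move=> p1; apply/eqP/eqP => [|->]; last exact: absp0.
by rewrite -[X in _ = X -> _](absp0 p1) => /(absp_inj p1); rewrite normr0 => /normr0P/eqP.
Qed.

Lemma absp_le1 p t : 1 <= p -> (absp p t <= 1) = (`|t| <= 1).
Proof. by move=> p1; have := ler_absp t 1 p1; rewrite absp1 normr1. Qed.

Lemma absp_lt1 p t : 1 <= p -> (absp p t < 1) = (`|t| < 1).
Proof. by move=> p1; have := ltr_absp t 1 p1; rewrite absp1 normr1. Qed.

Lemma absp_gt1 p t : 1 <= p -> (1 < absp p t) = (1 < `|t|).
Proof. by move=> p1; have := ltr_absp 1 t p1; rewrite absp1 normr1. Qed.

Lemma absp_eq1 p t : 1 <= p -> absp p t = 1 -> `|t| = 1.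
Proof. by move=> p1; rewrite -[X in _ = X -> _](absp1 p) => /(absp_inj p1); rewrite normr1. Qed.

Lemma absp_surj p e : 1 <= p -> 0 <= e -> exists2 t, 0 <= t & absp p t = e.
Proof.
move=> p1 e0; exists (e `^ p^-1); first exact: powR_ge0.
have p0 : p != 0 by rewrite gt_eqF // (lt_le_trans ltr01).
by rewrite /absp ger0_norm ?powR_ge0 // -powRrM mulVf // powRr1.
Qed.

(** Split off one factor 1 + t and bound the remaining power from below, by 1 in one summand and by
    t^(p-1) in the other. *)
Lemma absp_superadd p t : 1 <= p -> 0 <= t -> 1 + absp p t <= absp p (1 + t).
Proof.
move=> p1 t0; have p0 : 0 < p by exact: lt_le_trans p1.
have t1 : 0 < 1 + t by lra.
rewrite /absp !ger0_norm; try lra.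
rewrite -(mulr_powRB1 t0 p0) -[in leRHS](mulr_powRB1 (ltW t1) p0) mulrDl mul1r.
apply: lerD.
  have : 1 `^ (p - 1) <= (1 + t) `^ (p - 1).
    by rewrite ge0_ler_powR ?nnegrE ?subr_ge0 //; lra.
  by rewrite powR1.
by apply: ler_wpM2l => //; rewrite ge0_ler_powR ?nnegrE ?subr_ge0 //; lra.
Qed.

(** Strict Bernoulli inequality. The bound 1 + t < exp t is used at t = (p - 1) ln u for u^(p-1),
    and at t = - ln u to eliminate the logarithm. *)
Lemma bernoulli_lt p u : 1 < p -> 0 <= u -> u != 1 -> 1 + p * (u - 1) < u `^ p.
Proof.
move=> p1; have p0 : 0 < p by exact: lt_trans p1.
rewrite le_eqVlt => /predU1P[<- _|u0 u1]; first by rewrite powR0 ?gt_eqF //; lra.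
have lnu : ln u != 0 by rewrite ln_eq0.
have H1 : 1 + (p - 1) * ln u < expR ((p - 1) * ln u).
  by apply: expR_gt1Dx; rewrite mulf_neq0 // gt_eqF // subr_gt0.
have H2 : 1 - ln u < expR (- ln u) by apply: expR_gt1Dx; rewrite oppr_eq0.
have uE : u `^ p = u * expR ((p - 1) * ln u).
  rewrite -(mulr_powRB1 (ltW u0) p0) /powR gt_eqF //.
have uV : u * expR (- ln u) = 1 by rewrite expRN lnK ?posrE // mulfV ?gt_eqF.
have : u * (p) < u * (expR ((p - 1) * ln u) + (p - 1) * expR (- ln u)).
  rewrite ltr_pM2l //.
  have : (p - 1) * (1 - ln u) <= (p - 1) * expR (- ln u).
    by apply: ler_wpM2l; [lra|exact: ltW].
  lra.
rewrite mulrDr -uE mulrCA uV; lra.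
Qed.

(** Strict convexity of t^p, with 2^(p-1) written as [absp p 2 / 2]. After division by the midpoint
    the arguments add up to 2, and the linear terms of the two Bernoulli bounds cancel. *)
Lemma absp_midpoint_lt p a b : 1 < p -> 0 <= a -> 0 <= b -> a != b ->
  absp p (a + b) < absp p 2 / 2 * (absp p a + absp p b).
Proof.
move=> p1 a0 b0 ab; pose m := (a + b) / 2.
have m0 : 0 < m.
  rewrite divr_gt0 // lt_neqAle addr_ge0 // andbT eq_sym paddr_eq0 //.
  by apply: contraNN ab => /andP[/eqP-> /eqP->].
pose u := a / m; have u0 : 0 <= u by rewrite divr_ge0 // ltW.
pose v := b / m; have v0 : 0 <= v by rewrite divr_ge0 // ltW.
have mE : a + b = 2 * m by rewrite /m; field.
have uv : u + v = 2 by rewrite /u /v -mulrDl mE mulfK // gt_eqF.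
have aE : a = m * u by rewrite /u mulrC divfK // gt_eqF.
have bE : b = m * v by rewrite /v mulrC divfK // gt_eqF.
clearbody u v m; have u1 : u != 1.
  apply: contraNN ab => /eqP u1; rewrite aE bE u1.
  by have -> : v = 1 by lra.
have v1 : v != 1 by apply: contraNN u1 => /eqP v1; apply/eqP; lra.
have := bernoulli_lt p1 u0 u1; have := bernoulli_lt p1 v0 v1 => Hv Hu.
rewrite mE aE bE !abspM [absp p u]/absp [absp p v]/absp !ger0_norm // -mulrDr.
have M0 : 0 < absp p m by rewrite /absp powR_gt0 // normr_gt0 gt_eqF.
have T0 : 0 < absp p 2 by rewrite /absp powR_gt0 // normr_gt0.
have uv2 : 1 < (u `^ p + v `^ p) / 2.
  have vE : v = 2 - u by lra.
  by rewrite vE in Hv *; lra.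
have -> : absp p 2 / 2 * (absp p m * (u `^ p + v `^ p)) =
    absp p 2 * absp p m * ((u `^ p + v `^ p) / 2) by field.
by rewrite ltr_pMr // mulr_gt0.
Qed.

Lemma absp_midpoint p a b : 1 < p ->
  absp p (a - b) <= absp p 2 / 2 * (absp p a + absp p b).
Proof.
move=> p1; have p1' := ltW p1.
apply: (@le_trans _ _ (absp p (`|a| + `|b|))).
  by rewrite ler_absp // [leRHS]ger0_norm ?addr_ge0 // ler_normB.
have [ab|ab] := eqVneq `|a| `|b|; last first.
  by have := absp_midpoint_lt p1 (normr_ge0 a) (normr_ge0 b) ab; rewrite !absp_norm => /ltW.
rewrite -[absp p a]absp_norm ab absp_norm -(absp_norm p b).
have -> : `|b| + `|b| = 2 * `|b| by lra.
by rewrite abspM; lra.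
Qed.

Lemma absp_midpoint_eq p a b : 1 < p ->
  absp p (a - b) = absp p 2 / 2 * (absp p a + absp p b) -> b = - a.
Proof.
move=> p1 E; have p1' := ltW p1.
have [ab|ab] := eqVneq `|a| `|b|; last first.
  have := absp_midpoint_lt p1 (normr_ge0 a) (normr_ge0 b) ab.
  rewrite !absp_norm -E ltr_absp // [ltLHS]ger0_norm ?addr_ge0 //.
  by rewrite ltNge ler_normB.
have /eqP := ab; rewrite eqr_norm2 => /orP[]/eqP aE; last by rewrite aE opprK.
move: E; rewrite aE subrr absp0 // => /esym/eqP; rewrite !mulf_eq0 invr_eq0.
rewrite absp_eq0 // !pnatr_eq0 /= paddr_eq0 ?absp_ge0 // absp_eq0 //.
by rewrite andbb => /eqP->; rewrite oppr0.
Qed.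

End AbsPower.

(** * Spaces with coordinates *)

Section FsetSums.
Local Open Scope fset_scope.
Local Open Scope ring_scope.
Context {R : realType} {T : choiceType} (f : T -> R).
Implicit Types F G H : {fset T}.

Lemma sum_fset1 i : \sum_(j <- [fset i]) f j = f i.
Proof. exact: big_seq_fset1. Qed.

Lemma sum_fsetU1 i F : i \notin F ->
  \sum_(j <- i |` F) f j = f i + \sum_(j <- F) f j.
Proof. exact: big_fsetU1. Qed.

Lemma sum_fset_eq0 F : (forall i, i \in F -> f i = 0) -> \sum_(i <- F) f i = 0.
Proof. by move=> f0; rewrite big_seq big1. Qed.

Lemma sum_fsetID F G :
  \sum_(i <- F) f i = \sum_(i <- F `&` G) f i + \sum_(i <- F `\` G) f i.
Proof.
rewrite (big_fsetID _ (fun i => i \in G)) /=; congr (_ + _);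
  by apply: eq_fbigl => i; rewrite !inE // andbC.
Qed.

Lemma sum_fset_supp F G : (forall i, i \in F -> i \notin G -> f i = 0) ->
  \sum_(i <- F) f i = \sum_(i <- F `&` G) f i.
Proof.
move=> f0; rewrite (sum_fsetID F G) [X in _ + X]sum_fset_eq0 ?addr0 // => i.
by rewrite inE => /andP[iG iF]; exact: f0.
Qed.

Hypothesis f_ge0 : forall i, 0 <= f i.

Lemma sum_fset_ge0 F : 0 <= \sum_(i <- F) f i.
Proof. exact: sumr_ge0. Qed.

Lemma sum_fset_le F G : F `<=` G -> \sum_(i <- F) f i <= \sum_(i <- G) f i.
Proof.
move=> FG; rewrite (sum_fsetID G F) (fsetIidPr FG) lerDl; exact: sum_fset_ge0.
Qed.

End FsetSums.

Lemma sum_fset_const (R : realType) (T : choiceType) (F : {fset T}) (a : R) (f : T -> R) :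
  (forall i, i \in F -> f i = a) -> \sum_(i <- F) f i = a *+ #|` F|.
Proof.
move=> fa; rewrite big_seq (eq_bigr (fun=> a)) // -big_seq big_const_seq count_predT.
by rewrite iter_addr addr0.
Qed.

(** This is the interface to the completion. [coord_le] and [coord_ge] describe the p-th power of
    the norm as a supremum without mentioning suprema or roots; [coord_tail] is the trace of the
    density of finitely supported vectors. *)
Record coordinate_system (R : realType) (p : R) (A : set {fset nat})
    (X : normedModType R) := CoordinateSystem {
  coord :> X -> nat -> R;
  vec : {fset nat} -> (nat -> R) -> X;
  coordB : forall x y i, coord (x - y) i = coord x i - coord y i;
  coordZ : forall a x i, coord (a *: x) i = a * coord x i;
  coord_vec : forall F a i, coord (vec F a) i = if i \in F then a i else 0;
  coord_le : forall x F, A F -> \sum_(i <- F) absp p (coord x i) <= absp p `|x|;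
  coord_ge : forall x B, (forall F, A F -> \sum_(i <- F) absp p (coord x i) <= B) ->
    absp p `|x| <= B;
  coord_tail : forall x e, 0 < e -> exists N, forall F, A F ->
    (forall k, k \in F -> (N <= k)%N) -> \sum_(i <- F) absp p (coord x i) <= e }.

Section Coordinates.
Local Open Scope fset_scope.
Local Open Scope ring_scope.
Context {R : realType} {p : R} {A : set {fset nat}} {X : normedModType R}.
Variables (c : coordinate_system p A X) (p1 : 1 <= p) (sA : schreier_family A).
Implicit Types (F G H : {fset nat}) (x y z : X) (i j k : nat).

Definition phi x := absp p `|x|.

Lemma hereditaryA : hereditary A. Proof. by have [] := schreier_family_props sA. Qed.

Lemma singletonA k : A [fset k]. Proof. by have [] := schreier_family_props sA. Qed.

Lemma set0A : A fset0. Proof. exact: hereditaryA (singletonA 0) (fsub0set _). Qed.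

Lemma exchangeA i j G : i \notin G -> (i <= j)%N -> A (i |` G) -> A (j |` G).
Proof. by have [hA shA _ _] := schreier_family_props sA; exact: exchange. Qed.

Lemma phi_norm x y : `|x| = `|y| <-> phi x = phi y.
Proof.
rewrite /phi; split => [->//|/(absp_inj p1)]; by rewrite !normr_id.
Qed.

Lemma phi1 x : `|x| = 1 <-> phi x = 1.
Proof.
rewrite /phi; split => [->|/(absp_eq1 p1)]; first exact: absp1.
by rewrite normr_id.
Qed.

Lemma phiN x : phi (- x) = phi x. Proof. by rewrite /phi normrN. Qed.

Lemma phiC x y : phi (x - y) = phi (y - x).
Proof. by rewrite -phiN opprB. Qed.

Lemma phi_le2 x y : phi x = 1 -> phi y = 1 -> phi (x - y) <= absp p 2.
Proof.
move=> /phi1 x1 /phi1 y1; rewrite /phi ler_absp // normr_id ger0_norm //.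
by rewrite (le_trans (ler_normB _ _)) // x1 y1.
Qed.

Lemma coord0 i : c 0 i = 0.
Proof. by rewrite -(subrr 0) coordB subrr. Qed.

Lemma coordN x i : c (- x) i = - c x i.
Proof. by rewrite -sub0r coordB coord0 sub0r. Qed.

Lemma coordD x y i : c (x + y) i = c x i + c y i.
Proof. by rewrite -{1}[y]opprK coordB coordN opprK. Qed.

Lemma phi_bound x B :
  (forall F, A F -> \sum_(i <- F) absp p (c x i) <= B) -> phi x <= B.
Proof. exact: coord_ge. Qed.

Lemma coord_inj x y : (forall i, c x i = c y i) -> x = y.
Proof.
move=> xy; apply/eqP; rewrite -subr_eq0 -normr_eq0 -(absp_eq0 _ p1).
rewrite eq_le absp_ge0 andbT; apply: phi_bound => F _.
by rewrite sum_fset_eq0 // => i _; rewrite coordB xy subrr absp0.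
Qed.

Lemma phi_sum x F : A F -> \sum_(i <- F) absp p (c x i) <= phi x.
Proof. exact: coord_le. Qed.

Lemma phi_coord x i : absp p (c x i) <= phi x.
Proof. by rewrite -(sum_fset1 (fun i => absp p (c x i))); exact/phi_sum/singletonA. Qed.

Lemma norm_coord x i : phi x = 1 -> `|c x i| <= 1.
Proof. by move=> x1; rewrite -(absp_le1 _ p1) -x1 phi_coord. Qed.

Lemma sum_le1 x F : phi x = 1 -> A F -> \sum_(i <- F) absp p (c x i) <= 1.
Proof. by move=> <-; exact: phi_sum. Qed.

Lemma phi_pair x i j : (0 < i)%N -> (0 < j)%N -> i != j ->
  absp p (c x i) + absp p (c x j) <= phi x.
Proof.
move=> i0 j0 ij; have := phi_sum x (schreier_family_pair sA i0 j0).
by rewrite sum_fsetU1 ?inE // sum_fset1.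
Qed.

Lemma phi_le0 x B : absp p (c x 0%N) <= B ->
  (forall F, A F -> 0%N \notin F -> \sum_(i <- F) absp p (c x i) <= B) ->
  phi x <= B.
Proof.
move=> x0 xF; apply: phi_bound => F AF.
have [F0|/xF//] := boolP (0%N \in F); last exact.
by rewrite (schreier_family_zero sA AF F0) sum_fset1.
Qed.

Lemma coord_small x e : 0 < e -> exists N, forall k, (N <= k)%N -> `|c x k| <= e.
Proof.
move=> e0; have ge0 : 0 < absp p e.
  by rewrite lt_neqAle absp_ge0 andbT eq_sym absp_eq0 // gt_eqF.
have [N NP] := coord_tail c x ge0; exists N => k Nk.
have := NP _ (singletonA k); rewrite sum_fset1 ler_absp // (gtr0_norm e0).
by apply => j; rewrite inE => /eqP->.
Qed.

Definition unit_vec i : X := vec c [fset i] (fun=> 1).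

Local Notation e := unit_vec.

Lemma coord_e i j : c (e i) j = (j == i)%:R.
Proof. by rewrite coord_vec inE; case: eqP. Qed.

Lemma phi_vec F a : A F -> phi (vec c F a) = \sum_(i <- F) absp p (a i).
Proof.
move=> AF; apply/le_anti/andP; split.
  apply: phi_bound => G _.
  rewrite (sum_fset_supp (G := F)); last first.
    by move=> i _ /negPf iF; rewrite coord_vec iF absp0.
  apply: (@le_trans _ _ (\sum_(i <- G `&` F) absp p (a i))).
    by rewrite big_seq [leRHS]big_seq ler_sum // => i; rewrite inE coord_vec => /andP[_ ->].
  by apply: sum_fset_le => [i|]; [exact: absp_ge0|exact: fsubsetIr].
apply: le_trans (phi_sum _ AF); rewrite big_seq [leRHS]big_seq.
by apply: ler_sum => i iF; rewrite coord_vec iF.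
Qed.

Lemma phi_e i : phi (e i) = 1.
Proof. by rewrite phi_vec ?sum_fset1 ?absp1 //; exact: singletonA. Qed.

(** The pair of [i] and [k] is in the family; it contributes nearly 1 at [k] and a fixed positive
    amount at [i]. *)
Lemma coord_far x i : (0 < i)%N -> c x i != 0 -> exists N, forall k, (N <= k)%N ->
  forall y, c y k = 1 -> c y i = 0 -> 1 < phi (y - x).
Proof.
move=> i0 xi; have gx : 0 < absp p (c x i).
  by rewrite lt_neqAle absp_ge0 andbT eq_sym absp_eq0.
have [m [m0 m1 mx]] : exists m, [/\ 0 < m, m <= 1 & m <= absp p (c x i)].
  by exists (Num.min 1 (absp p (c x i))); rewrite lt_min ltr01 !ge_min !lexx orbT.
(* [d] is the loss tolerated at [k], less than the contribution at [i]; it is respected once [c x k]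
   is at most [1 - t], where t^p = 1 - d. *)
pose d := m / 2; have [d0 d1 dx] : [/\ 0 < d, d < 1 & d < absp p (c x i)].
  by rewrite /d; split; lra.
clearbody d; have [t t0 gt] : exists2 t, 0 <= t & absp p t = 1 - d.
  by apply: absp_surj => //; rewrite subr_ge0 ltW.
have t1 : t < 1.
  have : absp p t < 1 by lra.
  by rewrite absp_lt1 // ger0_norm.
have t1' : 0 < 1 - t by rewrite subr_gt0.
have [N NP] := coord_small x t1'.
exists (maxn N i.+1) => k; rewrite geq_max => /andP[/NP xk ik] y yk yi.
have k0 : (0 < k)%N := leq_ltn_trans (leq0n i) ik.
have ki : k != i by rewrite neq_ltn ik orbT.
apply: lt_le_trans (phi_pair (y - x) k0 i0 ki).
rewrite !coordB yk yi sub0r abspN.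
have : absp p t <= absp p (1 - c x k).
  rewrite ler_absp // ger0_norm //; apply: le_trans (ler_norm _).
  by have := ler_norm (c x k); lra.
lra.
Qed.

Definition sphere0 x := phi x = 1 /\ c x 0%N = 0.

Lemma sphere_axis x : phi x = 1 -> (forall i, (0 < i)%N -> c x i = 0) ->
  x = e 0 \/ x = - e 0.
Proof.
move=> x1 x0; have : `|c x 0%N| = 1.
  apply: (absp_eq1 p1); apply/le_anti; rewrite -{1}x1 phi_coord /= -x1.
  apply: phi_le0 => // F _ F0; rewrite sum_fset_eq0 ?absp_ge0 // => i iF.
  rewrite x0 ?absp0 //; case: i iF => // iF; by rewrite iF in F0.
move/eqP; rewrite eqr_norml ler01 andbT => /orP[]/eqP x01; [left|right];
by apply: coord_inj => -[|i]; rewrite ?coordN coord_e ?x01 ?x0 //= oppr0.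
Qed.

(** By [coord_far], if both vectors have nonzero coordinates beyond index 0, then [e k] with [k]
    large escapes both balls. If one vector lies on the axis, the other is opposite to it at index
    0, and a further coordinate is excluded in the same way. *)
Lemma axis_pair x y : phi x = 1 -> phi y = 1 -> phi (x - y) = absp p 2 ->
  (forall z, phi z = 1 -> phi (z - x) <= 1 \/ phi (z - y) <= 1) ->
  (x = e 0 /\ y = - e 0) \/ (x = - e 0 /\ y = e 0).
Proof.
have main a b : phi a = 1 -> phi b = 1 -> phi (a - b) = absp p 2 ->
    (forall z, phi z = 1 -> phi (z - a) <= 1 \/ phi (z - b) <= 1) ->
    (forall i, (0 < i)%N -> c a i = 0) ->
    (a = e 0 /\ b = - e 0) \/ (a = - e 0 /\ b = e 0).
  move=> a1 b1 ab abz a0; have aE := sphere_axis a1 a0.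
  have [s s1 as_] : exists2 s : R, `|s| = 1 & c a 0%N = s.
    exists (c a 0%N) => //.
    by case: aE => ->; rewrite ?coordN coord_e eqxx ?normrN normr1.
  have b0 : c b 0%N = - s.
    (* Away from index 0 the difference is [- b], which contributes at most 1, so distance 2 must be
       realised at index 0. *)
    have : absp p 2 <= absp p (c (a - b) 0%N).
      rewrite leNgt; apply/negP => lt2.
      have g2 : 1 < absp p 2 :> R by rewrite absp_gt1 // ger0_norm // ltr1n.
      have : phi (a - b) <= Num.max 1 (absp p (c (a - b) 0%N)).
        apply: phi_le0 => [|F AF F0]; first by rewrite le_max lexx orbT.
        rewrite le_max; apply/orP; left; rewrite -b1.
        apply: le_trans (phi_sum _ AF); rewrite le_eqVlt; apply/predU1P; left.
        rewrite big_seq [RHS]big_seq; apply: eq_bigr => i iF.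
        rewrite coordB a0 ?sub0r ?abspN //.
        by case: i iF F0 => // ->.
      by rewrite ab le_max leNgt g2 leNgt lt2.
    rewrite ler_absp // coordB as_ ger0_norm // => H.
    move: (norm_coord 0 b1) s1 H; rewrite ler_norml => /andP[].
    by case: (ger0P s); case: (ger0P (s - c b 0%N)); lra.
  have {}bz : forall i, (0 < i)%N -> c b i = 0.
    move=> i i0; apply/eqP; apply: contraT => bi.
    have [N NP] := coord_far i0 bi; pose k := (maxn N i).+1.
    have Nk : (N <= k)%N by rewrite leqW // leq_maxl.
    have ik : (i < k)%N by rewrite ltnS leq_maxr.
    (* The entry [- s / 2] puts [z] at distance at least 3/2 from [a]; the entry 1 at [k] puts it
       far from [b]. *)
    pose z := vec c [fset 0%N; k] (fun j => if j == 0%N then - s / 2 else 1).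
    have zE j : c z j = if j == 0%N then - s / 2 else (j == k)%:R.
      by rewrite coord_vec !inE; case: eqP => //= _; case: eqP.
    have z1 : phi z = 1.
      apply/le_anti/andP; split; last first.
        by have := phi_coord z k; rewrite zE eqxx absp1.
      apply: phi_le0; rewrite ?zE /=.
        by rewrite absp_le1 // normrM normrN s1; rewrite ger0_norm //; lra.
      move=> F AF F0; rewrite (sum_fset_supp (G := [fset k])).
        apply: (@le_trans _ _ (\sum_(i <- [fset k]) absp p (c z i))).
          by apply: sum_fset_le; [move=> ?; exact: absp_ge0|exact: fsubsetIr].
        by rewrite sum_fset1 zE eqxx absp1.
      move=> j jF; rewrite inE zE => /negPf ->; case: eqP => [j0|_].
        by rewrite -j0 jF in F0.
      exact: absp0.
    case: (abz z z1); rewrite leNgt => /negP[].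
      apply: lt_le_trans (phi_coord _ 0); rewrite coordB as_ zE /= absp_gt1 //.
      rewrite (_ : - s / 2 - s = - (3 / 2) * s); last by field.
      by rewrite normrM s1 normrN ger0_norm; lra.
    by apply: (NP k); rewrite // zE ?eqxx // (gtn_eqF i0) (ltn_eqF ik).
  have bE := sphere_axis b1 bz; move: as_ b0; case: aE => ->; case: bE => ->;
    rewrite ?coordN !coord_e eqxx ?mulr1n => <- b0.
  - by exfalso; lra.
  - by left.
  - by right.
  - by exfalso; lra.
move=> x1 y1 xy xyz.
have [x0|/existsNP[i /not_implyP[i0 /eqP xi]]] :=
  pselect (forall i, (0 < i)%N -> c x i = 0); first exact: main.
have [y0|/existsNP[j /not_implyP[j0 /eqP yj]]] :=
  pselect (forall i, (0 < i)%N -> c y i = 0).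
  have yx : phi (y - x) = absp p 2 by rewrite phiC.
  have yxz z : phi z = 1 -> phi (z - y) <= 1 \/ phi (z - x) <= 1.
    by move=> /xyz[]; [right|left].
  by have [[-> ->]|[-> ->]] := main y x y1 x1 yx yxz y0; [right|left].
have [N NP] := coord_far i0 xi; have [M MP] := coord_far j0 yj.
pose k := (maxn (maxn N M) (maxn i j)).+1.
have [Nk Mk] : (N <= k)%N /\ (M <= k)%N by rewrite !leqW // !leq_max leqnn ?orbT.
have [ik jk] : (i < k)%N /\ (j < k)%N by rewrite !ltnS !leq_max !leqnn !orbT.
case: (xyz (e k) (phi_e k)); rewrite leNgt => /negP[].
  by apply: (NP k); rewrite // coord_e ?eqxx // (ltn_eqF ik).
by apply: (MP k); rewrite // coord_e ?eqxx // (ltn_eqF jk).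
Qed.

End Coordinates.

(** * From a signed permutation of the basis to the identity *)

Section Rigidity.
Local Open Scope fset_scope.
Local Open Scope ring_scope.
Context {R : realType} {p : R} {A : set {fset nat}} {X : normedModType R}.
Variables (c : coordinate_system p A X) (p1 : 1 <= p) (sA : schreier_family A).
Implicit Types (F G H : {fset nat}) (x y z : X) (i j k : nat).

Local Notation g := (absp p).
Local Notation phi := (@phi R p X).
Local Notation e := (unit_vec c).
Local Notation sphere0 := (sphere0 c).

(** Carrying the inverse along makes the notion symmetric, so every result on [T] also applies to
    [T']. *)
Definition sphere_iso (T T' : X -> X) :=
  [/\ forall x, sphere0 x -> sphere0 (T x),
      forall x, sphere0 x -> sphere0 (T' x),
      forall x, sphere0 x -> T' (T x) = x,
      forall x, sphere0 x -> T (T' x) = x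
    & forall x y, sphere0 x -> sphere0 y -> phi (T x - T y) = phi (x - y)].

Lemma sphere_iso_sym T T' : sphere_iso T T' -> sphere_iso T' T.
Proof.
move=> [T1 T1' TK TK' Tp]; split => // x y sx sy.
by rewrite -Tp ?TK' //; exact: T1'.
Qed.

Lemma sphere0N x : sphere0 x -> sphere0 (- x).
Proof. by move=> [x1 x0]; split; rewrite ?phiN // coordN x0 oppr0. Qed.

Lemma sphere0_e i : (0 < i)%N -> sphere0 (e i).
Proof.
by move=> i0; split; rewrite ?phi_e // coord_e; case: i i0.
Qed.

Lemma sum_shift_in x s i F : i \in F ->
  \sum_(j <- F) g (c (x - s *: e i) j) = g (c x i - s) + \sum_(j <- F `\ i) g (c x j).
Proof.
move=> iF; rewrite (big_fsetD1 i) //= coordB coordZ coord_e eqxx mulr1; congr (_ + _).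
rewrite big_seq [RHS]big_seq; apply: eq_bigr => j; rewrite !inE => /andP[/negPf ji _].
by rewrite coordB coordZ coord_e ji mulr0 subr0.
Qed.

Lemma sum_shift_notin x s i F : i \notin F ->
  \sum_(j <- F) g (c (x - s *: e i) j) = \sum_(j <- F) g (c x j).
Proof.
move=> iF; rewrite big_seq [RHS]big_seq; apply: eq_bigr => j jF.
rewrite coordB coordZ coord_e (_ : j == i = false) ?mulr0 ?subr0 //.
by apply: contraNF iF => /eqP <-.
Qed.

(** Sums over sets containing [i] drop by the fixed amount [d], the other sums are at most 1, and
    the right-hand side exceeds 1. Both margins survive the supremum. *)
Lemma phi_coord_sub_lt x i : phi x = 1 -> 0 < c x i -> phi (x - e i) < phi (x + e i).
Proof.
move=> x1 xi; have -> : x + e i = x - (-1) *: e i by rewrite scaleN1r opprK.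
rewrite -[e i in ltLHS]scale1r; have xi1 := norm_coord c p1 sA i x1.
have up : g (c x i - 1) < g (c x i - -1).
  by rewrite ltr_absp // opprK [ltRHS]ger0_norm ?addr_ge0 ?ltW //;
    rewrite ltr_norml; apply/andP; split; lra.
pose d := g (c x i - -1) - g (c x i - 1).
have big1 : 1 < phi (x - (-1) *: e i).
  apply: lt_le_trans (phi_coord c sA _ i); rewrite coordB coordZ coord_e eqxx mulr1.
  by rewrite absp_gt1 // opprK ger0_norm ?addr_ge0 ?ltW //; lra.
apply: (@le_lt_trans _ _ (Num.max 1 (phi (x - (-1) *: e i) - d))); last first.
  by rewrite gt_max big1 /= gtrBl subr_gt0.
apply: (phi_bound (c := c)) => F AF; rewrite le_max; apply/orP.
have [iF|iF] := boolP (i \in F); last first.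
  by left; rewrite sum_shift_notin // sum_le1.
right; rewrite lerBrDr; apply: le_trans (phi_sum c _ AF).
by rewrite !sum_shift_in // /d; lra.
Qed.

Lemma coord_eq0 x i : phi x = 1 ->
  (phi (x - e i) == phi (x + e i)) = (c x i == 0).
Proof.
move=> x1; apply/eqP/eqP => [xe|x0].
  apply/eqP; case: ltgtP => // xi.
    have := phi_coord_sub_lt (x := - x) (i := i); rewrite phiN coordN oppr_gt0.
    by move=> /(_ x1 xi); rewrite -opprD [- x + _]addrC -opprB !phiN xe ltxx.
  by have := phi_coord_sub_lt x1 xi; rewrite xe ltxx.
have -> : x + e i = x - (-1) *: e i by rewrite scaleN1r opprK.
rewrite -[e i in LHS]scale1r; apply/le_anti/andP; split;
apply: (phi_bound (c := c)) => F AF; apply: le_trans (phi_sum c _ AF);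
(have [iF|iF] := boolP (i \in F);
  [by rewrite !sum_shift_in // x0 !sub0r !abspN|by rewrite !sum_shift_notin]).
Qed.

Definition signed_basis_map (T : X -> X) (pi : nat -> nat) (th : nat -> R) :=
  forall i, (0 < i)%N -> [/\ (0 < pi i)%N, th i = 1 \/ th i = -1,
    T (e i) = th i *: e (pi i) & T (- e i) = - (th i *: e (pi i))].

Lemma e_inj i j (s t : R) : s != 0 -> s *: e i = t *: e j -> i = j.
Proof.
move=> s0 /(congr1 (fun x => c x i)); rewrite !coordZ !coord_e eqxx.
by case: eqP => //= _ /eqP; rewrite mulr1 mulr0 (negPf s0).
Qed.

Section Pair.
Variables (T T' : X -> X) (pi pi' : nat -> nat) (th th' : nat -> R).
Hypotheses (TT' : sphere_iso T T').
Hypotheses (Tpi : signed_basis_map T pi th) (Tpi' : signed_basis_map T' pi' th').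

Lemma basis_mapK i : (0 < i)%N -> pi' (pi i) = i.
Proof.
move=> i0; have [pi0 thi Te TNe] := Tpi i0; have [pi0' thi' Te' TNe'] := Tpi' pi0.
have [_ _ TK _ _] := TT'; have sN := sphere0N (sphere0_e i0).
have := TK _ (sphere0_e i0); have := TK _ sN; rewrite Te TNe.
case: thi => ->; rewrite ?scale1r ?scaleN1r ?opprK Te' TNe'.
  move=> _ H; have := H; rewrite -[RHS]scale1r => /e_inj; apply.
  by case: thi' => ->; rewrite ?oppr_eq0 oner_neq0.
move=> H _; have := H; rewrite -[RHS]scaleN1r => /e_inj; apply.
by case: thi' => ->; rewrite ?oppr_eq0 oner_neq0.
Qed.

Lemma coord_image_eq0 x i : sphere0 x -> (0 < i)%N ->
  (c (T x) (pi i) == 0) = (c x i == 0).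
Proof.
move=> sx i0; have [pi0 thi Te TNe] := Tpi i0.
have [T1 _ _ _ Tp] := TT'; have [x1 _] := sx; have [Tx1 _] := T1 _ sx.
have se := sphere0_e i0; have sNe := sphere0N se.
rewrite -!coord_eq0 //; have := Tp _ _ sx se; have := Tp _ _ sx sNe.
rewrite opprK Te TNe opprK => <- <-.
by case: thi => ->; rewrite ?scale1r ?scaleN1r ?opprK // eq_sym.
Qed.

End Pair.

Definition ims (f : nat -> nat) F : {fset nat} := [fset x in map f F].

Lemma imsP f F k : reflect (exists2 i, i \in F & k = f i) (k \in ims f F).
Proof. by rewrite inE; exact: mapP. Qed.

(** Let [H] be in the family but not [F], which has one more point [a]. For [x] flat on [H], each
    set of the family through [a] misses a share of [x], so [x + e a] stays below 2; on the image
    side nothing is missed and 2 is reached. *)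
Lemma basis_map_reflects T T' pi pi' th th' F :
  sphere_iso T T' -> signed_basis_map T pi th -> signed_basis_map T' pi' th' ->
  (forall i, i \in F -> (0 < i)%N) -> A (ims pi F) -> A F.
Proof.
move=> TT' Tpi Tpi'; have piK := basis_mapK TT' Tpi Tpi'.
have piK' := basis_mapK (sphere_iso_sym TT') Tpi' Tpi.
move: {2}#|` F| (erefl #|` F|) => n; elim: n F => [|n IH] F.
  by move=> /cardfs0_eq -> _ _; exact: set0A.
move=> Fn F0 AF; have [a aF] : exists a, a \in F.
  by apply/fset0Pn; rewrite -cardfs_eq0 Fn.
pose H := F `\ a; have FE : F = a |` H by rewrite fsetD1K.
have aH : a \notin H by rewrite !inE eqxx.
have H0 i : i \in H -> (0 < i)%N by rewrite inE => /andP[_ /F0].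
have a0 := F0 _ aF.
have AH : A H.
  apply: IH => //; first by have := cardfsD1 a F; rewrite aF Fn => -[].
  apply: (hereditaryA sA AF); apply/fsubsetP => k /imsP[i]; rewrite inE => /andP[_ iF] ->.
  by apply/imsP; exists i.
have [H00|Hn0] := eqVneq H fset0.
  by rewrite FE H00 fsetU0; exact: singletonA.
apply: contrapT => nAF.
have N0 : (0 < #|` H|)%N by rewrite lt0n cardfs_eq0.
have N0' : 0 < (#|` H|)%:R :> R by rewrite ltr0n.
have [t t0 gt] : exists2 t, 0 <= t & g t = (#|` H|)%:R^-1.
  by apply: absp_surj => //; rewrite invr_ge0 ltW.
pose x := vec c H (fun=> t).
have x1 : phi x = 1.
  rewrite phi_vec // (@sum_fset_const _ _ _ (g t)) // gt -[_ *+ _]mulr_natr mulVf //.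
  by rewrite gt_eqF.
have sx : sphere0 x.
  by split => //; rewrite coord_vec; case: ifP => // /H0.
have [T1 _ _ _ Tp] := TT'.
have [z1 z0] := T1 _ sx; set z := T x in z1 z0.
have zsupp k : k \notin ims pi H -> c z k = 0.
  case: k => // k kH; have [pk0 _ _ _] := Tpi' k.+1 isT.
  apply/eqP; rewrite -(piK' k.+1) // (coord_image_eq0 TT' Tpi) // coord_vec.
  case: ifP => // kH'; case/imsP: kH; exists (pi' k.+1) => //; by rewrite piK'.
have [pa0 tha Te TNe] := Tpi _ a0.
have paH : pi a \notin ims pi H.
  apply/imsP => -[i iH pai]; move: aH; rewrite -(piK a) // pai piK ?iH //; exact: H0.
(* Only the support of [T x] is known, not its values; as the image of [H] is in the family, they
   still add up to 1. *)
have zH : \sum_(k <- ims pi H) g (c z k) = 1.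
  apply/le_anti/andP; split.
    apply: sum_le1 => //; apply: (hereditaryA sA AF); apply/fsubsetP => k /imsP[i iH ->].
    by apply/imsP; exists i => //; rewrite FE inE iH orbT.
  rewrite -[leLHS]z1; apply: (phi_bound (c := c)) => G AG.
  rewrite (sum_fset_supp (G := ims pi H)); last first.
    by move=> i _ /zsupp ->; rewrite absp0.
  by apply: sum_fset_le; [move=> ?; exact: absp_ge0|exact: fsubsetIr].
have ge2 : 2 <= phi (x + e a).
  have se := sphere0_e a0; rewrite -[e a]opprK -(Tp _ _ sx (sphere0N se)) TNe -/z.
  rewrite -scaleNr; apply: le_trans (phi_sum c _ (_ : A (pi a |` ims pi H))); last first.
    apply: (hereditaryA sA AF); apply/fsubsetP => k; rewrite in_fset1U.
    move=> /orP[/eqP->|/imsP[i iH ->]]; apply/imsP; first by exists a.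
    by exists i => //; rewrite FE inE iH orbT.
  rewrite sum_shift_in ?fset1U1 // fsetU1K // zH zsupp // sub0r abspN abspN.
  by case: tha => ->; rewrite ?abspN absp1.
have : phi (x + e a) <= 2 - (#|` H|)%:R^-1.
  have iN1 : (#|` H|)%:R^-1 <= 1 :> R by rewrite invf_le1 // ler1n.
  have xsum G : \sum_(k <- G) g (c x k) = (#|` H|)%:R^-1 *+ #|` G `&` H|.
    rewrite (sum_fset_supp (G := H)); last first.
      by move=> i _ /negPf iH; rewrite coord_vec iH absp0.
    rewrite (@sum_fset_const _ _ _ (g t)) ?gt // => i.
    by rewrite inE coord_vec => /andP[_ ->].
  have -> : x + e a = x - (-1) *: e a by rewrite scaleN1r opprK.
  apply: (phi_bound (c := c)) => G AG.
  have [aG|aG] := boolP (a \in G); last first.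
    rewrite sum_shift_notin //; apply: le_trans (sum_le1 c x1 AG) _; lra.
  rewrite sum_shift_in // coord_vec (negPf aH) sub0r opprK absp1.
  rewrite (_ : 2 = 1 + 1 :> R) // -addrA lerD2l xsum.
  have GH : (#|` (G `\ a) `&` H| < #|` H|)%N.
    apply: fproper_ltn_card; rewrite fproperE fsubsetIr /=.
    apply/negP => HG; apply: nAF; rewrite FE; apply: (hereditaryA sA AG).
    apply/fsubsetP => k; rewrite in_fset1U => /orP[/eqP->//|kH].
    by have := fsubsetP HG _ kH; rewrite !inE => /andP[/andP[]].
  have iN0 : 0 <= (#|` H|)%:R^-1 :> R by rewrite invr_ge0 ltW.
  have := ler_wpMn2l iN0 GH; rewrite mulrSr -[leRHS]mulr_natr mulVf ?gt_eqF //; lra.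
apply/negP; rewrite -ltNge; apply: lt_le_trans ge2; rewrite gtrBl invr_gt0 //.
Qed.

(** If [pi] reversed the order of [i] and [j], [schreier_family_strict] would give a [G] compatible
    with [pi i] but not with [pi j]; pulled back by [pi], this contradicts the exchange of [i] for
    [j]. *)
Lemma basis_map_homo T T' pi pi' th th' :
  sphere_iso T T' -> signed_basis_map T pi th -> signed_basis_map T' pi' th' ->
  forall i j, (0 < i)%N -> (i < j)%N -> (pi i < pi j)%N.
Proof.
move=> TT' Tpi Tpi' i j i0 ij; have j0 : (0 < j)%N by exact: leq_trans ij.
have T'T := sphere_iso_sym TT'.
have piK := basis_mapK TT' Tpi Tpi'; have piK' := basis_mapK T'T Tpi' Tpi.
have [pi0 _ _ _] := Tpi _ i0; have [pj0 _ _ _] := Tpi _ j0.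
rewrite ltnNge leq_eqVlt; apply/negP => /predU1P[pij|pji].
  by move: ij; rewrite -(piK i) // -pij piK // ltnn.
have [G [Gpi AG nAG]] := schreier_family_strict sA pji.
have pos' k : (0 < k)%N -> (0 < pi' k)%N by move=> /Tpi'[].
have G0 k : k \in G -> (0 < k)%N by move=> /Gpi; exact: leq_ltn_trans.
pose F := ims pi' G.
have iF : i \notin F.
  apply/imsP => -[k kG iE]; have := Gpi _ kG; rewrite iE piK' ?ltnn //; exact: G0.
have AiF : A (i |` F).
  apply: (basis_map_reflects TT' Tpi Tpi').
    by move=> k; rewrite in_fset1U => /orP[/eqP->//|/imsP[l /G0 l0 ->]]; exact: pos'.
  apply: (hereditaryA sA AG); apply/fsubsetP => k /imsP[l].
  rewrite !in_fset1U => /orP[/eqP-> ->|/imsP[m mG ->] ->]; first by rewrite eqxx.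
  by rewrite piK' ?mG ?orbT //; exact: G0.
have AjF := exchangeA sA iF (ltnW ij) AiF.
apply: nAG; apply: (basis_map_reflects T'T Tpi' Tpi).
  by move=> k; rewrite in_fset1U => /orP[/eqP->//|]; exact: G0.
apply: (hereditaryA sA AjF); apply/fsubsetP => k /imsP[l].
rewrite !in_fset1U => /orP[/eqP-> ->|lG ->]; first by rewrite piK // eqxx.
by apply/orP; right; apply/imsP; exists l.
Qed.

(** An increasing map of the positive indices moves none of them down; applied to the inverse as
    well, this leaves equality. *)
Lemma basis_map_id T T' pi pi' th th' :
  sphere_iso T T' -> signed_basis_map T pi th -> signed_basis_map T' pi' th' ->
  forall i, (0 < i)%N -> pi i = i.
Proof.
move=> TT' Tpi Tpi' i i0; have T'T := sphere_iso_sym TT'.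
have ge S S' rho rho' s s' : sphere_iso S S' -> signed_basis_map S rho s ->
    signed_basis_map S' rho' s' -> forall k, (0 < k)%N -> (k <= rho k)%N.
  move=> SS Srho Srho'; elim=> // -[_ _|k IH _]; first by have [] := Srho _ (isT : 0 < 1)%N.
  by apply: leq_ltn_trans (IH isT) _; exact: basis_map_homo SS Srho Srho' _ _ _ _.
apply/eqP; rewrite eqn_leq (ge _ _ _ _ _ _ TT' Tpi Tpi') // andbT.
rewrite -{2}(basis_mapK TT' Tpi Tpi' i0); apply: (ge _ _ _ _ _ _ T'T Tpi' Tpi).
by have [] := Tpi _ i0.
Qed.

End Rigidity.

(** * Exponents greater than 1 *)

Section Antipodes.
Local Open Scope fset_scope.
Local Open Scope ring_scope.
Context {R : realType} {p : R} {A : set {fset nat}} {X : normedModType R}.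
Variables (c : coordinate_system p A X) (p1 : 1 < p) (sA : schreier_family A).
Implicit Types (F G H E : {fset nat}) (x y z : X) (i j k : nat).

Local Notation g := (absp p).
Local Notation phi := (@phi R p X).
Local Notation e := (unit_vec c).
Local Notation sphere0 := (sphere0 c).

Let p1' : 1 <= p := ltW p1.

Definition antipodal x :=
  sphere0 x /\ forall y, sphere0 y -> phi (x - y) = g 2 -> y = - x.

Lemma fset_lower_bound (f : nat -> R) F : (forall i, i \in F -> 0 < f i) ->
  exists2 d, 0 < d & forall i, i \in F -> d <= f i.
Proof.
move=> f0; have H (s : seq nat) : {subset s <= F} ->
    exists2 d, 0 < d & forall i, i \in s -> d <= f i.
  elim: s => [|a s IH] sF; first by exists 1.
  have [|d d0 dP] := IH; first by move=> i si; apply: sF; rewrite inE si orbT.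
  exists (Num.min d (f a)); first by rewrite lt_min d0 f0 // sF // mem_head.
  move=> i; rewrite inE ge_min => /predU1P[->|/dP->//]; by rewrite lexx orbT.
have [d d0 dP] := H (enum_fset F) (fun _ h => h).
by exists d => // i iF; exact: dP.
Qed.

Lemma sum_missing x F G i : (forall j, j \notin F -> c x j = 0) ->
  \sum_(j <- F) g (c x j) <= 1 -> i \in F -> i \notin G ->
  \sum_(j <- G) g (c x j) <= 1 - g (c x i).
Proof.
move=> xF F1 iF iG; rewrite (sum_fset_supp (G := F)); last first.
  by move=> j _ /xF ->; rewrite absp0.
apply: (@le_trans _ _ (\sum_(j <- F `\ i) g (c x j))).
  apply: sum_fset_le; first by move=> ?; exact: absp_ge0.
  apply/fsubsetP => j; rewrite !inE => /andP[jG ->]; rewrite andbT.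
  by apply: contraNneq iG => <-.
by move: F1; rewrite (big_fsetD1 i) //=; lra.
Qed.

Lemma absp2_gt1 : 1 < g 2 :> R.
Proof. by rewrite absp_gt1 // ger0_norm // ltr1n. Qed.

(** Distance 2 forces equality in the midpoint inequality at each index of [G], hence [y = - x]
    there. At any other positive index, adding it to [G] leaves no mass for [y]. *)
Lemma extendable_antipodal G a : extendable A G -> (forall i, i \in G -> (0 < i)%N) ->
  (forall i, i \in G -> a i != 0) -> \sum_(i <- G) g (a i) = 1 ->
  antipodal (vec c G a).
Proof.
move=> eG G0 a0 a1; set x := vec c G a.
have AG : A G by apply: (hereditaryA sA (eG 1%N isT)); exact: fsubsetU1.
have x1 : phi x = 1 by rewrite phi_vec.
have xN i : i \notin G -> c x i = 0 by move=> /negPf iG; rewrite coord_vec iG.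
have xE i : i \in G -> c x i = a i by move=> iG; rewrite coord_vec iG.
have xG : \sum_(i <- G) g (c x i) = 1.
  by rewrite -a1 big_seq [RHS]big_seq; apply: eq_bigr => i /xE ->.
have sx : sphere0 x by split => //; apply: xN; apply/negP => /G0.
split => // y [y1 y0] xy.
have yG i : i \in G -> c y i = - c x i.
  move=> iG; apply: (absp_midpoint_eq p1); apply/eqP; apply: contraT => ne.
  (* [d] is lost on sets containing [i], and [d'] below on sets missing [i]; their minimum keeps the
     supremum away from its extreme value. *)
  pose d := g 2 / 2 * (g (c x i) + g (c y i)) - g (c x i - c y i).
  have d0 : 0 < d by rewrite subr_gt0 lt_neqAle ne absp_midpoint.
  pose d' := g 2 / 2 * g (c x i).
  have d'0 : 0 < d'.
    have g2 := absp2_gt1; have gx : 0 < g (c x i).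
      by rewrite lt_neqAle absp_ge0 andbT eq_sym absp_eq0 // xE ?a0.
    by rewrite mulr_gt0 // divr_gt0 // (lt_trans ltr01).
  have : phi (x - y) <= g 2 - Num.min d d'.
    apply: (phi_bound (c := c)) => F AF; have g2 := absp2_gt1.
    have xyF H : \sum_(j <- H) g (c (x - y) j) <=
        g 2 / 2 * (\sum_(j <- H) g (c x j) + \sum_(j <- H) g (c y j)).
      rewrite -big_split mulr_sumr /=; apply: ler_sum => j _.
      by rewrite coordB absp_midpoint.
    have yF := sum_le1 c y1 AF; have xF := sum_le1 c x1 AF.
    have [iF|iF] := boolP (i \in F).
      apply: (@le_trans _ _ (g 2 - d)); last by rewrite lerD2l lerN2 ge_min lexx.
      move: yF xF; rewrite !(big_fsetD1 i iF) /= => yF xF.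
      have := xyF (F `\ i); rewrite [c (x - y) i]coordB /d.
      set u := \sum_(j <- _) g (c (x - y) j).
      set v := \sum_(j <- _) _ in xF *; set w := \sum_(j <- _) _ in yF *.
      move=> uvw; have : g 2 / 2 * (g (c x i) + v + (g (c y i) + w)) <= g 2 / 2 * 2.
        by apply: ler_wpM2l; [rewrite divr_ge0 // absp_ge0|lra].
      lra.
    apply: (@le_trans _ _ (g 2 - d')); last by rewrite lerD2l lerN2 ge_min lexx orbT.
    apply: le_trans (xyF F) _.
    have xG1 : \sum_(j <- G) g (c x j) <= 1 by rewrite xG.
    have := sum_missing xN xG1 iG iF.
    rewrite /d'; set v := \sum_(j <- _) _ in yF *; set w := \sum_(j <- _) _ in xF *.
    move=> wx; have : g 2 / 2 * (w + v) <= g 2 / 2 * (1 - g (c x i) + 1).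
      by apply: ler_wpM2l; [rewrite divr_ge0 // absp_ge0|lra].
    lra.
  by rewrite xy leNgt gtrBl lt_min d0 d'0.
apply: (coord_inj (c := c) p1') => i; rewrite coordN.
have [/yG //|iG] := boolP (i \in G).
rewrite xN // oppr0; case: i iG => // i iG.
have := sum_le1 c y1 (eG i.+1 isT); rewrite sum_fsetU1 //.
have -> : \sum_(j <- G) g (c y j) = 1.
  rewrite -xG big_seq [RHS]big_seq; apply: eq_bigr => j jG.
  by rewrite yG // abspN.
rewrite gerDr => H; apply/eqP; rewrite -(absp_eq0 _ p1').
by rewrite eq_le H absp_ge0.
Qed.

(* Were the supremum not attained, an initial part [E] of almost norming sets
   could be prolonged forever, against compactness of the family. *)
Lemma norm_attained x : phi x = 1 ->
  exists2 F, A F & \sum_(i <- F) g (c x i) = 1.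
Proof.
move=> x1; apply: contrapT => natt.
(* [E] is the exact trace of [F] below [N], so that successive traces are the prefixes of one
   increasing sequence. *)
pose near E N F (d : R) :=
  [/\ A F, F `&` seg 0 N = E & 1 - d < \sum_(i <- F) g (c x i)].
pose P E N := forall d, 0 < d -> exists F, near E N F d.
have step E N : P E N -> exists k, (N <= k)%N /\ P (k |` E) k.+1.
  move=> PE; have [F0 [AF0 F0E _]] := PE 1 ltr01.
  have AE : A E by apply: (hereditaryA sA AF0); rewrite -F0E fsubsetIl.
  have E1 : \sum_(i <- E) g (c x i) < 1.
    rewrite lt_neqAle (sum_le1 c x1 AE) andbT; apply/eqP => E1.
    by apply: natt; exists E.
  (* The sum over [E] misses 1 by twice [d0], and a tail beyond [M] supplies at most [d0], so an
     almost norming set has a further point between [N] and [M]. *)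
  pose d0 := (1 - \sum_(i <- E) g (c x i)) / 2.
  have d00 : 0 < d0 by rewrite divr_gt0 // subr_gt0.
  have [M MP] := coord_tail c x d00.
  apply: contrapT => nok.
  (* Pigeonhole: if every [k] below [M] fails at some precision, the finest of these finitely many
     precisions defeats all of them. *)
  have bad n : exists2 d, 0 < d & forall k F, (k < n)%N -> (N <= k)%N ->
      ~ near (k |` E) k.+1 F d.
    elim: n => [|n [d dp dP]]; first by exists 1.
    have [Nn|Nn] := boolP (N <= n)%N; last first.
      exists d => // k F; rewrite ltnS leq_eqVlt => /predU1P[->|kn] Nk; last exact: dP.
      by rewrite Nk in Nn.
    have [d' d'p d'P] : exists2 d', 0 < d' & forall F, ~ near (n |` E) n.+1 F d'.
      apply: contrapT => H; apply: nok; exists n; split => // d' d'p.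
      by apply: contrapT => H'; apply: H; exists d' => // F nF; apply: H'; exists F.
    exists (Num.min d d'); first by rewrite lt_min dp.
    move=> k F kn Nk [AF FE Fd].
    have md : Num.min d d' <= d by rewrite ge_min lexx.
    have md' : Num.min d d' <= d' by rewrite ge_min lexx orbT.
    move: kn; rewrite ltnS leq_eqVlt => /predU1P[kn|kn].
      by apply: (d'P F); split; rewrite -?kn //; lra.
    by apply: (dP k F kn Nk); split => //; lra.
  have [d dp dP] := bad M.
  have [F [AF FE Fd]] : exists F, near E N F (Num.min d d0).
    by apply: PE; rewrite lt_min dp.
  have [K KM] : exists k, k \in (F `\` E) `&` seg 0 M.
    apply/fset0Pn/negP => /eqP FM.
    have AFE : A (F `\` E) by apply: (hereditaryA sA AF); exact: fsubsetDl.
    have := MP _ AFE; rewrite (sum_fsetID _ F E) in Fd.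
    have FEE : F `&` E = E by apply/fsetIidPr; rewrite -FE fsubsetIl.
    rewrite FEE in Fd.
    have min0 : Num.min d d0 <= d0 by rewrite ge_min lexx orbT.
    move=> H; have {}H : \sum_(i <- F `\` E) g (c x i) <= d0.
      apply: H => k kFE; rewrite leqNgt; apply/negP => kM.
      by move/fsetP/(_ k): FM; rewrite in_fsetI kFE in_seg /= add0n kM.
    by move: Fd; rewrite ltNge => /negP; apply; move: H min0; rewrite /d0; lra.
  have exk : exists k, k \in F `\` E by exists K; move: KM; rewrite in_fsetI => /andP[].
  have [k kFE kmin] := ex_minnP exk.
  have Nk : (N <= k)%N.
    rewrite leqNgt; apply/negP => kN; move: kFE; rewrite inE -{1}FE in_fsetI in_seg add0n.
    by rewrite kN /= andbT; case: (k \in F).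
  apply: (dP k F _ Nk).
    apply: leq_ltn_trans (kmin K _) _; first by move: KM; rewrite in_fsetI => /andP[].
    by move: KM; rewrite in_fsetI in_seg add0n => /andP[].
  split => //; last first.
    by apply: le_lt_trans Fd; rewrite lerD2l lerN2 ge_min lexx.
  apply/fsetP => j; rewrite in_fsetI in_seg add0n /= in_fset1U ltnS.
  have [jE|jE] := boolP (j \in E).
    rewrite orbT; move: jE; rewrite -FE in_fsetI in_seg add0n => /andP[-> /= jN].
    by rewrite (leq_trans (ltnW jN)).
  rewrite orbF; apply/andP/eqP => [[jF jk]|->].
    by apply/eqP; rewrite eqn_leq jk kmin // inE jE jF.
  by split => //; move: kFE; rewrite inE => /andP[].
have P0 : P fset0 0%N.
  move=> d dp; apply: contrapT => H.
  have : phi x <= 1 - d.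
    apply: (phi_bound (c := c)) => F AF; rewrite leNgt; apply/negP => Fd.
    apply: H; exists F; split => //; apply/fsetP => j.
    by rewrite in_fsetI in_seg add0n andbF in_fset0.
  by rewrite x1 leNgt gtrBl dp.
have [h hP] : exists h : {fset nat} * nat -> nat, forall s, P s.1 s.2 ->
    (s.2 <= h s)%N /\ P (h s |` s.1) (h s).+1.
  have /choice[h hP] : forall s : {fset nat} * nat, exists k, P s.1 s.2 ->
      (s.2 <= k)%N /\ P (k |` s.1) k.+1.
    move=> s; have [Ps|nPs] := pselect (P s.1 s.2); last by exists 0%N.
    by have [k kP] := step _ _ Ps; exists k.
  by exists h.
pose st := fix st t := if t is t'.+1 then (h (st t') |` (st t').1, (h (st t')).+1)
  else (fset0, 0%N).
have stP t : P (st t).1 (st t).2 by elim: t => [|t IH] //=; have [] := hP _ IH.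
pose m t := h (st t).
have mS t : (m t < m t.+1)%N by have [] := hP _ (stP t.+1).
have [_ _ cA _] := schreier_family_props sA.
have [k] := cA m (homo_ltn ltn_trans mS); apply.
have -> : prefix_fset m k = (st k).1.
  elim: k => [|k /= <-]; first by apply/fsetP => j; rewrite !inE.
  apply/fsetP => j; rewrite in_fset1U; apply/prefix_fsetP/orP => [[t]|].
    rewrite ltnS leq_eqVlt => /predU1P[->|tk] ->; first by left.
    by right; apply/prefix_fsetP; exists t.
  move=> [/eqP->|/prefix_fsetP[t tk ->]]; first by exists k.
  by exists t => //; exact: leqW.
have [F [AF <- _]] := stP k 1 ltr01.
by apply: (hereditaryA sA AF); exact: fsubsetIl.
Qed.

(** Every unit vector equal to [- x] on a norming set of [x] is at distance 2 from [x]. Truncating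
    [- x] to that set, or adding a small entry at an index that cannot join the support, would
    produce a second such vector. *)
Lemma antipodal_support x : antipodal x ->
  exists F, [/\ extendable A F, forall i, (c x i != 0) = (i \in F),
    forall i, i \in F -> (0 < i)%N & \sum_(i <- F) g (c x i) = 1].
Proof.
move=> [[x1 x0] xU]; have [F0 AF0 F01] := norm_attained x1.
have cN i : g (- c x i) = g (c x i) by exact: abspN.
have double y : sphere0 y -> (forall i, c x i != 0 -> i \in F0 -> c y i = - c x i) ->
    y = - x.
  move=> sy yF; apply: xU => //; apply/le_anti/andP; split.
    by apply: phi_le2 => //; case: sy.
  apply: le_trans (phi_sum c _ AF0).
  rewrite -[leLHS]mulr1 -[X in _ * X]F01 mulr_sumr big_seq [leRHS]big_seq; apply: ler_sum => i iF.
  have [xi|xi] := eqVneq (c x i) 0.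
    by rewrite xi absp0 // mulr0 absp_ge0.
  by rewrite coordB yF // (_ : _ - - _ = 2 * c x i) ?abspM //; ring.
have supp i : i \notin F0 -> c x i = 0.
  move=> iF; have : vec c F0 (fun j => - c x j) = - x.
    apply: double; last by move=> j _ jF; rewrite coord_vec jF.
    split; last by rewrite coord_vec x0 oppr0; case: ifP.
    by rewrite phi_vec // -F01; apply: eq_bigr.
  move/(congr1 (fun y => c y i)); rewrite coord_vec (negPf iF) coordN => /esym/eqP.
  by rewrite oppr_eq0 => /eqP.
pose F := [fset i in F0 | c x i != 0].
have FE i : (c x i != 0) = (i \in F).
  by rewrite !inE /=; have [//|/supp->] := boolP (i \in F0); rewrite eqxx.
have AF : A F by apply: (hereditaryA sA AF0); exact: fset_sub.
have F1 : \sum_(i <- F) g (c x i) = 1.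
  rewrite -F01 (sum_fset_supp (F := F0) (G := F)); last first.
    by move=> i _; rewrite -FE negbK => /eqP->; rewrite absp0.
  by congr (\sum_(i <- enum_fset _) _); apply/esym/fsetIidPr; exact: fset_sub.
exists F; split => //; last first.
  by move=> [|i] //; rewrite -FE x0 eqxx.
move=> k k0; have [kF|kF] := boolP (k \in F).
  by rewrite (_ : k |` F = F) //; apply/fsetUidPr; rewrite fsub1set.
apply: contrapT => nA.
have [d d0 dF] : exists2 d, 0 < d & forall i, i \in F -> d <= g (c x i).
  apply: fset_lower_bound => i iF.
  by rewrite lt_neqAle absp_ge0 andbT eq_sym absp_eq0 // FE.
have [s s0 gs] : exists2 s, 0 <= s & g s = d by apply: absp_surj => //; exact: ltW.
(* A set of the family through [k] misses an index of the support, which contributes at least as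
   much as the new entry [s]; so the norm remains 1. *)
pose y := vec c (k |` F) (fun i => if i == k then s else - c x i).
have yF i : i \in F -> c y i = - c x i.
  move=> iF; rewrite coord_vec in_fset1U iF orbT; case: eqP => // ik.
  by rewrite -ik iF in kF.
have yk : c y k = s by rewrite coord_vec fset1U1 eqxx.
have yN i : i \notin F -> i != k -> c y i = 0.
  by move=> /negPf iF /negPf ik; rewrite coord_vec in_fset1U iF ik.
have yF1 : \sum_(i <- F) g (c y i) = 1.
  by rewrite -F1 big_seq [RHS]big_seq; apply: eq_bigr => i /yF ->.
have : y = - x.
  apply: double; last by move=> i; rewrite FE => /yF.
  split; last first.
    apply: yN; last by rewrite eq_sym -lt0n.
    by rewrite -FE x0 eqxx.
  apply/le_anti/andP; split; last by rewrite -yF1 phi_sum.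
  apply: (phi_bound (c := c)) => G AG.
  have xG H : k \notin H -> \sum_(i <- H) g (c y i) = \sum_(i <- H) g (c x i).
    move=> kH; rewrite big_seq [RHS]big_seq; apply: eq_bigr => i iH.
    have [/yF->//|iF] := boolP (i \in F); rewrite yN //; last first.
      by apply: contraNneq kH => <-.
    by move: iF; rewrite -FE negbK => /eqP->.
  have [kG|kG] := boolP (k \in G); last by rewrite xG // sum_le1.
  have [i iF iG] : exists2 i, i \in F & i \notin G.
    apply: contrapT => H; apply: nA; apply: (hereditaryA sA AG); apply/fsubsetP => i.
    rewrite in_fset1U => /orP[/eqP->//|iF]; apply: contrapT => /negP iG.
    by apply: H; exists i.
  rewrite (big_fsetD1 k) //= yk gs xG ?inE ?eqxx //.
  have : \sum_(j <- G `\ k) g (c x j) <= 1 - g (c x i).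
    apply: (sum_missing _ _ iF); rewrite ?F1 //.
      by move=> j; rewrite -FE negbK => /eqP.
    by rewrite inE negb_and iG orbT.
  by have := dF _ iF; lra.
move/(congr1 (fun z => c z k)); rewrite yk coordN.
move: (kF); rewrite -FE negbK => /eqP->; rewrite oppr0 => sE.
by move: d0; rewrite -gs sE absp0 ?ltxx.
Qed.

(** The only point at distance 2 from [T x] is the image of [- x], and [- T x] is such a point. *)
Lemma antipodal_iso T T' x : sphere_iso c T T' -> antipodal x ->
  antipodal (T x) /\ T (- x) = - T x.
Proof.
move=> [T1 T1' TK TK' Tp] [sx xU].
have uniq y : sphere0 y -> phi (T x - y) = g 2 -> y = T (- x).
  move=> sy Txy; rewrite -(TK' _ sy); congr T; apply: xU; first exact: T1'.
  by rewrite -Tp ?TK' //; exact: T1'.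
have TN : T (- x) = - T x.
  apply/esym/uniq; first exact/sphere0N/T1.
  rewrite opprK -mulr2n -scaler_nat /phi normrZ abspM.
  by have [] := T1 _ sx; rewrite /phi => -> _; rewrite absp_norm mulr1.
split => //; split; first exact: T1.
by move=> y sy /uniq ->.
Qed.

(** This prevents a basis vector from having a [y] as in [antipodal_not_basis]: the support of [x]
    may be joined by [i], and superadditivity of t^p yields 2 when signs do not cancel. *)
Lemma basis_max_ge2 i x : (0 < i)%N -> antipodal x ->
  2 <= phi (x - e i) \/ 2 <= phi (x + e i).
Proof.
move=> i0 xU; have [F [eF FE F0 F1]] := antipodal_support xU.
have main s : `|s| = 1 -> 0 <= - s * c x i -> 2 <= phi (x - s *: e i).
  move=> s1 sx; apply: le_trans (phi_sum c _ (eF _ i0)).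
  rewrite sum_shift_in ?fset1U1 //.
  have -> : (i |` F) `\ i = F `\ i by apply/fsetP => j; rewrite !inE; case: eqP.
  have -> : \sum_(j <- F `\ i) g (c x j) = 1 - g (c x i).
    have [iF|iF] := boolP (i \in F); first by move: F1; rewrite (big_fsetD1 i) //=; lra.
    rewrite (_ : F `\ i = F); last by apply/fsetDidPl; rewrite fdisjointX1.
    by rewrite F1; move: iF; rewrite -FE negbK => /eqP->; rewrite absp0 // subr0.
  have : 1 + g (- s * c x i) <= g (1 + - s * c x i) by exact: absp_superadd.
  rewrite abspM abspN -(absp_norm p s) s1 absp1 mul1r.
  suff -> : g (1 + - s * c x i) = g (c x i - s) by lra.
  have ss : s * s = 1.
    by have /eqP := s1; rewrite eqr_norml => /andP[/orP[]/eqP-> _]; rewrite ?mulrNN mulr1.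
  have -> : 1 + - s * c x i = - s * (c x i - s).
    by rewrite mulrBr !mulNr opprK ss addrC.
  by rewrite abspM abspN -(absp_norm p s) s1 absp1 mul1r.
have [x0|x0] := leP (c x i) 0.
  left; rewrite -[e i]scale1r; apply: main; first by rewrite normr1.
  by rewrite mulN1r oppr_ge0.
right; have -> : x + e i = x - (-1) *: e i by rewrite scaleN1r opprK.
by apply: main; rewrite ?normrN ?normr1 // opprK mul1r ltW.
Qed.

(** [y] is flat on a blocker of the support of [v]: no set of the family contains both supports, so
    each sum lacks an entry of [y] or of [v]. *)
Lemma antipodal_not_basis v k l : antipodal v -> (k < l)%N ->
  c v k != 0 -> c v l != 0 ->
  exists y, [/\ antipodal y, phi (y - v) < 2 & phi (y + v) < 2].
Proof.
move=> vU kl vk vl; have [F [eF FE F0 F1]] := antipodal_support vU.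
have AF : A F by apply: (hereditaryA sA (eF 1%N isT)); exact: fsubsetU1.
rewrite !FE in vk vl.
have [G [FG eG G0 nA]] := exists_blocker sA AF vk vl kl.
have Gn0 : (0 < #|` G|)%N.
  rewrite lt0n cardfs_eq0; apply/negP => /eqP G00; apply: nA.
  by rewrite G00 fsetU0.
have N0 : 0 < (#|` G|)%:R :> R by rewrite ltr0n.
have [t t0 gt] : exists2 t, 0 <= t & g t = (#|` G|)%:R^-1.
  by apply: absp_surj => //; rewrite invr_ge0 ltW.
have tn0 : t != 0.
  by rewrite -(absp_eq0 t p1') gt invr_eq0 gt_eqF.
pose y := vec c G (fun=> t).
have gt1 : \sum_(i <- G) g t = 1.
  by rewrite (@sum_fset_const _ _ _ (g t)) // gt -[_ *+ _]mulr_natr mulVf // gt_eqF.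
have yU : antipodal y by apply: extendable_antipodal.
have yG : \sum_(i <- G) g (c y i) = 1.
  by rewrite -gt1 big_seq [RHS]big_seq; apply: eq_bigr => i iG; rewrite coord_vec iG.
have yN i : i \notin G -> c y i = 0 by move=> /negPf iG; rewrite coord_vec iG.
have vN i : i \notin F -> c v i = 0 by rewrite -FE negbK => /eqP.
have GN i : i \in F -> i \notin G by move/fdisjointP: FG; exact.
have [d d0 dF] : exists2 d, 0 < d & forall i, i \in F -> d <= g (c v i).
  apply: fset_lower_bound => i iF.
  by rewrite lt_neqAle absp_ge0 andbT eq_sym absp_eq0 // FE.
have [[y1 y0] _] := yU; have [[v1 v0] _] := vU.
have main w : (forall i, g (c w i) = g (c y i) + g (c v i)) -> phi w < 2.
  move=> wE; apply: (@le_lt_trans _ _ (2 - Num.min d (g t))); last first.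
    by rewrite gtrBl lt_min d0 gt invr_gt0.
  apply: (phi_bound (c := c)) => H AH.
  rewrite (eq_bigr (fun i => g (c y i) + g (c v i))) // big_split /=.
  have yH := sum_le1 c y1 AH; have vH := sum_le1 c v1 AH.
  have m1 : Num.min d (g t) <= d by rewrite ge_min lexx.
  have m2 : Num.min d (g t) <= g t by rewrite ge_min lexx orbT.
  have [i iFG iH] : exists2 i, i \in F `|` G & i \notin H.
    apply: contrapT => nex; apply: nA; apply: (hereditaryA sA AH); apply/fsubsetP => i iFG.
    by apply: contrapT => /negP iH; apply: nex; exists i.
  move: iFG; rewrite in_fsetU => /orP[iF|iG].
    have F1le : \sum_(j <- F) g (c v j) <= 1 by rewrite F1.
    by have := sum_missing vN F1le iF iH; have := dF _ iF; lra.
  have yGle : \sum_(j <- G) g (c y j) <= 1 by rewrite yG.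
  have := sum_missing yN yGle iG iH; rewrite coord_vec iG; lra.
exists y; split => //; apply: main => i; rewrite ?coordB ?coordD;
(have [iF|iF] := boolP (i \in F);
  [rewrite (yN i (GN _ iF)) absp0 // add0r ?sub0r ?add0r ?abspN
  |by rewrite (vN i iF) absp0 // addr0 ?subr0 ?addr0]) => //.
Qed.

Lemma signed_basis_gt1 T T' i : sphere_iso c T T' -> (0 < i)%N ->
  exists j s, [/\ (0 < j)%N, s = 1 \/ s = -1 :> R,
    T (e i) = s *: e j & T (- e i) = - (s *: e j)].
Proof.
move=> TT' i0; have T'T := sphere_iso_sym TT'.
have eU : antipodal (e i).
  apply: extendable_antipodal; rewrite ?sum_fset1 ?absp1 //.
  - move=> k k0; have [->|ki] := eqVneq k i.
      by rewrite fsetUid; exact: singletonA.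
    exact: schreier_family_pair.
  - by move=> k; rewrite inE => /eqP->.
have [vU TN] := antipodal_iso TT' eU; set v := T (e i) in vU TN *.
have [F [eF FE F0 F1]] := antipodal_support vU.
have no2 k l : c v k != 0 -> c v l != 0 -> k = l.
  wlog kl : k l / (k < l)%N.
    move=> W vk vl; case: (ltngtP k l) => // [kl|lk]; first exact: W.
    by apply/esym/W.
  move=> vk vl; have [y [yU yv yv']] := antipodal_not_basis vU kl vk vl.
  have [yU' _] := antipodal_iso T'T yU.
  have [T1 T1' TK TK' Tp] := TT'; have [sy _] := yU; have se := sphere0_e c p1' sA i0.
  have [] := basis_max_ge2 i0 yU'.
    by rewrite -Tp // ?TK' // -/v ?leNgt ?yv //; exact: T1'.
  rewrite -[e i]opprK -Tp // ?TK' // ?TN ?opprK ?leNgt ?yv' //.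
    exact: T1'.
  exact: sphere0N.
have [j jF] : exists j, j \in F.
  apply/fset0Pn/eqP => F00; move: F1; rewrite F00 big_nil => /esym/eqP.
  by rewrite oner_eq0.
have vj : c v j != 0 by rewrite FE.
have vE : v = c v j *: e j.
  apply: (coord_inj (c := c) p1') => k; rewrite coordZ coord_e.
  case: eqP => [->|kj]; rewrite ?mulr1 // mulr0; apply/eqP; apply: contraT => vk.
  by case: kj; exact: no2.
exists j, (c v j); rewrite -vE TN; split => //; first exact: F0.
have : phi (c v j *: e j) = 1 by rewrite -vE; case: vU => -[].
have := phi_e c p1' sA j; rewrite /phi normrZ abspM absp_norm => ->; rewrite mulr1.
by move=> /(absp_eq1 p1')/eqP; rewrite eqr_norml => /andP[/orP[]/eqP->]; [left|right].
Qed.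

End Antipodes.

(** * Exponent 1 *)

Section MaximalPoints.
Local Open Scope fset_scope.
Local Open Scope ring_scope.
Context {R : realType} {p : R} {A : set {fset nat}} {X : normedModType R}.
Variables (c : coordinate_system p A X) (p1 : p = 1) (sA : schreier_family A).
Implicit Types (F G H : {fset nat}) (x y z u v w : X) (i j k : nat).

Local Notation phi := (@phi R p X).
Local Notation e := (unit_vec c).
Local Notation sphere0 := (sphere0 c).

Let p1' : 1 <= p. Proof. by rewrite p1. Qed.

Let absE (t : R) : absp p t = `|t|. Proof. by rewrite p1 abspC1. Qed.

Lemma phi_sum1 x F : A F -> \sum_(i <- F) `|c x i| <= phi x.
Proof.
move=> AF; apply: le_trans (phi_sum c x AF).
by apply: ler_sum => i _; rewrite absE.
Qed.

Lemma phi_bound1 x B :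
  (forall F, A F -> \sum_(i <- F) `|c x i| <= B) -> phi x <= B.
Proof.
move=> xB; apply: (phi_bound (c := c)) => F /xB; apply: le_trans.
by apply: ler_sum => i _; rewrite absE.
Qed.

Lemma phi_sup x B : B < phi x -> exists2 F, A F & B < \sum_(i <- F) `|c x i|.
Proof.
move=> Bx; apply: contrapT => nF; move: Bx; rewrite ltNge => /negP; apply.
apply: phi_bound1 => F AF; rewrite leNgt; apply/negP => BF.
by apply: nF; exists F.
Qed.

Lemma phi_sub_le2 x y : phi x = 1 -> phi y = 1 -> phi (x - y) <= 2.
Proof. by move=> x1 y1; have := phi_le2 p1' x1 y1; rewrite absE ger0_norm. Qed.

Lemma sum_sub_le x y F : \sum_(i <- F) `|c (x - y) i| <=
  \sum_(i <- F) `|c x i| + \sum_(i <- F) `|c y i|.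
Proof.
by rewrite -big_split /=; apply: ler_sum => i _; rewrite coordB ler_normB.
Qed.

Lemma sum_sub_gain x y F i m : i \in F ->
  `|c x i - c y i| <= `|c x i| + `|c y i| - m ->
  \sum_(i <- F) `|c (x - y) i| <=
  \sum_(i <- F) `|c x i| + \sum_(i <- F) `|c y i| - m.
Proof.
move=> iF xy; rewrite !(big_fsetD1 i iF) /= [c (x - y) i]coordB.
have := sum_sub_le x y (F `\ i).
set a := \sum_(j <- _) `|c (x - y) j|; set b := \sum_(j <- _) _.
set d := \sum_(j <- _) _; lra.
Qed.

Lemma same_sign_gain (s a b m : R) : `|s| = 1 -> m <= s * a -> m <= s * b ->
  `|a - b| <= `|a| + `|b| - m.
Proof.
move=> /eqP; rewrite eqr_norml => /andP[/orP[]/eqP-> _];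
rewrite ?mul1r ?mulN1r; case: (ger0P a); case: (ger0P b); case: (ger0P (a - b)); lra.
Qed.

(** Maximality refers to inclusion of the sets of points at distance 2. The notion is purely metric,
    hence preserved by isometries. *)
Definition maximal_point y := sphere0 y /\ forall z, sphere0 z ->
  (forall u, sphere0 u -> phi (y - u) = 2 -> phi (z - u) = 2) -> z = y.

Lemma maximal_point_iso T T' y : sphere_iso c T T' ->
  maximal_point y -> maximal_point (T y).
Proof.
move=> [T1 T1' TK TK' Tp] [sy yM]; split; first exact: T1.
move=> z sz zD; rewrite -(TK' _ sz); congr T; apply: yM; first exact: T1'.
move=> u su yu; rewrite -Tp ?TK' //; last exact: T1'.
by apply: zD; [exact: T1|rewrite Tp].
Qed.

(** Otherwise coordinate [i] could be changed by [d] without touching any almost norming set: the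
    new vector has norm 1 and keeps every point at distance 2. *)
Lemma maximal_point_star y i d : maximal_point y -> (0 < i)%N -> 0 < d ->
  exists F, [/\ A F, i \in F & 1 - d < \sum_(j <- F) `|c y j|].
Proof.
move=> [[y1 y0] yM] i0 d0; apply: contrapT => nF.
have yF F : A F -> i \in F -> \sum_(j <- F) `|c y j| <= 1 - d.
  by move=> AF iF; rewrite leNgt; apply/negP => dF; apply: nF; exists F.
pose z := y - d *: e i.
have zE j : c z j = c y j - d * (j == i)%:R by rewrite coordB coordZ coord_e.
have zF F (u : X) : i \notin F ->
    \sum_(j <- F) `|c (z - u) j| = \sum_(j <- F) `|c (y - u) j|.
  move=> iF; rewrite big_seq [RHS]big_seq; apply: eq_bigr => j jF.
  rewrite !coordB coordZ coord_e (_ : j == i = false) ?mulr0 ?subr0 //.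
  by apply: contraNF iF => /eqP <-.
have zF0 F : i \notin F -> \sum_(j <- F) `|c z j| = \sum_(j <- F) `|c y j|.
  by move=> iF; have := zF F 0 iF; rewrite !subr0.
have z1 : phi z = 1.
  apply/le_anti/andP; split.
    apply: phi_bound1 => F AF; have [iF|iF] := boolP (i \in F); last first.
      by rewrite zF0 // -y1 phi_sum1.
    apply: le_trans (sum_sub_le _ _ _) _.
    have -> : \sum_(j <- F) `|c (d *: e i) j| = d; last by have := yF _ AF iF; lra.
    rewrite (big_fsetD1 i) //= coordZ coord_e eqxx mulr1 gtr0_norm //.
    rewrite sum_fset_eq0 ?addr0 // => j; rewrite !inE => /andP[/negPf ji _].
    by rewrite coordZ coord_e ji mulr0 normr0.
  rewrite leNgt; apply/negP => z1.
  have : phi y <= Num.max (1 - d) (phi z).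
    apply: phi_bound1 => F AF; rewrite le_max.
    have [iF|iF] := boolP (i \in F); first by rewrite yF.
    by rewrite -zF0 // phi_sum1 ?orbT.
  by rewrite y1 leNgt gt_max z1 gtrBl d0.
have zy : z = y.
  apply: yM.
    by split => //; rewrite zE y0; case: i i0 {nF yF z zE zF zF0 z1} => // i _; rewrite mulr0 subr0.
  move=> u [u1 u0] yu; apply/le_anti; rewrite phi_sub_le2 //= leNgt; apply/negP => zu.
  have : phi (y - u) <= Num.max (2 - d) (phi (z - u)).
    apply: phi_bound1 => F AF; rewrite le_max.
    have [iF|iF] := boolP (i \in F).
      rewrite (le_trans (sum_sub_le _ _ _)) //.
      have := phi_sum1 u AF; rewrite u1; have := yF _ AF iF; lra.
    by rewrite -zF // phi_sum1 ?orbT.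
  by rewrite yu leNgt gt_max zu gtrBl d0.
have := zE i; rewrite zy eqxx mulr1; lra.
Qed.

(** [maximal_point_star] gives almost norming sets through [i]; the sign of [e i] is chosen so that
    nothing cancels there. *)
Lemma maximal_point_basis y i : maximal_point y -> (0 < i)%N ->
  phi (y - e i) = 2 \/ phi (y + e i) = 2.
Proof.
move=> yM i0; have [[y1 y0] _] := yM.
have [e1 _] := sphere0_e c p1' sA i0.
have main s : `|s| = 1 -> s * c y i <= 0 -> 2 <= phi (y - s *: e i).
  move=> s1 sy; rewrite leNgt; apply/negP => lt2.
  have d0 : 0 < 2 - phi (y - s *: e i) by rewrite subr_gt0.
  have [F [AF iF dF]] := maximal_point_star yM i0 d0.
  have := phi_sum1 (y - s *: e i) AF.
  have -> : \sum_(j <- F) `|c (y - s *: e i) j| = 1 + \sum_(j <- F) `|c y j|.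
    transitivity (\sum_(j <- F) absp p (c (y - s *: e i) j)).
      by apply: eq_bigr => j _; rewrite absE.
    rewrite sum_shift_in // (big_fsetD1 i iF) /= absE addrA; congr (_ + _).
      move: s1 sy => /eqP; rewrite eqr_norml => /andP[/orP[]/eqP-> _];
      rewrite ?mul1r ?mulN1r ?opprK; case: (ger0P (c y i)); case: (ger0P (c y i - 1));
      case: (ger0P (c y i + 1)); lra.
    by apply: eq_bigr => j _; rewrite absE.
  lra.
have [y0'|y0'] := leP (c y i) 0.
  left; apply/le_anti; rewrite phi_sub_le2 //= -[e i]scale1r; apply: main.
    by rewrite normr1.
  by rewrite mul1r.
right; apply/le_anti; rewrite -{1}[e i]opprK phi_sub_le2 ?phiN //=.
have -> : y + e i = y - (-1) *: e i by rewrite scaleN1r opprK.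
by apply: main; rewrite ?normrN ?normr1 // mulN1r oppr_le0 ltW.
Qed.

(* A test point [u] which is flat on a norming set [F] of [y] forces the sign
   pattern of [y] on every [z] dominating [y], and norms [z] along supersets
   of [F]. *)
Lemma norming_dominated y z F (s : nat -> R) :
  sphere0 y -> sphere0 z ->
  (forall u, sphere0 u -> phi (y - u) = 2 -> phi (z - u) = 2) ->
  A F -> 0%N \notin F -> \sum_(i <- F) `|c y i| = 1 ->
  (forall i, `|s i| = 1) -> (forall i, i \in F -> s i * c y i = `|c y i|) ->
  (forall i, i \in F -> s i * c z i = `|c z i|) /\
  forall d, 0 < d -> exists H, [/\ A H, F `<=` H & 1 - d < \sum_(i <- H) `|c z i|].
Proof.
move=> [y1 y0] [z1 z0] yz AF F0 yF s1 sy.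
have N0 : (0 < #|` F|)%N.
  rewrite lt0n cardfs_eq0; apply/negP => /eqP F00.
  by move: yF; rewrite F00 big_nil => /esym/eqP; rewrite oner_eq0.
pose t : R := (#|` F|)%:R^-1; have t0 : 0 < t by rewrite invr_gt0 ltr0n.
have tF : \sum_(i <- F) t = 1.
  rewrite (@sum_fset_const _ _ _ t) // -[_ *+ _]mulr_natr mulVf //.
  by rewrite gt_eqF // ltr0n.
(* The signs are opposite to those of [y] because the distance is formed with [y - u]. *)
pose u := vec c F (fun i => - (s i * t)).
have uF i : i \in F -> c u i = - (s i * t) by move=> iF; rewrite coord_vec iF.
have nuF i : i \in F -> `|c u i| = t.
  by move=> iF; rewrite uF // normrN normrM s1 mul1r gtr0_norm.
have uN i : i \notin F -> c u i = 0 by move=> /negPf iF; rewrite coord_vec iF.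
have su : sphere0 u.
  split; last exact: uN.
  rewrite phi_vec // -[RHS]tF big_seq [RHS]big_seq; apply: eq_bigr => i iF.
  by rewrite absE -uF // nuF.
have [u1 u0] := su.
have yu : phi (y - u) = 2.
  apply/le_anti; rewrite phi_sub_le2 //=; apply: le_trans (phi_sum1 _ AF).
  rewrite (_ : 2 = 1 + 1 :> R) // -{1}yF -tF -big_split /= big_seq [leRHS]big_seq.
  apply: ler_sum => i iF; rewrite coordB uF // opprK -sy //.
  have <- : s i * (c y i + s i * t) = s i * c y i + t.
    have ss : s i * s i = 1.
      have /eqP := s1 i; rewrite eqr_norml => /andP[/orP[]/eqP-> _];
      by rewrite ?mulrNN mulr1.
    by rewrite mulrDr mulrA ss mul1r.
  by rewrite (le_trans (ler_norm _)) // normrM s1 mul1r.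
have zu := yz _ su yu.
have uH i H : i \in F -> i \notin H -> \sum_(j <- H) `|c u j| <= 1 - t.
  move=> iF iH; rewrite (sum_fset_supp (G := F)); last first.
    by move=> j _ /uN ->; rewrite normr0.
  apply: (@le_trans _ _ (\sum_(j <- F `\ i) `|c u j|)).
    apply: sum_fset_le; first by move=> ?; exact: normr_ge0.
    apply/fsubsetP => j; rewrite !inE => /andP[jH ->]; rewrite andbT.
    by apply: contraNneq iH => <-.
  have : \sum_(j <- F) `|c u j| = 1.
    by rewrite -tF big_seq [RHS]big_seq; apply: eq_bigr => j /nuF.
  by rewrite (big_fsetD1 i) //= nuF //; lra.
split => [i iF|d d0].
  have [zi|zi] := leP 0 (s i * c z i).
    by rewrite -[LHS]ger0_norm // normrM s1 mul1r.
  exfalso; pose m := Num.min `|c z i| t.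
  have nz : `|c z i| = - (s i * c z i).
    by rewrite -ltr0_norm // normrM s1 mul1r.
  have m0 : 0 < m by rewrite lt_min t0 nz oppr_gt0 zi.
  have : phi (z - u) <= 2 - m.
    apply: phi_bound1 => H AH; have zH := phi_sum1 z AH; have uHs := phi_sum1 u AH.
    have mt : m <= t by rewrite ge_min lexx orbT.
    have [iH|iH] := boolP (i \in H).
      apply: le_trans (sum_sub_gain (m := m) iH _) _; last by move: zH uHs; rewrite z1 u1; lra.
      apply: (@same_sign_gain (- s i)); first by rewrite normrN.
        by rewrite mulNr -nz ge_min lexx.
      rewrite uF // mulrNN mulrA.
      have -> : s i * s i = 1.
        have /eqP := s1 i; rewrite eqr_norml => /andP[/orP[]/eqP-> _];
        by rewrite ?mulrNN mulr1.
      by rewrite mul1r.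
    apply: le_trans (sum_sub_le _ _ _) _.
    by move: zH (uH _ _ iF iH); rewrite z1; lra.
  by rewrite zu leNgt gtrBl m0.
have d'0 : 2 - Num.min d t < phi (z - u) by rewrite zu gtrBl lt_min d0.
have [H AH Hd] := phi_sup d'0; exists H.
have zH := phi_sum1 z AH; have uHs := phi_sum1 u AH; rewrite z1 u1 in zH uHs.
have zuH := sum_sub_le z u H.
have md : Num.min d t <= d by rewrite ge_min lexx.
have mt : Num.min d t <= t by rewrite ge_min lexx orbT.
split => //; last by lra.
apply/fsubsetP => i iF; apply: contraT => iH.
by have := uH _ _ iF iH; lra.
Qed.

End MaximalPoints.

(** * Maximal points with prescribed signs on an initial segment *)

Section Probes.
Local Open Scope fset_scope.
Local Open Scope ring_scope.
Context {R : realType} {p : R} {A : set {fset nat}} {X : normedModType R}.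
Variables (c : coordinate_system p A X) (p1 : p = 1) (sA : schreier_family A).
Implicit Types (F G H : {fset nat}) (x y z u v w : X) (i j k : nat).

Local Notation phi := (@phi R p X).
Local Notation e := (unit_vec c).
Local Notation sphere0 := (sphere0 c).
Local Notation maximal_point := (maximal_point c).

Let p1' : 1 <= p. Proof. by rewrite p1. Qed.

Lemma eq_sums_omit (S : {fset nat}) (f : nat -> R) t :
  (forall k, k \in S -> \sum_(i <- S `\ k) f i = t) ->
  forall i j, i \in S -> j \in S -> f i = f j.
Proof.
move=> St i j iS jS; have := St _ iS; rewrite -(St _ jS).
have := big_fsetD1 (op := +%R) (F := f) i iS.
rewrite (big_fsetD1 j jS) /= => H1 H2; lra.
Qed.

Lemma in_window a r i : (2 <= a)%N ->
  ((2 <= i) && (i < a + r.+1))%N = (i \in seg 2 (a + r).-1).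
Proof. by move=> a2; rewrite in_seg; lia. Qed.

Lemma window_cases a r q i : (q < r)%N -> (2 <= a)%N ->
  i \in seg 2 (a + r).-1 -> (i + q <= a + r.+1)%N \/ i \in seg a r.+1.
Proof.
move=> qr a2; rewrite !in_seg => ai.
by have [|] := leqP (i + q) (a + r.+1); [left|right; lia].
Qed.

Lemma window_sets a r q : (0 < q)%N -> (q < r)%N -> (2 <= a)%N ->
  let W := seg 2 (a + r).-1 in
  [/\ seg a r.+1 `<=` W, seg a.+1 r `<=` W,
      seg (a + r.+1 - q).+1 q.-1 `<=` seg a r.+1,
      forall i, (2 <= i)%N -> (i + q <= a + r.+1)%N ->
        i \in W /\ i \notin seg (a + r.+1 - q).+1 q.-1
    & (a + q <= a + r.+1)%N /\ 1%N \notin W].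
Proof.
move=> q0 qr a2 /=; split.
- by apply/fsubsetP => i; rewrite !in_seg; lia.
- by apply/fsubsetP => i; rewrite !in_seg; lia.
- by apply/fsubsetP => i; rewrite !in_seg; lia.
- by move=> i i2 iq; rewrite !in_seg; lia.
- by rewrite in_seg; lia.
Qed.

(** The values come from [exists_window]: with [s] the inverse of [r], a set of the family with [r]
    points in the window is norming, and [1 - s *+ q] at 1 compensates for 1 admitting only [q] of
    them. Sets that are not norming fall short by at least [s]. *)
Lemma exists_probe N (ep : nat -> R) : (forall i, `|ep i| = 1) ->
  exists y s, [/\ maximal_point y, 0 < s,
    forall i, (0 < i < N)%N -> s <= ep i * c y i
    & forall F, A F ->
      [\/ \sum_(i <- F) `|c y i| <= 1 - s,
          1%N \in F /\ (forall b d, b \in F -> d \in F -> (2 <= b)%N ->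
            (b < d)%N -> (N <= d)%N)
        | forall b, b \in F -> (0 < b)%N -> (N <= b)%N]].
Proof.
move=> ep1; have [a [r [q [[a2 Na q0 qr] [[SA tailA thinA] winA]]]]] := exists_window sA N.
have [SW TW QS QW [aq W1]] := window_sets q0 qr a2.
set W := seg 2 (a + r).-1 in SW TW QW W1 winA.
have epp i : ep i * ep i = 1.
  have /eqP := ep1 i; rewrite eqr_norml => /andP[/orP[]/eqP-> _];
  by rewrite ?mulrNN mulr1.
pose s : R := r%:R^-1.
have r0 : 0 < r%:R :> R by rewrite ltr0n; exact: leq_trans qr.
have s0 : 0 < s by rewrite invr_gt0.
have sr : s *+ r = 1 by rewrite -mulr_natr mulVf // gt_eqF.
have sle m n : (m <= n)%N -> s *+ m <= s *+ n by move=> mn; rewrite ler_wpMn2l ?ltW.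
have slt m n : (m < n)%N -> s *+ m <= s *+ n - s.
  by move=> mn; have := sle _ _ mn; rewrite mulrS; lra.
have sq := slt _ _ qr; rewrite sr in sq.
pose val i : R := if i == 1%N then 1 - s *+ q else s.
have val_ge i : s <= val i by rewrite /val; case: eqP => // _; lra.
pose y := vec c (1%N |` W) (fun i => ep i * val i).
have yE i : i \in 1%N |` W -> `|c y i| = val i.
  move=> iW; rewrite coord_vec iW normrM ep1 mul1r ger0_norm //.
  exact: le_trans (ltW s0) (val_ge i).
have yN i : i \notin 1%N |` W -> c y i = 0 by move=> /negPf iW; rewrite coord_vec iW.
have valW i : i \in W -> val i = s.
  by move=> iW; rewrite /val; case: eqP => // i1; rewrite -i1 iW in W1.
have y1 : `|c y 1%N| = 1 - s *+ q by rewrite yE ?fset1U1 // /val eqxx.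
have yW F : 1%N \notin F -> \sum_(i <- F) `|c y i| = s *+ #|` F `&` W|.
  move=> F1; rewrite (sum_fset_supp (G := W)).
    apply: sum_fset_const => i; rewrite inE => /andP[_ iW].
    by rewrite yE ?valW // in_fset1U iW orbT.
  move=> i iF iW; rewrite yN ?normr0 // in_fset1U negb_or iW andbT.
  by apply: contraNneq F1 => <-.
have y1W F : 1%N \in F -> \sum_(i <- F) `|c y i| = 1 - s *+ q + s *+ #|` F `&` W|.
  move=> F1; rewrite (big_fsetD1 1%N) //= y1 yW; last by rewrite in_fsetD1 eqxx.
  congr (_ + _ *+ #|` _|); apply/fsetP => i; rewrite !in_fsetI in_fsetD1.
  by case: eqP => //= ->; rewrite (negPf W1) andbF.
have y0 : c y 0%N = 0 by apply: yN; rewrite in_fset1U in_seg.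
have yle F : A F -> \sum_(i <- F) `|c y i| <= 1.
  move=> AF; have [Fr Fq _ _] := winA F AF.
  have [F1|F1] := boolP (1%N \in F); last by rewrite yW // -[leRHS]sr sle.
  by rewrite y1W //; have := sle _ _ (Fq F1); lra.
have TA : A (seg a.+1 r).
  by apply: (hereditaryA sA (tailA (a + r).+1 (ltnSn _))); exact: fsubsetU1.
have sy : sphere0 y.
  split => //; apply/le_anti/andP; split; first exact: (phi_bound1 (c := c) p1).
  apply: le_trans (phi_sum1 c p1 y TA); rewrite yW; last first.
    by apply: contra W1 => /(fsubsetP TW).
  by rewrite (fsetIidPl TW) card_seg sr.
exists y, s; split => //; first split => //; last first.
- move=> F AF; have [Fr Fq Fr' Fq'] := winA F AF.
  have [F1|F1] := boolP (1%N \in F).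
    move: (Fq F1); rewrite leq_eqVlt => /predU1P[qE|/slt ql].
      by constructor 2; split => // b d bF dF; exact: Fq'.
    by constructor 1; rewrite y1W //; lra.
  move: Fr; rewrite leq_eqVlt => /predU1P[rE|/slt rl].
    constructor 3 => b bF b0; apply: Fr' => //.
    by rewrite ltn_neqAle b0 andbT; apply: contraNneq F1 => ->.
  by constructor 1; rewrite yW // -sr.
- move=> i /andP[i0 iN]; rewrite coord_vec in_fset1U.
  have -> : (i == 1%N) || (i \in W).
    have [//|i1] := eqVneq i 1%N; rewrite /W -(in_window r i a2).
    rewrite ltn_neqAle eq_sym i1 i0 /=.
    by rewrite (leq_trans iN) // (leq_trans Na) // leq_addr.
  by rewrite mulrA epp mul1r.
(* What remains is maximality: the norming sets supplied by the window determine all signs and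
   moduli of [z]. *)
move=> z sz yz; have [z1 z0] := sz.
have sg F (t : nat -> R) : A F -> 0%N \notin F -> \sum_(i <- F) `|c y i| = 1 ->
    (forall i, `|t i| = 1) -> (forall i, i \in F -> t i * c y i = `|c y i|) ->
    (forall i, i \in F -> t i * c z i = `|c z i|) /\
    forall d, 0 < d -> exists H, [/\ A H, F `<=` H & 1 - d < \sum_(i <- H) `|c z i|].
  exact: norming_dominated.
have epy i : ep i * c y i = `|c y i|.
  have [iW|/yN->] := boolP (i \in 1%N |` W); last by rewrite mulr0 normr0.
  by rewrite yE // coord_vec iW mulrA epp mul1r.
have zN i : i \notin 1%N |` W -> c z i = 0.
  case: i => // i; rewrite in_fset1U negb_or => /andP[i1 iW].
  have ai : (a + r < i.+1)%N.
    rewrite ltnNge; apply: contra iW => ai; rewrite /W -(in_window r _ a2).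
    by rewrite addnS; apply/andP; split; [rewrite ltn_neqAle eq_sym i1|exact: ai].
  have AF := tailA _ ai; set F := i.+1 |` _ in AF.
  have F0 : 0%N \notin F by rewrite in_fset1U in_seg.
  have F1 : 1%N \notin F.
    rewrite in_fset1U eq_sym (negPf i1) /=.
    by apply: contra W1 => /(fsubsetP TW).
  have yi : c y i.+1 = 0 by apply: yN; rewrite in_fset1U negb_or i1.
  have yF : \sum_(j <- F) `|c y j| = 1.
    rewrite yW // -[RHS]sr; congr (_ *+ _); rewrite -[RHS](card_seg a.+1).
    congr #|` _|; apply/fsetP => j; rewrite in_fsetI in_fset1U.
    have [->|] := eqVneq j i.+1.
      rewrite (negPf iW) /=; apply/esym/negP => /(fsubsetP TW).
      by rewrite (negPf iW).
    by move=> _ /=; apply/andP/idP => [[]//|jT]; split => //; exact: (fsubsetP TW).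
  (* As [y] vanishes at [i.+1], either sign may be prescribed there, which forces [z] to vanish as
     well. *)
  have sgi t0 : `|t0| = 1 -> t0 * c z i.+1 = `|c z i.+1|.
    move=> t1; pose t j := if j == i.+1 then t0 else ep j.
    have t1' j : `|t j| = 1 by rewrite /t; case: eqP.
    have ty j : j \in F -> t j * c y j = `|c y j|.
      by rewrite /t; case: eqP => [-> _|_ _]; rewrite ?epy // yi mulr0 normr0.
    have [tz _] := sg F t AF F0 yF t1' ty.
    by have := tz i.+1 (fset1U1 _ _); rewrite /t eqxx.
  have := sgi 1 (normr1 _); have := sgi (-1) (normrN1 _); rewrite mul1r mulN1r; lra.
(* If no larger set of the family gains points of the support, almost norming supersets add nothing
   and [F] itself norms [z]. *)
have zsum F : A F -> F `<=` 1%N |` W -> \sum_(i <- F) `|c y i| = 1 ->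
    (forall H, A H -> F `<=` H -> H `&` (1%N |` W) `<=` F) ->
    (forall i, i \in F -> ep i * c z i = `|c z i|) /\ \sum_(i <- F) `|c z i| = 1.
  move=> AF FW yF HF.
  have F0 : 0%N \notin F.
    by apply/negP => /(fsubsetP FW); rewrite in_fset1U in_seg.
  have [zF zH] := sg F ep AF F0 yF ep1 (fun i _ => epy i).
  split => //; apply/le_anti; rewrite -{1}z1 phi_sum1 //= leNgt; apply/negP => lt1.
  have [|H [AH FH]] := zH (1 - \sum_(i <- F) `|c z i|); first by rewrite subr_gt0.
  rewrite opprB addrC subrK (sum_fset_supp (F := H) (G := 1%N |` W)); last first.
    by move=> i _ /zN ->; rewrite normr0.
  by rewrite ltNge sum_fset_le ?HF.
have zS k : k \in seg a r.+1 ->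
    (forall i, i \in seg a r.+1 `\ k -> ep i * c z i = `|c z i|) /\
    \sum_(i <- seg a r.+1 `\ k) `|c z i| = 1.
  move=> kS; have FW : seg a r.+1 `\ k `<=` W.
    by apply: fsubset_trans SW; exact: fsubsetDl.
  have F1 : 1%N \notin seg a r.+1 `\ k by apply: contra W1 => /(fsubsetP FW).
  have card : #|` seg a r.+1 `\ k| = r.
    by have := cardfsD1 k (seg a r.+1); rewrite kS card_seg add1n => -[].
  apply: zsum.
  - exact: SA.
  - by apply: fsubset_trans FW _; exact: fsubsetU1.
  - by rewrite yW // (fsetIidPl FW) card sr.
  - move=> H AH FH; have [Hr Hq _ _] := winA H AH.
    have HWE : seg a r.+1 `\ k = H `&` W.
      by apply/eqP; rewrite eqEfcard fsubsetI FH FW card.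
    have H1 : 1%N \notin H.
      by apply/negP => /Hq; rewrite -HWE card leqNgt qr.
    apply/fsubsetP => i; rewrite HWE in_fsetI in_fset1U => /andP[iH /orP[/eqP i1|iW]].
      by rewrite i1 (negPf H1) in iH.
    by rewrite in_fsetI iH.
have aS : a \in seg a r.+1 by rewrite in_seg leqnn addnS ltnS leq_addr.
have aS' : a.+1 \in seg a r.+1.
  by rewrite in_seg leqnSn addnS ltnS -addn1 leq_add2l; exact: leq_trans qr.
(* Any [r] of these [r.+1] points norm [z], so comparing the omitted points makes all moduli
   equal. *)
have zSc : forall i, i \in seg a r.+1 -> `|c z i| = s.
  have eqS := @eq_sums_omit _ (fun i => `|c z i|) 1 (fun k kS => (zS k kS).2).
  move=> i iS; have [_] := zS _ aS.
  rewrite (@sum_fset_const _ _ _ `|c z i|); last first.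
    by move=> j; rewrite in_fsetD1 => /andP[_ jS]; exact: eqS.
  have -> : #|` seg a r.+1 `\ a| = r.
    by have := cardfsD1 a (seg a r.+1); rewrite aS card_seg add1n => -[].
  by rewrite -mulr_natr => /(canRL (mulfK (lt0r_neq0 r0)))->; rewrite mul1r.
have zSs i : i \in seg a r.+1 -> ep i * c z i = `|c z i|.
  move=> iS; have [->|ia] := eqVneq i a.
    have [+ _] := zS _ aS'; apply; rewrite in_fsetD1 aS andbT.
    by rewrite neq_ltn ltnSn.
  by have [+ _] := zS _ aS; apply; rewrite in_fsetD1 ia.
(* Apart from 1 and [i], these sets contain only indices where [z] is already known. The case
   [i = a] determines [z] at 1, and then the other indices follow. *)
have zQ i : (2 <= i)%N -> (i + q <= a + r.+1)%N ->
    [/\ ep 1%N * c z 1%N = `|c z 1%N|, ep i * c z i = `|c z i|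
      & `|c z 1%N| + `|c z i| = 1 - s *+ q + s].
  move=> i2 iq; have AF := thinA i i2 iq; set Q := seg _ q.-1 in AF QS QW.
  have [iW iQ] := QW i i2 iq.
  have QW' : Q `<=` W by apply: fsubset_trans SW.
  have Q1 : 1%N \notin Q by apply: contra W1 => /(fsubsetP QW').
  have i1 : 1%N != i by rewrite neq_ltn i2.
  have FW : i |` Q `<=` W by rewrite fsubUset fsub1set iW.
  have F1 : 1%N \notin i |` Q by apply: contra W1 => /(fsubsetP FW).
  have card : #|` i |` Q| = q by rewrite cardfsU1 iQ card_seg add1n prednK.
  have FWE : (1%N |` (i |` Q)) `&` W = i |` Q.
    rewrite fsetIUl (fsetIidPl FW) (_ : _ `&` _ = fset0) ?fset0U //.
    by apply/eqP; rewrite fsetI_eq0 fdisjoint1X.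
  have [|||zF] := zsum _ AF.
  - by apply: fsetUS.
  - by rewrite y1W ?fset1U1 // FWE card; lra.
  - move=> H AH FH; have [Hr Hq _ _] := winA H AH.
    have H1 : 1%N \in H by apply: (fsubsetP FH); exact: fset1U1.
    have HWE : i |` Q = H `&` W.
      apply/eqP; rewrite eqEfcard fsubsetI FW card Hq // !andbT.
      by apply: fsubset_trans FH; exact: fsubsetU1.
    apply/fsubsetP => j; rewrite HWE in_fsetI !in_fset1U => /andP[jH /orP[->//|jW]].
    by rewrite in_fsetI jH jW orbT.
  have zQs : \sum_(j <- Q) `|c z j| = s *+ q - s.
    rewrite (@sum_fset_const _ _ _ s); last by move=> j /(fsubsetP QS) /zSc.
    by rewrite card_seg -[in RHS](prednK q0) mulrSr addrK.
  rewrite !sum_fsetU1 // zQs => Hs; split; last by lra.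
    by apply: zF; exact: fset1U1.
  by apply: zF; rewrite !in_fset1U eqxx orbT.
have [z1s _ z1E] := zQ a a2 aq.
have z1v : `|c z 1%N| = 1 - s *+ q by apply: (addIr s); rewrite -z1E (zSc a aS).
apply: (coord_inj (c := c) p1') => i.
have [iW|iW] := boolP (i \in 1%N |` W); last by rewrite zN // yN.
suff [zs zv] : ep i * c z i = `|c z i| /\ `|c z i| = val i.
  rewrite -[c z i]mul1r -(epp i) -mulrA zs zv -[RHS]mul1r -(epp i) -mulrA epy.
  by rewrite yE.
move: iW; rewrite in_fset1U => /orP[/eqP->|iW]; first by rewrite /val eqxx.
rewrite valW //; have [iq|iS] := window_cases qr a2 iW; last by rewrite zSs // zSc.
move: iW; rewrite /W -(in_window r _ a2) => /andP[i2 _].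
have [_ zi zE] := zQ i i2 iq; split => //.
by apply: (addrI (1 - s *+ q)); rewrite -zE z1v.
Qed.

End Probes.

(** * Images of basis vectors for exponent 1 *)

Section SignedBasisOne.
Local Open Scope fset_scope.
Local Open Scope ring_scope.
Context {R : realType} {p : R} {A : set {fset nat}} {X : normedModType R}.
Variables (c : coordinate_system p A X) (p1 : p = 1) (sA : schreier_family A).
Implicit Types (F G H : {fset nat}) (x y z u v w : X) (i j k : nat).

Local Notation phi := (@phi R p X).
Local Notation e := (unit_vec c).
Local Notation sphere0 := (sphere0 c).
Local Notation maximal_point := (maximal_point c).

Let p1' : 1 <= p. Proof. by rewrite p1. Qed.

Let absE (t : R) : absp p t = `|t|. Proof. by rewrite p1 abspC1. Qed.

(* Under this condition a probe of sign pattern [ep] is at distance less than 2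
   from [u]: an almost norming set of the probe contains no point of an initial
   segment, or only 1 and at most one more point. *)
Definition safe (ep : nat -> R) u := 0 < ep 1%N * c u 1%N \/
  exists k : R, [/\ 0 < k, `|c u 1%N| <= 1 - k & forall b, (2 <= b)%N ->
    k <= ep b * c u b \/ `|c u 1%N| + `|c u b| <= 1 - k].

Definition probe N (ep : nat -> R) y (s : R) :=
  [/\ maximal_point y, 0 < s,
    forall i, (0 < i < N)%N -> s <= ep i * c y i
    & forall F, A F ->
      [\/ \sum_(i <- F) `|c y i| <= 1 - s,
          1%N \in F /\ (forall b d, b \in F -> d \in F -> (2 <= b)%N ->
            (b < d)%N -> (N <= d)%N)
        | forall b, b \in F -> (0 < b)%N -> (N <= b)%N]].

Lemma coord_tail1 u d : 0 < d -> exists M, forall F, A F ->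
  (forall k, k \in F -> (M <= k)%N) -> \sum_(i <- F) `|c u i| <= d.
Proof.
move=> d0; have [M MP] := coord_tail c u d0; exists M => F AF /(MP _ AF).
by under eq_bigr do rewrite absE.
Qed.

Lemma phi_sub_lt2 x y m : 0 < m ->
  (forall F, A F -> \sum_(i <- F) `|c (x - y) i| <= 2 - m) -> phi (x - y) < 2.
Proof.
move=> m0 xy; apply: (@le_lt_trans _ _ (2 - m)); first exact: (phi_bound1 (c := c) p1).
by rewrite gtrBl.
Qed.

Lemma safe_probe ep u : (forall i, `|ep i| = 1) -> sphere0 u -> safe ep u ->
  exists M, forall N y s, (M <= N)%N -> probe N ep y s -> phi (y - u) < 2.
Proof.
move=> ep1 [u1 u0] su.
have [k [k0 k1 kP]] : exists k : R, [/\ 0 < k, k <= 1 & k <= ep 1%N * c u 1%N \/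
    (`|c u 1%N| <= 1 - k /\ forall b, (2 <= b)%N ->
    k <= ep b * c u b \/ `|c u 1%N| + `|c u b| <= 1 - k)].
  case: su => [su|[k [k0 ku kP]]]; last first.
    exists k; split => //; last by right.
    by have := normr_ge0 (c u 1%N); lra.
  exists (Num.min 1 (ep 1%N * c u 1%N)); rewrite lt_min ltr01 su ge_min lexx.
  by split => //; left; rewrite ge_min lexx orbT.
have k20 : 0 < k / 2 by rewrite divr_gt0.
(* The tail of [u] may use half of the margin [k]; the bound 2 ensures that the sign of the probe at
   1 is prescribed. *)
have [M MP] := coord_tail1 u k20; exists (maxn M 2) => N y s.
rewrite geq_max => /andP[MN N2] [[[y1 y0] _] s0 ys yF].
have m0 : 0 < Num.min s (k / 2) by rewrite lt_min s0.
have ms : Num.min s (k / 2) <= s by rewrite ge_min lexx.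
have mk : Num.min s (k / 2) <= k / 2 by rewrite ge_min lexx orbT.
set m := Num.min s (k / 2) in m0 ms mk.
apply: (phi_sub_lt2 m0) => F AF.
have yF1 := phi_sum1 c p1 y AF; have uF1 := phi_sum1 c p1 u AF; rewrite y1 u1 in yF1 uF1.
have split_le := sum_sub_le c y u F.
have gain i : i \in F -> (0 < i < N)%N -> k <= ep i * c u i ->
    \sum_(j <- F) `|c (y - u) j| <= 2 - m.
  move=> iF iN ki; apply: le_trans (sum_sub_gain (m := m) iF _) _; last by lra.
  by apply: (same_sign_gain (ep1 i)); [have := ys _ iN; lra|lra].
have [F0|F0] := boolP (0%N \in F).
  rewrite (schreier_family_zero sA AF F0) sum_fset1 coordB y0 u0 subrr normr0; lra.
have tail G : G `<=` F -> (forall b, b \in G -> (N <= b)%N) ->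
    \sum_(i <- G) `|c u i| <= k / 2.
  move=> GF GN; apply: MP; first exact: (hereditaryA sA AF).
  by move=> b /GN; exact: leq_trans.
(* Either [F] is not almost norming for [y], or it contains 1 and at most one more index below [N],
   or it lies in the tail of [u]. *)
case: (yF F AF) => [yFs|[F1 Fbd]|FN].
- by lra.
- case: kP => [kP|[ku kP]]; first by apply: (gain 1%N) => //; rewrite N2.
  have F'N : forall b, b \in F `\ 1%N -> (2 <= b)%N.
    move=> b; rewrite in_fsetD1 => /andP[b1 bF].
    have b0 : b != 0%N by apply: contraNneq F0 => <-.
    by case: b b1 b0 bF => [|[|b]].
  have [[b [bF b2 bN]]|nob] := pselect (exists b, [/\ b \in F, (2 <= b)%N & (b < N)%N]).
    have [kb|kb] := kP b b2.
      by apply: (gain b) => //; rewrite bN andbT; exact: leq_trans b2.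
    have bF' : b \in F `\ 1%N by rewrite in_fsetD1 bF andbT neq_ltn b2 orbT.
    have : \sum_(i <- (F `\ 1%N) `\ b) `|c u i| <= k / 2.
      apply: tail; first by apply: fsubset_trans (fsubsetDl _ _) _; exact: fsubsetDl.
      move=> d; rewrite in_fsetD1 => /andP[db dF'].
      have dF : d \in F by move: dF'; rewrite in_fsetD1 => /andP[].
      have [bd|bd] := ltnP b d; first exact: (Fbd b d).
      have := Fbd d b dF bF (F'N _ dF'); rewrite ltn_neqAle db bd => /(_ isT).
      by rewrite leqNgt bN.
    move: split_le yF1; rewrite [\sum_(i <- F) `|c u i|](big_fsetD1 1%N) //=.
    rewrite [\sum_(i <- F `\ 1%N) _](big_fsetD1 b) //=; lra.
  have : \sum_(i <- F `\ 1%N) `|c u i| <= k / 2.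
    apply: tail; first exact: fsubsetDl.
    move=> b bF'; rewrite leqNgt; apply/negP => bN; apply: nob; exists b; split => //.
      by move: bF'; rewrite in_fsetD1 => /andP[].
    exact: F'N.
  move: split_le yF1; rewrite [\sum_(i <- F) `|c u i|](big_fsetD1 1%N) //=; lra.
- have : \sum_(i <- F) `|c u i| <= k / 2.
    apply: tail => // b bF; apply: FN => //; rewrite lt0n.
    by apply: contraNneq F0 => <-.
  lra.
Qed.

Lemma safe_pair ep v w : (forall i, `|ep i| = 1) -> sphere0 v -> sphere0 w ->
  safe ep v -> safe ep w ->
  exists y, [/\ maximal_point y, phi (y - v) < 2 & phi (y - w) < 2].
Proof.
move=> ep1 sv sw /(safe_probe ep1 sv)[M MP] /(safe_probe ep1 sw)[M' MP'].
have [y [s yP]] := exists_probe c p1 sA (maxn M M') ep1.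
exists y; split; first by case: yP.
  by apply: (MP (maxn M M') y s) => //; exact: leq_maxl.
by apply: (MP' (maxn M M') y s) => //; exact: leq_maxr.
Qed.

Definition unit_sign (t : R) : R := if t < 0 then -1 else 1.

Lemma norm_unit_sign t : `|unit_sign t| = 1.
Proof. by rewrite /unit_sign; case: ifP; rewrite ?normrN normr1. Qed.

Lemma unit_signM t : unit_sign t * t = `|t|.
Proof. by rewrite /unit_sign; case: (ger0P t); rewrite ?mulN1r ?mul1r. Qed.

Lemma coord_unit u j : sphere0 u -> (0 < j)%N -> `|c u j| = 1 -> u = c u j *: e j.
Proof.
move=> [u1 u0] j0 uj; apply: (coord_inj (c := c) p1') => i; rewrite coordZ coord_e.
have [->|ij] := eqVneq i j; first by rewrite mulr1.
rewrite mulr0; case: i ij => // i ij; apply/eqP; rewrite -normr_eq0 eq_le normr_ge0 andbT.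
have := phi_pair c sA u (isT : 0 < i.+1)%N j0 ij; rewrite !absE u1 uj; lra.
Qed.

Lemma safe_unit ep u j : (forall i, `|ep i| = 1) -> sphere0 u -> (0 < j)%N ->
  `|c u j| = 1 -> ep j = c u j -> safe ep u.
Proof.
move=> ep1 su j0 uj epj.
have epu : ep j * c u j = 1.
  by rewrite epj; move/eqP: uj; rewrite eqr_norml => /andP[/orP[]/eqP-> _];
     rewrite ?mulrNN mulr1.
have uE i : i != j -> c u i = 0.
  by move=> ij; rewrite (coord_unit su j0 uj) coordZ coord_e (negPf ij) mulr0.
have [j1|j1] := eqVneq j 1%N; first by left; rewrite -j1 epu.
have u10 : c u 1%N = 0 by rewrite uE // eq_sym.
right; exists 1; split => //; first by rewrite u10 normr0 subrr.
move=> b b2; have [->|bj] := eqVneq b j; first by left; rewrite epu.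
by right; rewrite u10 uE // normr0 subrr addr0.
Qed.

Lemma safe_unit_sign ep u : `|c u 1%N| < 1 ->
  (forall b, (2 <= b)%N -> ep b = unit_sign (c u b)) -> safe ep u.
Proof.
(* Half of the gap at 1: a larger modulus at [b] is a usable agreement of signs, a smaller one
   leaves the other half free. *)
move=> u1 epb; right; exists ((1 - `|c u 1%N|) / 2); split; try lra.
move=> b b2; rewrite epb // unit_signM.
by case: (lerP ((1 - `|c u 1%N|) / 2) `|c u b|) => H; [left|right; lra].
Qed.

(** Coordinates tend to 0, so only finitely many exceed one half and the moduli stay uniformly below
    1. *)
Lemma coord_lt1_bound u : sphere0 u -> (forall j, (0 < j)%N -> `|c u j| <> 1) ->
  exists2 k, 0 < k & forall j, `|c u j| <= 1 - k.
Proof.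
move=> [u1 u0] un; have h0 : 0 < 2^-1 :> R by rewrite invr_gt0.
have [N NP] := coord_small c p1' sA u h0.
have [|d d0 dP] := @fset_lower_bound _ (fun j => 1 - `|c u j|) (seg 0 N).
  move=> j _; rewrite subr_gt0 lt_neqAle (norm_coord c p1' sA j u1) andbT.
  by case: j => [|j]; [rewrite u0 normr0 eq_sym oner_neq0|apply/eqP/un].
exists (Num.min d 2^-1); first by rewrite lt_min d0.
move=> j; have md : Num.min d 2^-1 <= d by rewrite ge_min lexx.
have mh : Num.min d 2^-1 <= 2^-1 :> R by rewrite ge_min lexx orbT.
have [/NP uj|jN] := leqP N j; first by lra.
by have := dP j; rewrite in_seg add0n jN => /(_ isT); lra.
Qed.

Lemma safe_small ep u : sphere0 u -> (forall j, (0 < j)%N -> `|c u j| <> 1) ->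
  c u 1%N = 0 -> safe ep u.
Proof.
move=> su un u10; have [k k0 kP] := coord_lt1_bound su un.
right; exists k; split => //.
by move=> b _; right; rewrite u10 normr0 add0r.
Qed.

(** The signs do not conflict, since index 1 serves [v] and the others serve [w]; the roles are
    swapped when [w] has modulus 1 at index 1. *)
Lemma exists_safe v w : sphere0 v -> sphere0 w ->
  (forall j, (0 < j)%N -> `|c v j| <> 1) ->
  exists ep, [/\ forall i, `|ep i| = 1, safe ep v & safe ep w].
Proof.
move=> sv sw vn; have [w1 _] := sw; have [v1 _] := sv.
have vlt : `|c v 1%N| < 1.
  by rewrite lt_neqAle (norm_coord c p1' sA 1 v1) andbT; apply/eqP/vn.
have [wlt|wge] := ltP `|c w 1%N| 1.
  pose ep b := if b == 1%N then unit_sign (c v 1%N) else unit_sign (c w b).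
  exists ep; split.
  - by move=> i; rewrite /ep; case: ifP => _; exact: norm_unit_sign.
  - have [v10|v10] := eqVneq (c v 1%N) 0; first exact: safe_small.
    by left; rewrite /ep eqxx unit_signM normr_gt0.
  - by apply: safe_unit_sign => // b b2; rewrite /ep gtn_eqF.
have w11 : `|c w 1%N| = 1 by apply/le_anti; rewrite (norm_coord c p1' sA 1 w1) wge.
pose ep b := if b == 1%N then c w 1%N else unit_sign (c v b).
have ep1 i : `|ep i| = 1 by rewrite /ep; case: ifP => _ //; exact: norm_unit_sign.
exists ep; split => //.
- by apply: safe_unit_sign => // b b2; rewrite /ep gtn_eqF.
- by apply: (safe_unit (j := 1%N)).
Qed.

(** [exists_safe] leaves only signed basis vectors, and one sign pattern suits both unless they have
    the same index and opposite signs. *)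
Lemma opposite_basis v w : sphere0 v -> sphere0 w ->
  (forall y, maximal_point y -> phi (y - v) = 2 \/ phi (y - w) = 2) ->
  exists j s, [/\ (0 < j)%N, s = 1 \/ s = -1 :> R, v = s *: e j & w = - (s *: e j)].
Proof.
move=> sv sw vw.
have nosafe ep : (forall i, `|ep i| = 1) -> safe ep v -> safe ep w -> False.
  move=> ep1 ev ew; have [y [yM yv yw]] := safe_pair ep1 sv sw ev ew.
  by case: (vw y yM) => H; [move: yv|move: yw]; rewrite H ltxx.
have [vn|/existsNP[j /not_implyP[j0 /contrapT vj]]] :=
    pselect (forall j, (0 < j)%N -> `|c v j| <> 1).
  by have [ep [ep1 ev ew]] := exists_safe sv sw vn; case: (nosafe ep).
have [wn|/existsNP[k /not_implyP[k0 /contrapT wk]]] :=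
    pselect (forall j, (0 < j)%N -> `|c w j| <> 1).
  by have [ep [ep1 ew ev]] := exists_safe sw sv wn; case: (nosafe ep).
have [/andP[/eqP jk /eqP vwN]|nopp] := boolP ((j == k) && (c w k == - c v j)).
  exists j, (c v j); split => //.
  - by move/eqP: vj; rewrite eqr_norml => /andP[/orP[]/eqP-> _]; [left|right].
  - exact: coord_unit.
  - by rewrite (coord_unit sw k0 wk) vwN jk scaleNr.
exfalso; pose ep i := if i == j then c v j else if i == k then c w k else 1.
have ep1 i : `|ep i| = 1.
  by rewrite /ep; case: ifP => // _; case: ifP => // _; rewrite normr1.
apply: (nosafe ep) => //.
  by apply: (safe_unit (j := j)) => //; rewrite /ep eqxx.
apply: (safe_unit (j := k)) => //; rewrite /ep eqxx; case: eqP => // kj.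
subst k; move: nopp; rewrite eqxx /=.
move/eqP: vj; rewrite eqr_norml => /andP[/orP[]/eqP-> _];
move/eqP: wk; rewrite eqr_norml => /andP[/orP[]/eqP-> _];
by rewrite ?opprK ?eqxx.
Qed.

Lemma signed_basis_eq1 T T' i : sphere_iso c T T' -> (0 < i)%N ->
  exists j s, [/\ (0 < j)%N, s = 1 \/ s = -1 :> R,
    T (e i) = s *: e j & T (- e i) = - (s *: e j)].
Proof.
move=> TT' i0; have se := sphere0_e c p1' sA i0; have sNe := sphere0N se.
have [T1 T1' TK TK' Tp] := TT'.
apply: opposite_basis; [exact: T1|exact: T1|move=> y yM].
have sy : sphere0 y by case: yM.
have yM' := maximal_point_iso (sphere_iso_sym TT') yM.
have [H|H] := maximal_point_basis p1 sA yM' i0; [left|right].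
  by rewrite -[y]TK' // Tp //; exact: T1'.
by rewrite -[y]TK' // Tp ?opprK //; exact: T1'.
Qed.

End SignedBasisOne.

(** * Isometries of the sphere *)

Section SphereIsometry.
Local Open Scope fset_scope.
Local Open Scope ring_scope.
Context {R : realType} {p : R} {A : set {fset nat}} {X : normedModType R}.
Variables (c : coordinate_system p A X) (p1 : 1 <= p) (sA : schreier_family A).
Implicit Types (x y z : X) (i j k : nat).

Local Notation g := (absp p).
Local Notation phi := (@phi R p X).
Local Notation e := (unit_vec c).
Local Notation sphere0 := (sphere0 c).

Lemma phi_sub_axis_le1 x s : phi x = 1 -> `|c x 0%N - s| <= 1 -> phi (x - s *: e 0%N) <= 1.
Proof.
move=> x1 xs; apply: (phi_le0 (c := c) sA).
  by rewrite coordB coordZ coord_e eqxx mulr1 absp_le1.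
by move=> F AF F0; rewrite sum_shift_notin // sum_le1.
Qed.

Lemma axis_cover x : phi x = 1 -> phi (x - e 0%N) <= 1 \/ phi (x + e 0%N) <= 1.
Proof.
move=> x1; have := norm_coord c p1 sA 0 x1; rewrite ler_norml => /andP[x0 x0'].
have [xp|xn] := leP 0 (c x 0%N).
  left; rewrite -[e 0%N]scale1r phi_sub_axis_le1 // ler_norml; lra.
right; have -> : x + e 0%N = x - (-1) *: e 0%N by rewrite scaleN1r opprK.
by rewrite phi_sub_axis_le1 // ler_norml; apply/andP; split; lra.
Qed.

(** Vanishing at index 0 is expressed by distances to two points that [T] permutes. *)
Lemma sphere0P x : phi x = 1 ->
  sphere0 x <-> phi (x - e 0%N) <= 1 /\ phi (x + e 0%N) <= 1.
Proof.
move=> x1; have xE : x + e 0%N = x - (-1) *: e 0%N by rewrite scaleN1r opprK.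
split=> [[_ x0]|[xm xp]].
  split; first by rewrite -[e 0%N]scale1r phi_sub_axis_le1 // x0 sub0r normrN normr1.
  by rewrite xE phi_sub_axis_le1 // x0 sub0r opprK normr1.
split => //; have := le_trans (phi_coord c sA _ 0) xm.
have := le_trans (phi_coord c sA _ 0) xp; rewrite !absp_le1 // coordB coordD coord_e.
rewrite eqxx /= !ler_norml => /andP[_ H1] /andP[H2 _]; apply/le_anti/andP; split; lra.
Qed.

Lemma sphere_isometry_signs (T : X -> X) :
  (forall x, `|x| = 1 -> `|T x| = 1) ->
  (forall y, `|y| = 1 -> exists2 x, `|x| = 1 & T x = y) ->
  (forall x y, `|x| = 1 -> `|y| = 1 -> `|T x - T y| = `|x - y|) ->
  forall i, exists2 s : R, s = 1 \/ s = -1 & T (e i) = s *: e i.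
Proof.
move=> T1 Tsurj Tnorm.
have [T' T'P] : exists T' : X -> X, forall y, `|y| = 1 -> `|T' y| = 1 /\ T (T' y) = y.
  have /choice[T' T'P] : forall y, exists x, `|y| = 1 -> `|x| = 1 /\ T x = y.
    move=> y; have [y1|ny] := pselect (`|y| = 1); last by exists 0.
    by have [x x1 <-] := Tsurj y y1; exists x.
  by exists T'.
have TK x : `|x| = 1 -> T' (T x) = x.
  move=> x1; have [T'1 TT'] := T'P _ (T1 _ x1).
  by apply/eqP; rewrite -subr_eq0 -normr_eq0 -Tnorm // TT' subrr normr0.
have Tp x y : phi x = 1 -> phi y = 1 -> phi (T x - T y) = phi (x - y).
  by move=> /(phi1 p1) x1 /(phi1 p1) y1; apply/(phi_norm p1)/Tnorm.
have T1p x : phi x = 1 -> phi (T x) = 1 by move=> /(phi1 p1)/T1/(phi1 p1).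
have e0 := phi_e c p1 sA 0; have eN0 : phi (- e 0%N) = 1 by rewrite phiN.
have ee : phi (e 0%N - - e 0%N) = g 2.
  rewrite opprK -mulr2n -scaler_nat /phi normrZ abspM absp_norm.
  by move: e0; rewrite /phi => ->; rewrite mulr1.
(* Since [T] is onto, the unit balls around the images still cover the sphere, so [axis_pair]
   applies. *)
have axis : (T (e 0%N) = e 0%N /\ T (- e 0%N) = - e 0%N) \/
    (T (e 0%N) = - e 0%N /\ T (- e 0%N) = e 0%N).
  apply: (axis_pair c p1 sA); rewrite ?T1p ?Tp // => z /(phi1 p1) z1.
  have [/(phi1 p1) T'1 <-] := T'P _ z1; rewrite !Tp // opprK; exact: axis_cover.
have T0 x : phi x = 1 -> sphere0 (T x) <-> sphere0 x.
  move=> x1; have xp : phi (x + e 0%N) = phi (T x - T (- e 0%N)) by rewrite Tp ?opprK.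
  have xm : phi (x - e 0%N) = phi (T x - T (e 0%N)) by rewrite Tp.
  rewrite !sphere0P ?T1p // xp xm.
  case: axis => -[-> ->]; rewrite ?opprK //; split=> -[]; by split.
have TT' : sphere_iso c T T'.
  split.
  - by move=> x sx; apply/T0 => //; case: sx.
  - move=> x [/(phi1 p1) x1 x0]; have [/(phi1 p1) T'1 TT'] := T'P _ x1.
    by apply/T0 => //; rewrite TT'; split => //; apply/(phi1 p1).
  - by move=> x [/(phi1 p1) x1 _]; exact: TK.
  - by move=> x [/(phi1 p1) x1 _]; have [] := T'P _ x1.
  - by move=> x y [x1 _] [y1 _]; exact: Tp.
have signed U U' : sphere_iso c U U' -> exists pi th, signed_basis_map c U pi th.
  move=> UU'; have H i : exists js : nat * R, (0 < i)%N ->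
      [/\ (0 < js.1)%N, js.2 = 1 \/ js.2 = -1,
        U (e i) = js.2 *: e js.1 & U (- e i) = - (js.2 *: e js.1)].
    case: i => [|i]; first by exists (0%N, 0).
    have [j [s js]] : exists j s, [/\ (0 < j)%N, s = 1 \/ s = -1 :> R,
        U (e i.+1) = s *: e j & U (- e i.+1) = - (s *: e j)].
      move: p1; rewrite le_eqVlt => /predU1P[/esym p1'|p1'].
        exact: (signed_basis_eq1 p1' sA UU').
      exact: (signed_basis_gt1 p1' sA UU').
    by exists (j, s).
  have [f fP] := choice H.
  by exists (fun i => (f i).1), (fun i => (f i).2) => i /fP.
have [pi [th Tpi]] := signed _ _ TT'.
have [pi' [th' Tpi']] := signed _ _ (sphere_iso_sym TT').
case=> [|i].
  case: axis => -[-> _]; [exists 1|exists (-1)]; rewrite ?scale1r ?scaleN1r //;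
  by [left|right].
have [_ thi Te _] := Tpi i.+1 isT; exists (th i.+1) => //.
by rewrite Te (basis_map_id p1 sA TT' Tpi Tpi').
Qed.

End SphereIsometry.

(** * Schreier families and completions *)

Section Shift.
Local Open Scope fset_scope.
Local Open Scope nat_scope.

Definition pos n : posn := exist _ n.+1 (ltn0Sn n).

Definition unpos (i : posn) : nat := (val i).-1.

Lemma posK : cancel pos unpos. Proof. by []. Qed.

Lemma unposK : cancel unpos pos.
Proof. by move=> i; apply: val_inj; exact: (prednK (valP i)). Qed.

Lemma leq_unpos i j : (unpos i <= unpos j) = (val i <= val j).
Proof. by rewrite -{2}(unposK i) -{2}(unposK j). Qed.

Lemma pos_inj : injective pos. Proof. exact: can_inj posK. Qed.

Definition fpos (F : {fset nat}) : {fset posn} := [fset pos x | x in F].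

Definition funpos (F : {fset posn}) : {fset nat} := [fset unpos x | x in F].

Lemma in_fpos F i : (i \in fpos F) = (unpos i \in F).
Proof.
apply/imfsetP/idP => [[n nF ->]|iF]; first by rewrite posK.
by exists (unpos i); rewrite ?unposK.
Qed.

Lemma in_funpos F n : (n \in funpos F) = (pos n \in F).
Proof.
apply/imfsetP/idP => [[i iF ->]|nF]; first by rewrite unposK.
by exists (pos n); rewrite ?posK.
Qed.

Lemma fposK : cancel fpos funpos.
Proof. by move=> F; apply/fsetP => n; rewrite in_funpos in_fpos posK. Qed.

Lemma funposK : cancel funpos fpos.
Proof. by move=> F; apply/fsetP => i; rewrite in_fpos in_funpos unposK. Qed.

Lemma card_fpos F : #|` fpos F| = #|` F|.
Proof. by rewrite card_imfset //; exact: pos_inj. Qed.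

Definition shift_family (S : set {fset posn}) : set {fset nat} :=
  fun F => S (fpos F).

Lemma blocks_shift (S : set {fset posn}) n F :
  blocks n (shift_family S) F <->
  exists E : 'I_n -> {fset posn}, [/\ forall i, S (E i),
    forall i j : 'I_n, i < j -> fset_lt (E i) (E j)
    & fpos F = \big[fsetU/fset0]_(i < n) E i].
Proof.
elim: n F => [|n IH] F /=.
  split=> [->|[E [_ _]]]; last first.
    by rewrite big_ord0 => FE; rewrite -(fposK F) FE; apply/fsetP => k; rewrite in_funpos !inE.
  exists (fun=> fset0); split; [by case|by case|].
  by rewrite big_ord0; apply/fsetP => k; rewrite in_fpos !inE.
split.
- move=> [E0 [G [SE0 /IH[E [SE Elt GE]] EG ->]]].
  exists (fun i => if unlift ord0 i is Some j then E j else fpos E0); split.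
  + by move=> i; case: unliftP => [j|] _ //; exact: SE.
  + move=> i j; case: (unliftP ord0 i) => [i'|] ->; case: (unliftP ord0 j) => [j'|] -> //.
      by rewrite ltnS; exact: Elt.
    move=> _ k l; rewrite in_fpos => kE lE.
    have lG : l \in fpos G.
      by rewrite GE (bigD1 j') //= inE lE.
    have := EG _ _ kE; rewrite in_fpos in lG; move=> /(_ _ lG).
    by rewrite -ltnS !prednK ?(valP k) ?(valP l).
  + rewrite big_ord_recl unlift_none; under eq_bigr do rewrite liftK.
    by rewrite -GE; apply/fsetP => k; rewrite inE !in_fpos inE.
- move=> [E [SE Elt FE]]; move: FE; rewrite big_ord_recl => FE.
  exists (funpos (E ord0)), (funpos (\big[fsetU/fset0]_(i < n) E (lift ord0 i))); split.
  + by rewrite /shift_family funposK.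
  + apply/IH; exists (fun i => E (lift ord0 i)); split => //; last by rewrite funposK.
    by move=> i j ij; apply: Elt; rewrite !lift0 ltnS.
  + move=> k l; rewrite !in_funpos => kE /bigfcupP[i _ lE].
    exact: (Elt ord0 (lift ord0 i) isT (pos k) (pos l) kE lE).
  + by apply: (can_inj fposK); rewrite FE; apply/fsetP => k;
      rewrite inE !in_fpos inE !in_funpos unposK.
Qed.

Lemma shift_succ S : shift_family (schreier_succ S) = schreier_next (shift_family S).
Proof.
apply/funext => F; apply/propext; split.
- move=> [n [E [SE nE Elt FE]]]; exists (unpos n); split; last first.
    by rewrite prednK ?(valP n) //; apply/blocks_shift; exists E.
  move=> k kF; have : pos k \in fpos F by rewrite in_fpos posK.
  by rewrite FE => /bigfcupP[i _ /nE]; rewrite -leq_unpos posK.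
- move=> [n [nF /blocks_shift[E [SE Elt FE]]]]; exists (pos n), E; split => //.
  move=> i k kE; have : k \in fpos F.
    by rewrite FE; apply/bigfcupP; exists i; rewrite ?mem_index_enum.
  by rewrite in_fpos => /nF; rewrite -leq_unpos posK.
Qed.

Lemma shift_zero : shift_family [set F : {fset posn} | #|` F| <= 1] = schreier_zero.
Proof.
by apply/funext => F; apply/propext; rewrite /shift_family /schreier_zero /= card_fpos.
Qed.

Lemma shift_limit (S : posn -> set {fset posn}) :
  shift_family [set F | exists n : posn, nle_fset n F /\ S n F] =
  schreier_limit (fun n => shift_family (S (pos n))).
Proof.
apply/funext => F; apply/propext; split.
- move=> [n [nF SF]]; exists (unpos n); split; last by rewrite unposK.
  move=> k kF; have : pos k \in fpos F by rewrite in_fpos posK.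
  by move=> /nF; rewrite -leq_unpos posK.
- move=> [n [nF SF]]; exists (pos n); split => // k.
  by rewrite in_fpos => /nF; rewrite -leq_unpos posK.
Qed.

End Shift.

Lemma well_order_ind (d : Order.disp_t) (W : orderType d) (P : W -> Prop) :
  wochoice.well_order (<=%O : rel W) ->
  (forall a, (forall b, (b < a)%O -> P b) -> P a) -> forall a, P a.
Proof.
move=> wo IH a; apply: contrapT => nPa.
have [|b [[/asboolP nPb bmin] _]] := wo [pred x | `[< ~ P x >]].
  by exists a; apply/asboolP.
apply: nPb; apply: IH => x xb; apply: contrapT => nPx.
by have := bmin x (asboolT nPx); rewrite leNgt xb.
Qed.

Lemma transfinite_schreier_family (d : Order.disp_t) (W : orderType d)
    (appr : W -> posn -> W) (S : W -> set {fset posn}) :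
  is_omega1 W -> transfinite_schreier appr S ->
  forall a, ~ ord_zero a -> schreier_family (shift_family (S a)).
Proof.
move=> [wo _ _] [appP S0 Ssucc Slim].
apply: (well_order_ind wo) => a IH a0.
have [[b ba]|nsucc] := pselect (exists b, ord_succ b a).
  rewrite (Ssucc _ _ ba) shift_succ.
  have [b0|b0] := pselect (ord_zero b).
    by rewrite S0 // shift_zero; exact: schreier_family_one.
  by apply: schreier_family_next; apply: IH => //; case: ba.
have la : ord_limit a by [].
have [appS appN0 [appub _]] := appP a la.
rewrite Slim // shift_limit; apply: schreier_family_limit => n.
apply: IH; last exact: appN0.
(* Being an upper bound gives only a weak inequality; strict growth places the term strictly below
   [a]. *)
have lt : (appr a (pos n) < appr a (pos n.+1))%O by exact: appS.
by apply: (lt_le_trans lt); apply: appub; exists (pos n.+1).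
Qed.

(** * The norm on finitely supported sequences *)

Section SchreierNorm.
Local Open Scope fset_scope.
Local Open Scope ring_scope.
Context {R : realType}.
Variables (p : R) (p1 : 1 <= p) (S : set {fset posn}) (S1 : forall i, S [fset i]).
Implicit Types (F G : {fset posn}) (z w : c00 R).

Local Notation g := (absp p).
Local Notation N := (schreier_norm p S).

Lemma c00_support z : exists F, forall i, i \notin F -> z i = 0.
Proof.
have /asboolP/finite_fsetP[F FE] := c00_finsupp z; exists F => i iF.
apply/eqP; apply: contraT => zi; move: iF.
by have : [set j | z j != 0] i by []; rewrite FE /= => ->.
Qed.

Lemma c00_sumE (I : Type) (s : seq I) (v : I -> c00 R) j :
  (\sum_(i <- s) v i) j = \sum_(i <- s) v i j.
Proof. by elim/big_rec2: _ => // i y x _ <-. Qed.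

Definition c00_restrict F (a : posn -> R) : c00 R :=
  \sum_(i <- F) a i *: c00_basis R i.

Lemma c00_restrictE F a j : c00_restrict F a j = if j \in F then a j else 0.
Proof.
rewrite /c00_restrict c00_sumE.
have E i : (a i *: c00_basis R i) j = a i * (j == i)%:R by [].
under eq_bigr do rewrite E.
case: ifPn => jF; last first.
  rewrite sum_fset_eq0 // => i iF; rewrite (_ : j == i = false) ?mulr0 //.
  by apply: contraNF jF => /eqP->.
rewrite (big_fsetD1 j) //= eqxx mulr1 sum_fset_eq0 ?addr0 // => i.
by rewrite !inE eq_sym => /andP[/negPf-> _]; rewrite mulr0.
Qed.

Lemma powR_invK t : 0 <= t -> (t `^ p^-1) `^ p = t.
Proof.
move=> t0; have p0 : p != 0 by rewrite gt_eqF // (lt_le_trans ltr01).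
by rewrite -powRrM mulVf // powRr1.
Qed.

Lemma schreier_norm_ub z : has_ubound
  [set (\sum_(i <- F) `|z i| `^ p) `^ p^-1 | F in S].
Proof.
have [G zG] := c00_support z.
exists ((\sum_(i <- G) g (z i)) `^ p^-1) => _ [F _ <-].
have pV : 0 <= p^-1 by rewrite invr_ge0 (le_trans ler01).
apply: ge0_ler_powR => //; try by rewrite nnegrE sum_fset_ge0 // => i; exact: powR_ge0.
rewrite (sum_fset_supp (f := fun i => g (z i)) (F := F) (G := G)); last first.
  by move=> i _ /zG ->; rewrite absp0.
by apply: sum_fset_le; [move=> ?; exact: absp_ge0|exact: fsubsetIr].
Qed.

Lemma schreier_norm_ge0 z : 0 <= N z.
Proof.
have i0 : posn := pos 0.
apply: (@le_trans _ _ ((\sum_(i <- [fset i0]) `|z i| `^ p) `^ p^-1)).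
  exact: powR_ge0.
by apply: ub_le_sup; [exact: schreier_norm_ub|exists [fset i0]].
Qed.

Lemma schreier_norm_le z F : S F -> \sum_(i <- F) g (z i) <= g (N z).
Proof.
move=> SF; have s0 : 0 <= \sum_(i <- F) g (z i).
  by apply: sumr_ge0 => i _; exact: absp_ge0.
have H : (\sum_(i <- F) g (z i)) `^ p^-1 <= N z.
  by apply: ub_le_sup; [exact: schreier_norm_ub|exists F].
rewrite -{1}(powR_invK s0) {2}/absp ger0_norm ?schreier_norm_ge0 //.
apply: ge0_ler_powR => //; rewrite ?nnegrE ?powR_ge0 ?schreier_norm_ge0 //.
exact: le_trans p1.
Qed.

Lemma schreier_norm_ge z B :
  (forall F, S F -> \sum_(i <- F) g (z i) <= B) -> g (N z) <= B.
Proof.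
move=> zB; have B0 : 0 <= B.
  apply: le_trans (zB _ (S1 (pos 0))); apply: sumr_ge0 => i _; exact: absp_ge0.
have : N z <= B `^ p^-1.
  apply: ge_sup; first by eexists; exists [fset pos 0].
  move=> _ [F SF <-]; apply: ge0_ler_powR; rewrite ?nnegrE //.
  - by rewrite invr_ge0 (le_trans ler01).
  - by apply: sumr_ge0 => i _; exact: powR_ge0.
  - exact: zB.
move=> H; rewrite -[leRHS](powR_invK B0) /absp ger0_norm ?schreier_norm_ge0 //.
apply: ge0_ler_powR => //; rewrite ?nnegrE ?powR_ge0 ?schreier_norm_ge0 //.
exact: le_trans p1.
Qed.

Lemma schreier_norm_coord z i : `|z i| <= N z.
Proof.
have := schreier_norm_le z (S1 i); rewrite sum_fset1 ler_absp //.
by rewrite [leRHS]ger0_norm ?schreier_norm_ge0.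
Qed.

Lemma schreier_norm_restrict F a : S F ->
  g (N (c00_restrict F a)) = \sum_(i <- F) g (a i).
Proof.
move=> SF; apply/le_anti/andP; split.
  apply: schreier_norm_ge => G _; rewrite (sum_fset_supp (G := F)); last first.
    by move=> i _ /negPf iF; rewrite c00_restrictE iF absp0.
  apply: (@le_trans _ _ (\sum_(i <- G `&` F) g (a i))).
    rewrite big_seq [leRHS]big_seq ler_sum // => i.
    by rewrite inE c00_restrictE => /andP[_ ->].
  by apply: sum_fset_le; [move=> ?; exact: absp_ge0|exact: fsubsetIr].
apply: le_trans (schreier_norm_le _ SF); rewrite big_seq [leRHS]big_seq.
by apply: ler_sum => i iF; rewrite c00_restrictE iF.
Qed.

End SchreierNorm.

(** * Coordinates on the completion *)

Section Completion.
Local Open Scope fset_scope.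
Local Open Scope ring_scope.
Context {R : realType}.
Variables (p : R) (p1 : 1 <= p) (S : set {fset posn}) (S1 : forall i, S [fset i]).
Variables (X : completeNormedModType R) (iota : {linear c00 R -> X}).
Hypothesis hX : is_completion (schreier_norm p S) iota.
Implicit Types (F G : {fset posn}) (z w : c00 R) (x y : X).

Local Notation g := (absp p).
Local Notation N := (schreier_norm p S).

Let iotaN z : `|iota z| = N z. Proof. by have [] := hX. Qed.

Lemma completion_approx x d : 0 < d -> exists z, `|x - iota z| < d.
Proof.
move=> d0; have [_ dn] := hX.
have [|y [xb [z _ zy]]] := dn (ball x d) _ (ball_open x d).
  by exists x; exact: ballxx.
by exists z; move: xb; rewrite -zy -ball_normE.
Qed.

(** McShane's formula for the 1-Lipschitz extension of a coordinate from the dense image of [iota];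
    no approximating sequence has to be chosen. *)
Definition ccoord x i : R := sup [set z i - `|x - iota z| | z in [set: c00 R]].

Lemma c00_coord_dist z w i : z i - w i <= `|iota z - iota w|.
Proof.
rewrite -(linearB iota) iotaN; apply: le_trans (schreier_norm_coord p1 S1 (z - w) i).
exact: ler_norm.
Qed.

Lemma ccoord_approx x i z : `|ccoord x i - z i| <= `|x - iota z|.
Proof.
have ub w : w i - `|x - iota w| <= z i + `|x - iota z|.
  have := c00_coord_dist w z i; have := ler_normD (iota w - x) (x - iota z).
  by rewrite addrA subrK -(distrC x); lra.
rewrite ler_distl; apply/andP; split.
  apply: ub_le_sup; last by exists z.
  by exists (z i + `|x - iota z|) => _ [w _ <-]; exact: ub.
apply: ge_sup; first by exists (z i - `|x - iota z|); exists z.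
by move=> _ [w _ <-]; exact: ub.
Qed.

Lemma eq_small (a b : R) : (forall d, 0 < d -> `|a - b| <= d) -> a = b.
Proof.
move=> ab; apply/eqP; rewrite -subr_eq0 -normr_eq0 eq_le normr_ge0 andbT.
by apply/ler_addgt0Pr => d d0; rewrite add0r; exact: ab.
Qed.

Lemma ccoordB x y i : ccoord (x - y) i = ccoord x i - ccoord y i.
Proof.
apply: eq_small => d d0; have d4 : 0 < d / 4 by rewrite divr_gt0.
have [z xz] := completion_approx x d4; have [w yw] := completion_approx y d4.
have := ccoord_approx (x - y) i (z - w).
rewrite (_ : (z - w) i = z i - w i) // (linearB iota).
have -> : x - y - (iota z - iota w) = (x - iota z) - (y - iota w).
  by rewrite !opprD !opprK addrACA.
move=> H; have := le_trans H (ler_normB _ _).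
have := ccoord_approx x i z; have := ccoord_approx y i w.
rewrite !ler_norml => /andP[? ?] /andP[? ?] /andP[? ?]; apply/andP; split; lra.
Qed.

Lemma ccoordZ a x i : ccoord (a *: x) i = a * ccoord x i.
Proof.
apply: eq_small => d d0.
have a0 : 0 < 2 * `|a| + 1 by have := normr_ge0 a; lra.
have [z xz] := completion_approx x (divr_gt0 d0 a0).
have := ccoord_approx (a *: x) i (a *: z).
rewrite (_ : (a *: z) i = a * z i) // (linearZ_LR iota) -scalerBr normrZ => H.
have -> : ccoord (a *: x) i - a * ccoord x i =
    (ccoord (a *: x) i - a * z i) - a * (ccoord x i - z i) by rewrite mulrBr; lra.
apply: le_trans (ler_normB _ _) _; rewrite normrM.
have H' : `|a| * `|ccoord x i - z i| <= `|a| * `|x - iota z|.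
  by apply: ler_wpM2l => //; exact: ccoord_approx.
have H2 : `|a| * `|x - iota z| <= `|a| * (d / (2 * `|a| + 1)).
  by apply: ler_wpM2l => //; exact: ltW.
have H3 : (2 * `|a| + 1) * (d / (2 * `|a| + 1)) = d by rewrite mulrC divfK // gt_eqF.
have H4 : 0 <= d / (2 * `|a| + 1) by rewrite ltW // divr_gt0.
lra.
Qed.

Lemma ccoord_iota z i : ccoord (iota z) i = z i.
Proof.
have := ccoord_approx (iota z) i z; rewrite subrr normr0 normr_le0 subr_eq0.
by move/eqP.
Qed.

Lemma norm_restrict_le F a : `|iota (c00_restrict F a)| <= \sum_(i <- F) `|a i|.
Proof.
rewrite linear_sum; apply: le_trans (ler_norm_sum _ _ _) _.
apply: ler_sum => i _; rewrite linearZ normrZ ler_piMr //.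
rewrite iotaN; apply: (@le_trans _ _ `|N (c00_basis R i)|); first exact: ler_norm.
rewrite -(absp_le1 _ p1); apply: schreier_norm_ge => // G _.
rewrite (sum_fset_supp (G := [fset i])).
  apply: (@le_trans _ _ (\sum_(j <- [fset i]) g (c00_basis R i j))).
    by apply: sum_fset_le; [move=> ?; exact: absp_ge0|exact: fsubsetIr].
  by rewrite sum_fset1 /= eqxx absp1.
by move=> j _; rewrite inE /= => /negPf ->; rewrite absp0.
Qed.

Lemma restrictB F (a b : posn -> R) : c00_restrict F (fun i => a i - b i) =
  c00_restrict F a - c00_restrict F b.
Proof.
rewrite /c00_restrict -sumrB; apply: eq_bigr => i _.
by rewrite scalerBl.
Qed.

(** Restriction to [F] does not increase the norm of finitely supported vectors. The approximation
    error enters once through the norm and once per index of [F], hence the factor [K0]. *)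
Lemma norm_restrict_ccoord F x : S F -> `|iota (c00_restrict F (ccoord x))| <= `|x|.
Proof.
move=> SF; apply/ler_addgt0Pr => d d0.
have K0 : 0 < (#|` F|)%:R + 1 :> R by rewrite ltr_wpDl.
have [z xz] := completion_approx x (divr_gt0 d0 K0).
have -> : ccoord x = (fun i => z i - (z i - ccoord x i)).
  by apply/funext => i; rewrite subKr.
rewrite restrictB (linearB iota); apply: le_trans (ler_normB _ _) _.
have H1 : `|iota (c00_restrict F z)| <= `|iota z|.
  rewrite -[leLHS]normr_id -[leRHS]normr_id -(ler_absp _ _ p1) !iotaN.
  apply: le_trans (schreier_norm_le p1 S1 z SF).
  by rewrite -(schreier_norm_restrict p1 S1 z SF).
have H2 : `|iota z| <= `|x| + `|x - iota z|.
  by have := ler_normB x (x - iota z); rewrite subKr.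
have H3 := norm_restrict_le F (fun i => z i - ccoord x i).
have H4 : \sum_(i <- F) `|z i - ccoord x i| <= (#|` F|)%:R * `|x - iota z|.
  apply: (@le_trans _ _ (\sum_(i <- F) `|x - iota z|)).
    by apply: ler_sum => i _; rewrite distrC ccoord_approx.
  by rewrite (@sum_fset_const _ _ _ `|x - iota z|) // mulr_natl.
have H5 : ((#|` F|)%:R + 1) * `|x - iota z| <= d.
  by rewrite mulrC -ler_pdivlMr // ltW.
rewrite mulrDl mul1r in H5; lra.
Qed.

Lemma ccoord_le x F : S F -> \sum_(i <- F) g (ccoord x i) <= g `|x|.
Proof.
move=> SF; rewrite -(schreier_norm_restrict p1 S1 _ SF) -iotaN ler_absp // !normr_id.
exact: norm_restrict_ccoord.
Qed.

Lemma ccoord_ge x B : (forall F, S F -> \sum_(i <- F) g (ccoord x i) <= B) ->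
  g `|x| <= B.
Proof.
move=> xB; have B0 : 0 <= B.
  apply: le_trans (xB _ (S1 (pos 0))); apply: sumr_ge0 => i _; exact: absp_ge0.
have [b b0 gb] := absp_surj p1 B0.
rewrite -gb ler_absp // normr_id (ger0_norm b0).
apply/ler_addgt0Pr => d d0; have d2 : 0 < d / 2 by rewrite divr_gt0.
have [z xz] := completion_approx x d2.
have : N z <= b + d / 2.
  have bd : 0 <= b + d / 2 by rewrite addr_ge0 // ltW.
  rewrite -[leLHS]ger0_norm ?schreier_norm_ge0 // -[leRHS]ger0_norm // -(ler_absp _ _ p1).
  apply: schreier_norm_ge => // F SF.
  rewrite -(schreier_norm_restrict p1 S1 _ SF) -iotaN ler_absp // normr_id.
  rewrite [leRHS]ger0_norm //.
  have -> : (z : posn -> R) = (fun i => ccoord x i - (ccoord x i - z i)).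
    by apply/funext => i; rewrite subKr.
  rewrite restrictB (linearB iota); apply: le_trans (ler_normB _ _) _; apply: lerD.
    rewrite -(ger0_norm b0) -[leLHS]normr_id -(ler_absp _ _ p1) gb iotaN.
    by rewrite (schreier_norm_restrict p1 S1 _ SF); exact: xB.
  have -> : (fun i => ccoord x i - z i) = ccoord (x - iota z).
    by apply/funext => i; rewrite ccoordB ccoord_iota.
  exact: le_trans (norm_restrict_ccoord _ SF) (ltW xz).
rewrite -iotaN; have := ler_normD (iota z) (x - iota z).
rewrite addrC subrK; lra.
Qed.

(** Beyond the support of a finitely supported [z] close to [x], the coordinates of [x] are those of
    [x - iota z]. *)
Lemma ccoord_tail x d : 0 < d -> exists M, forall F, S F ->
  (forall k, k \in F -> (M <= unpos k)%N) -> \sum_(i <- F) g (ccoord x i) <= d.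
Proof.
move=> d0; have [t t0 gt] := absp_surj p1 (ltW d0).
have t00 : 0 < t.
  rewrite lt_neqAle t0 andbT; apply: contraTneq d0 => tE.
  by rewrite -gt -tE absp0 // ltxx.
have [z xz] := completion_approx x t00; have [G zG] := c00_support z.
exists (\max_(i <- G) unpos i).+1 => F SF FM.
rewrite -gt; apply: (@le_trans _ _ (g `|x - iota z|)).
  apply: le_trans (ccoord_le _ SF); rewrite big_seq [leRHS]big_seq.
  apply: ler_sum => i iF; rewrite ccoordB ccoord_iota zG ?subr0 //.
  apply/negP => iG; have := FM _ iF; rewrite ltnNge => /negP; apply.
  exact: (leq_bigmax_seq (F := unpos)).
by rewrite ler_absp // normr_id ger0_norm // ltW.
Qed.

Lemma sum_fpos (F : {fset nat}) (f : posn -> R) :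
  \sum_(i <- fpos F) f i = \sum_(i <- F) f (pos i).
Proof. by rewrite big_imfset // => i j _ _; exact: pos_inj. Qed.

(** Kept transparent because [completion_basis] computes with the field [vec]. *)
Definition completion_coord : coordinate_system p (shift_family S) X.
Proof.
refine (@CoordinateSystem R p (shift_family S) X (fun x i => ccoord x (pos i))
  (fun H a => iota (c00_restrict (fpos H) (fun i => a (unpos i)))) _ _ _ _ _ _).
- by move=> x y i; exact: ccoordB.
- by move=> a x i; exact: ccoordZ.
- by move=> F a i; rewrite ccoord_iota c00_restrictE in_fpos posK.
- move=> x F SF; have := ccoord_le x SF; by rewrite sum_fpos.
- move=> x B xB; apply: ccoord_ge => F SF; rewrite -[F]funposK sum_fpos.
  by apply: xB; rewrite /shift_family funposK.
- move=> x d d0; have [M MP] := ccoord_tail x d0; exists M => F SF FM.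
  rewrite -(sum_fpos _ (fun i => g (ccoord x i))); apply: MP => // k.
  by rewrite in_fpos => /FM.
Defined.

Lemma completion_basis i : unit_vec completion_coord i = iota (c00_basis R (pos i)).
Proof.
rewrite /unit_vec /=; congr (iota _); apply: val_inj; apply/funext => j /=.
rewrite c00_restrictE in_fpos inE; have [->|ji] := eqVneq j (pos i).
  by rewrite posK eqxx.
by case: eqP => // uj; rewrite -uj unposK eqxx in ji.
Qed.

End Completion.

Theorem proposition1p3 (d : Order.disp_t) (W : orderType d)
    (hW : is_omega1 W)
    (appr : W -> posn -> W) (S : W -> set {fset posn})
    (hS : transfinite_schreier appr S)
    (a : W) (ha : ~ ord_zero a)
    (R : realType) (p : R) (hp : 1 <= p)
    (hgood : 1 < p -> p != 2 -> good_schreier appr S)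
    (X : completeNormedModType R) (iota : {linear c00 R -> X})
    (hX : is_completion (schreier_norm p (S a)) iota)
    (T : X -> X)
    (Tsphere : set_fun (unit_sphere X) (unit_sphere X) T)
    (Tsurj : set_surj (unit_sphere X) (unit_sphere X) T)
    (Tisom : forall x y, unit_sphere X x -> unit_sphere X y ->
       `|T x - T y| = `|x - y|) :
  exists theta : posn -> R,
    (forall i, theta i = 1 \/ theta i = -1) /\
    (forall i, T (iota (c00_basis R i)) = theta i *: iota (c00_basis R i)).
Proof.
have sA := transfinite_schreier_family hW hS ha.
have S1 i : S a [fset i]%fset.
  have := singletonA sA (unpos i); rewrite /shift_family.
  rewrite (_ : fpos _ = [fset i]%fset) //; apply/fsetP => j.
  by rewrite in_fpos !inE (can_eq unposK).
pose c := completion_coord hp S1 hX.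
have H i : exists s : R, (s = 1 \/ s = -1) /\
    T (iota (c00_basis R i)) = s *: iota (c00_basis R i).
  have Tsurj' y : `|y| = 1 -> exists2 x, `|x| = 1 & T x = y.
    by move=> /Tsurj[x x1 xy]; exists x.
  have [s s1 Ts] := sphere_isometry_signs c hp sA Tsphere Tsurj' Tisom (unpos i).
  by exists s; split => //; move: Ts; rewrite completion_basis unposK.
have [theta thetaP] := choice H.
by exists theta; split => i; have [] := thetaP i.
Qed.
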